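(* Suppose that $\ell=p$ and $v(c)=-p/(p-1)$, and let $0\le n<\infty$ be an integer. Let $b\in\overline{K}$ be a fixed point of $f(z)$. (a) If $\mu_p\subset K$, then $G(n)/I(n)$ is a cyclic $p$-group. (b) The group $I(n)$ is a $p$-group. (c) If $v(a)>v(c)$, then $I(n)$ is an elementary abelian $p$-group of order dividing $p^n$. (d) If $\mu_p\subset K$, then $G(\infty)/I(\infty)\cong\mathbb{Z}_p$. (e) If $v(a-b)<0$, then $I(\infty)$ is an infinite pro-$p$ group; if, moreover, $v(a)>v(c)$, then $I(\infty)\simeq(\mathbb{Z}/p\mathbb{Z})^\infty$. (f) If $v(a-b)\ge 0$, then $I(\infty)=\{1\}$.
   Context: $p$ is a prime, $K$ is a finite extension of $\mathbb{Q}_p$ with valuation $v$ normalized by $v(p)=1$ and extended to an algebraic closure $\overline{K}$; $f(z)=z^p-c$ with $c\in K^\times$ (i.e. $\ell=p$ is the degree of $f$). $f^n$ is the $n$-th iterate of $f$; $a\in K$ is such that for every $n\ge0$ the solutions of $f^n(z)=a$ in $\overline{K}$ are distinct; $f^{-n}(a)$ is the set of these solutions; $K_n=K(f^{-n}(a))$; $K_\infty=\bigcup_{n\ge1}K_n$. For $0\le n\le\infty$, $G(n)=\mathrm{Gal}(K_n/K)$ and $I(n)$ is its inertia subgroup. $\mu_p$ is the group of $p$-th roots of unity. $(\mathbb{Z}/p\mathbb{Z})^\infty$ denotes the product of countably infinitely many copies of $\mathbb{Z}/p\mathbb{Z}$ (as a profinite group). *)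

(* Defs.v *)
From HB Require Import structures.
From mathcomp Require Import all_boot all_order all_algebra fieldext.
From mathcomp Require Import mathcomp_extra boolp classical_sets functions.
From mathcomp Require Import cardinality constructive_ereal topology normedtype.

Set Implicit Arguments.
Unset Strict Implicit.
Unset Printing Implicit Defensive.

Import Order.TTheory GRing.Theory Num.Theory.

Local Open Scope classical_set_scope.
Local Open Scope card_scope.
Local Open Scope ring_scope.

(* Values in [\bar rat] lose no generality over an algebraic closure of Q_p:
   with [v p = 1] the value group of an algebraic extension of Q_p is contained
   in the rationals. *)
Record valuation (F : fieldType) := Valuation {
  val_of :> F -> \bar rat;
  val_pinfty : forall x, val_of x = +oo%E <-> x = 0;
  val_ninfty : forall x, val_of x <> -oo%E;
  valM : forall x y, val_of (x * y)%R = (val_of x + val_of y)%E;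
  valD : forall x y, (Order.min (val_of x) (val_of y) <= val_of (x + y)%R)%E }.

Section ValuationTheory.
Variables (F : fieldType) (v : valuation F).

Lemma val0 : v 0 = +oo%E.
Proof. exact/val_pinfty. Qed.

Lemma val_fin x : x != 0 -> exists r : rat, v x = r%:E.
Proof.
case E: (v x) => [r| |] x0; first by exists r.
- by have /val_pinfty x0' := E; rewrite x0' eqxx in x0.
- by have := val_ninfty E.
Qed.

Lemma val1 : v 1 = 0%E.
Proof.
have [r vr] := val_fin (oner_neq0 F).
have := valM v 1 1; rewrite mulr1 vr -EFinD => -[] /eqP.
by rewrite eq_sym addrC -subr_eq0 addrK => /eqP ->.
Qed.

Lemma valN x : v (- x) = v x.
Proof.
suff vN1 : v (- 1) = 0%E by rewrite -mulN1r valM vN1 add0e.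
have N1 : (- 1 : F) != 0 by rewrite oppr_eq0 oner_neq0.
have [r vr] := val_fin N1.
have := valM v (- 1) (- 1); rewrite mulN1r opprK val1 vr -EFinD => -[] /eqP.
by rewrite eq_sym -mulr2n mulrn_eq0 /= => /eqP ->.
Qed.

Lemma valD_gt (r : \bar rat) x y :
  (r < v x)%E -> (r < v y)%E -> (r < v (x + y)%R)%E.
Proof. by move=> rx ry; rewrite (lt_le_trans _ (valD v x y))// lt_min rx ry. Qed.

Lemma valD_ge (r : \bar rat) x y :
  (r <= v x)%E -> (r <= v y)%E -> (r <= v (x + y)%R)%E.
Proof. by move=> rx ry; rewrite (le_trans _ (valD v x y))// le_min rx ry. Qed.

Lemma valV_lt0 x : (v x < 0)%E -> (0 < v (x^-1)%R)%E.
Proof.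
have [->|x0] := eqVneq x 0; first by rewrite val0.
have xV0 : x^-1 != 0 by rewrite invr_eq0.
have [r vr] := val_fin x0; have [s vs] := val_fin xV0.
have := valM v x x^-1; rewrite mulfV// val1 vr vs -EFinD => -[] /esym rs0.
by rewrite !lte_fin -(addr0_eq rs0) oppr_gt0.
Qed.

Lemma valV_gt0 x : x != 0 -> (0 < v (x^-1)%R)%E -> (v x < 0)%E.
Proof.
move=> x0; have xV0 : x^-1 != 0 by rewrite invr_eq0.
have [r vr] := val_fin x0; have [s vs] := val_fin xV0.
have := valM v x x^-1; rewrite mulfV// val1 vr vs -EFinD => -[] /esym rs0.
by rewrite !lte_fin -(addr0_eq rs0) oppr_gt0.
Qed.

End ValuationTheory.

(* The topology defined by a valuation, with basic neighbourhoods
   [{y | r < v (y - x)}] of [x]. *)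
Definition valued (F : fieldType) (v : valuation F) : Type := F.

Section ValuedTopology.
Variables (F : fieldType) (v : valuation F).

HB.instance Definition _ := GRing.Field.copy (valued v) F.

Definition valued_open (U : set (valued v)) : Prop :=
  forall x, U x -> exists r : rat,
    forall y : F, (r%:E < v (y - (x : F))%R)%E -> U y.

Lemma valued_openT : valued_open setT.
Proof. by move=> x _; exists 0. Qed.

Lemma valued_openI : setI_closed valued_open.
Proof.
move=> U V oU oV x [/oU[r rU] /oV[s sV]]; exists (Order.max r s) => y.
rewrite EFin_max gt_max => /andP[ry sy]; split; [exact: rU|exact: sV].
Qed.

Lemma valued_open_bigcup (I : Type) (U : I -> set (valued v)) :
  (forall i, valued_open (U i)) -> valued_open (\bigcup_i U i).
Proof.
move=> oU x [i _ /oU[r rU]]; exists r => y /rU; by exists i.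
Qed.

HB.instance Definition _ := isOpenTopological.Build (valued v)
  valued_openT valued_openI valued_open_bigcup.

End ValuedTopology.

(* For [p] prime, [F] with [w] is a completion of the rationals for the [p]-adic valuation,
   i.e. it is (up to a unique isomorphism) Q_p with its normalized valuation.
   The first clause determines [w] on the rationals. *)
Record is_Qp (p : nat) (F : fieldType) (w : valuation F) : Prop := IsQp {
  Qp_val : forall m : nat, (0 < m)%N -> w m%:R = (logn p m)%:R%:E;
  Qp_dense : forall (x : F) (r : rat),
    exists q : rat, (r%:E < w (x - ratr q)%R)%E;
  Qp_complete : forall u : nat -> F,
    (forall r : rat, exists N : nat, forall m n : nat,
       (N <= m)%N -> (N <= n)%N -> (r%:E < w (u m - u n)%R)%E) ->
    exists l : F, forall r : rat, exists N : nat, forall n : nat,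
       (N <= n)%N -> (r%:E < w (u n - l)%R)%E }.

(* The valuation ring, as an additive topological group; it is Z_p when
   [is_Qp p w]. *)
Section ValuationRing.
Variables (F : fieldType) (w : valuation F).

Definition val_ring : {pred F} := [pred x | (0 <= w x)%E].

Lemma val_ring_zmod : zmod_closed val_ring.
Proof.
split=> [|x y]; rewrite !inE ?val0// => x0 y0.
by apply: valD_ge; rewrite ?valN.
Qed.

HB.instance Definition _ := GRing.isZmodClosed.Build F val_ring val_ring_zmod.

Definition valuation_ring : Type := {x : F | x \in val_ring}.
HB.instance Definition _ := SubType.on valuation_ring.
HB.instance Definition _ := [Choice of valuation_ring by <:].
HB.instance Definition _ := [SubChoice_isSubZmodule of valuation_ring by <:].
HB.instance Definition _ := Topological.copy valuation_ring
  (initial_topology (val : valuation_ring -> valued w)).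

End ValuationRing.

(* The product of countably many copies of Z/pZ, each with the discrete
   topology ('Z_p is Z/pZ because p is at least 2). *)
Definition Zmodp_infty (p : nat) : Type := nat -> 'Z_p.
HB.instance Definition _ p := GRing.Zmodule.copy (Zmodp_infty p) (nat -> 'Z_p).
HB.instance Definition _ p := Topological.copy (Zmodp_infty p)
  {ptws nat -> discrete_topology 'Z_p}.

#[short(type="pretopGroupType")]
HB.structure Definition PreTopologicalGroup := {G of Group G & Topological G}.

Definition is_topological_group (G : pretopGroupType) : Prop :=
  continuous (fun x : G * G => (x.1 * x.2)%g) /\
  continuous (fun x : G => (x^-1)%g).

Definition is_profinite (G : pretopGroupType) : Prop :=
  [/\ is_topological_group G, compact [set: G], hausdorff_space G &
      totally_disconnected [set: G]].

Definition topgroup_isog (G : pretopGroupType)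
    (A : PreTopologicalZmodule.type) : Prop :=
  exists (f : G -> A) (g : A -> G),
    [/\ cancel f g, cancel g f, {morph f : x y / (x * y)%g >-> x + y},
        continuous f & continuous g].

Definition has_order (G : groupType) (m : nat) : Prop := [set: G] #= `I_m.

Definition finite_pgroup (p : nat) (G : groupType) : Prop :=
  exists k : nat, has_order G (p ^ k)%N.

Definition is_cyclic (G : groupType) : Prop :=
  exists g : G, forall x : G, exists k : nat, x = (g ^+ k)%g \/ x = (g ^- k)%g.

Definition is_pelem (p : nat) (G : groupType) : Prop :=
  (forall x y : G, commute x y) /\ (forall x : G, (x ^+ p = 1)%g).

Section Subgroup.
Variables (G : groupType) (H : groupClosed G).

Definition subgroup_of : Type := {x : G | x \in H}.
HB.instance Definition _ := SubType.on subgroup_of.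
HB.instance Definition _ := [Choice of subgroup_of by <:].
Lemma groupClosed_closed : group_closed (H : {pred G}).
Proof. by split; [exact: gpred1|move=> x y xH yH; exact: gpredF]. Qed.
HB.instance Definition _ :=
  SubChoice_isSubGroup.Build G _ subgroup_of groupClosed_closed.

Definition is_normal : Prop := forall x y : G, x \in H -> (x ^ y)%g \in H.

End Subgroup.

HB.instance Definition _ (G : pretopGroupType) (H : groupClosed G) :=
  Topological.copy (subgroup_of H)
    (initial_topology (val : subgroup_of H -> G)).

Section QuotientGroup.
Variables (G : groupType) (H : groupClosed G).

Definition coset_rel : rel G := fun x y => (x^-1 * y)%g \in H.

Lemma coset_rel_equiv : equiv_class_of coset_rel.
Proof.
split=> [x|x y|y x z]; rewrite /coset_rel.
- by rewrite mulVg gpred1.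
- by rewrite -gpredV invgM invgK.
- move=> xy yz; have -> : (x^-1 * z = (x^-1 * y) * (y^-1 * z))%g.
    by rewrite mulgA mulgK.
  exact: gpredM.
Qed.
Canonical coset_equiv := EquivRelPack coset_rel_equiv.

Definition quotient_group (nH : is_normal H) : Type :=
  {eq_quot coset_equiv}%qT.

Variable nH : is_normal H.
Local Notation Q := (quotient_group nH).

HB.instance Definition _ := Choice.on Q.
HB.instance Definition _ := EqQuotient.on Q.

Local Notation pr := (\pi_Q)%qT.

Lemma quot_eqP (x y : G) : pr x = pr y <-> coset_rel x y.
Proof. by split=> /(@eqquotP _ _ Q). Qed.

Definition quot_one : Q := pr 1%g.
Definition quot_inv (x : Q) : Q := pr (repr x)^-1%g.
Definition quot_mul (x y : Q) : Q := pr (repr x * repr y)%g.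

Lemma quot_mulE x y : quot_mul (pr x) (pr y) = pr (x * y)%g.
Proof.
apply/quot_eqP; rewrite /coset_rel.
have rx : coset_rel (repr (pr x)) x by apply/quot_eqP; rewrite reprK.
have ry : coset_rel (repr (pr y)) y by apply/quot_eqP; rewrite reprK.
set x' := repr _ in rx *; set y' := repr _ in ry *.
have -> : ((x' * y')^-1 * (x * y) = (x'^-1 * x) ^ y' * (y'^-1 * y))%g.
  by rewrite invgM /conjg -!mulgA mulVKg.
by apply: gpredM => //; exact: nH.
Qed.

Lemma quot_invE x : quot_inv (pr x) = pr x^-1%g.
Proof.
apply/quot_eqP; rewrite /coset_rel.
have rx : coset_rel (repr (pr x)) x by apply/quot_eqP; rewrite reprK.
set x' := repr _ in rx *; rewrite invgK -gpredV invgM invgK.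
have := nH x'^-1%g rx; rewrite /conjg invgK -mulgA mulVKg; exact.
Qed.

Lemma quot_mulA : associative quot_mul.
Proof.
elim/quotW=> x; elim/quotW=> y; elim/quotW=> z.
by rewrite (quot_mulE y z) (quot_mulE x y) !quot_mulE mulgA.
Qed.

Lemma quot_mul1 : left_id quot_one quot_mul.
Proof. by elim/quotW=> x; rewrite quot_mulE mul1g. Qed.

Lemma quot_mulr1 : right_id quot_one quot_mul.
Proof. by elim/quotW=> x; rewrite quot_mulE mulg1. Qed.

Lemma quot_mulV : left_inverse quot_one quot_inv quot_mul.
Proof. by elim/quotW=> x; rewrite quot_invE quot_mulE mulVg. Qed.

Lemma quot_mulrV : right_inverse quot_one quot_inv quot_mul.
Proof. by elim/quotW=> x; rewrite quot_invE quot_mulE mulgV. Qed.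

HB.instance Definition _ := isGroup.Build Q
  quot_mulA quot_mul1 quot_mulr1 quot_mulV quot_mulrV.

End QuotientGroup.

Section QuotientTopology.
Variables (G : pretopGroupType) (H : groupClosed G) (nH : is_normal H).
Local Notation Q := (quotient_group nH).

Definition quot_open (U : set Q) : Prop := open (\pi_Q%qT @^-1` U : set G).

Lemma quot_openT : quot_open setT.
Proof. by rewrite /quot_open preimage_setT; exact: openT. Qed.

Lemma quot_openI : setI_closed quot_open.
Proof. by move=> U V; exact: openI. Qed.

Lemma quot_open_bigcup (I : Type) (U : I -> set Q) :
  (forall i, quot_open (U i)) -> quot_open (\bigcup_i U i).
Proof. by move=> oU; apply: bigcup_open => i _; exact: oU. Qed.

HB.instance Definition _ := isOpenTopological.Build Q
  quot_openT quot_openI quot_open_bigcup.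

End QuotientTopology.

Definition is_pro_p (p : nat) (G : pretopGroupType) : Prop :=
  is_profinite G /\
  forall (N : groupClosed G) (nN : is_normal N),
    open [set x : G | x \in N] -> finite_pgroup p (quotient_group nN).

Section Subfield.
Variables (F : fieldType) (S : divringClosed F).

Definition subfield_of : Type := {x : F | x \in S}.
HB.instance Definition _ := SubType.on subfield_of.
HB.instance Definition _ := [Choice of subfield_of by <:].
HB.instance Definition _ :=
  [SubChoice_isSubIntegralDomain of subfield_of by <:].
HB.instance Definition _ := [SubIntegralDomain_isSubField of subfield_of by <:].

End Subfield.

Section Galois.
Variables (K F : fieldType) (iota : {rmorphism K -> F}).

(* The field [K(A)], with [K] embedded in [F] by [iota]. *)
Definition adjoin (A : set F) : {pred F} := fun x =>
  `[< forall S : divringClosed F,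
       (forall k : K, iota k \in S) -> (forall y, A y -> y \in S) -> x \in S >].

Lemma adjoin_closed A : divring_closed (adjoin A).
Proof.
split=> [|x y|x y].
- by apply/asboolP => S _ _; exact: rpred1.
- move=> /asboolP xA /asboolP yA; apply/asboolP => S KS AS.
  by rewrite rpredB ?xA ?yA.
- move=> /asboolP xA /asboolP yA; apply/asboolP => S KS AS.
  by rewrite rpred_div ?xA ?yA.
Qed.
HB.instance Definition _ A :=
  GRing.isDivringClosed.Build F (adjoin A) (adjoin_closed A).

Lemma sub_adjoin (A : set F) x : A x -> x \in adjoin A.
Proof. by move=> Ax; apply/asboolP => S _; exact. Qed.

Lemma base_adjoin (A : set F) k : iota k \in adjoin A.
Proof. by apply/asboolP => S + _; exact. Qed.

Lemma adjoin_min (A : set F) (S : divringClosed F) :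
  (forall k, iota k \in S) -> (forall y, A y -> y \in S) ->
  {subset adjoin A <= S}.
Proof. by move=> KS AS x /asboolP; exact. Qed.

Section GaloisGroup.
Variable S : divringClosed F.
Local Notation L := (subfield_of S).

Record is_gal (f : L -> L) : Prop := IsGal {
  galD : {morph f : x y / x + y};
  galM : {morph f : x y / x * y};
  galK : forall (k : K) (x : L), val x = iota k -> f x = x;
  gal_bij : bijective f }.

Record galois_group := Gal { gal_fun :> L -> L; galP : is_gal gal_fun }.

HB.instance Definition _ := gen_eqMixin galois_group.
HB.instance Definition _ := gen_choiceMixin galois_group.

Lemma galE (s t : galois_group) : s =1 t -> s = t.
Proof.
case: s t => [f fP] [g gP] /= /funext fg; case: _ / fg gP => gP.
by congr Gal; exact: Prop_irrelevance.
Qed.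

Lemma is_gal_id : is_gal id.
Proof. by split=> //; exists id. Qed.

Lemma is_gal_comp (s t : galois_group) : is_gal (s \o t).
Proof.
case: s t => [f [fD fM fK fb]] [g [gD gM gK gb]]; split=> /=.
- by move=> x y /=; rewrite gD fD.
- by move=> x y /=; rewrite gM fM.
- by move=> k x xk /=; rewrite (gK k)// (fK k).
- exact: bij_comp.
Qed.

Lemma gal_inv_ex (s : galois_group) : exists g : L -> L, cancel s g /\ cancel g s.
Proof. by case: (gal_bij (galP s)) => g sg gs; exists g. Qed.

Definition gal_inv_fun (s : galois_group) : L -> L := projT1 (cid (gal_inv_ex s)).

Lemma gal_funK (s : galois_group) : cancel s (gal_inv_fun s).
Proof. by rewrite /gal_inv_fun; case: cid => g []. Qed.

Lemma gal_invK (s : galois_group) : cancel (gal_inv_fun s) s.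
Proof. by rewrite /gal_inv_fun; case: cid => g []. Qed.

Lemma is_gal_inv (s : galois_group) : is_gal (gal_inv_fun s).
Proof.
have sI := can_inj (gal_funK s); have [sD sM sK _] := galP s; split.
- by move=> x y; apply: sI; rewrite sD !gal_invK.
- by move=> x y; apply: sI; rewrite sM !gal_invK.
- by move=> k x xk; apply: sI; rewrite gal_invK (sK k).
- by exists s; [exact: gal_invK|exact: gal_funK].
Qed.

Definition gal_one : galois_group := Gal is_gal_id.
Definition gal_mul (s t : galois_group) : galois_group := Gal (is_gal_comp s t).
Definition gal_inv (s : galois_group) : galois_group := Gal (is_gal_inv s).

Lemma gal_mulA : associative gal_mul.
Proof. by move=> s t u; exact: galE. Qed.
Lemma gal_mul1 : left_id gal_one gal_mul.
Proof. by move=> s; exact: galE. Qed.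
Lemma gal_mulr1 : right_id gal_one gal_mul.
Proof. by move=> s; exact: galE. Qed.
Lemma gal_mulV : left_inverse gal_one gal_inv gal_mul.
Proof. by move=> s; apply: galE => x /=; rewrite gal_funK. Qed.
Lemma gal_mulrV : right_inverse gal_one gal_inv gal_mul.
Proof. by move=> s; apply: galE => x /=; rewrite gal_invK. Qed.

HB.instance Definition _ := isGroup.Build galois_group
  gal_mulA gal_mul1 gal_mulr1 gal_mulV gal_mulrV.

(* Krull topology: the basic neighbourhoods of [s] are the cosets [s Gal(L/M)]
   with [M] generated over [K] by the finite list [xs]. *)
Definition gal_open (U : set galois_group) : Prop :=
  forall s, U s -> exists xs : seq L,
    forall t : galois_group, {in xs, s =1 t} -> U t.

Lemma gal_openT : gal_open setT.
Proof. by move=> s _; exists [::]. Qed.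

Lemma gal_openI : setI_closed gal_open.
Proof.
move=> U V oU oV s [/oU[xs xsU] /oV[ys ysV]]; exists (xs ++ ys) => t st.
by split; [apply: xsU|apply: ysV] => x xs_x; apply: st;
  rewrite mem_cat xs_x ?orbT.
Qed.

Lemma gal_open_bigcup (I : Type) (U : I -> set galois_group) :
  (forall i, gal_open (U i)) -> gal_open (\bigcup_i U i).
Proof. by move=> oU s [i _ /oU[xs xsU]]; exists xs => t /xsU; exists i. Qed.

HB.instance Definition _ := isOpenTopological.Build galois_group
  gal_openT gal_openI gal_open_bigcup.

Variable v : valuation F.

(* The elements of [Gal(L/K)] acting trivially on the residue field of [L]. *)
Definition inertia_group : {pred galois_group} := fun s =>
  `[< forall x : L, (0 <= v (val x))%E -> (0 < v (val (s x) - val x)%R)%E >].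

Lemma inertia1 : (1%g : galois_group) \in inertia_group.
Proof. by apply/asboolP => x _; rewrite subrr val0. Qed.

Lemma inertiaM : mulg_closed inertia_group.
Proof.
move=> s t /asboolP sI /asboolP tI; apply/asboolP => x x0 /=.
have tx : (0 <= v (val (t x)))%E.
  by rewrite -(subrK (val x) (val (t x))) valD_ge// ltW ?tI.
by rewrite -(subrKA (val (t x))) valD_gt ?sI ?tI.
Qed.

Lemma inertiaV : invg_closed inertia_group.
Proof.
move=> s /asboolP sI; apply/asboolP => x x0.
set y := s^-1%g x; have xE : x = s y by rewrite /y /= gal_invK.
suff y0 : (0 <= v (val y))%E by rewrite -opprB valN xE sI.
rewrite leNgt; apply/negP => y_lt0.
have yn0 : y != 0 by apply: contraTneq y_lt0 => ->; rewrite val0.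
have [sD sM sK _] := galP s.
have s1 : s 1 = 1 by apply: (sK 1); rewrite rmorph1.
have xyV : x * s y^-1 = 1 by rewrite xE -sM mulfV// s1.
have xn0 : val x != 0.
  apply: contra_eq_neq xyV => vx0; have -> : x = 0 by exact: val_inj.
  by rewrite mul0r eq_sym oner_neq0.
have syV : val (s y^-1) = (val x)^-1.
  by apply: (mulfI xn0); rewrite mulfV// -[RHS](congr1 val xyV).
have yV0 : (0 < v (val (y^-1)%R))%E.
  rewrite [val _](_ : _ = (val y)^-1); last exact: fmorphV.
  exact: valV_lt0.
have := sI _ (ltW yV0); move=> /valD_gt /(_ yV0); rewrite subrK syV.
by move=> /(valV_gt0 xn0); rewrite ltNge x0.
Qed.

HB.instance Definition _ := isMulClosed.Build galois_group inertia_group inertiaM.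
HB.instance Definition _ := isMul1Closed.Build galois_group inertia_group inertia1.
HB.instance Definition _ := isInvClosed.Build galois_group inertia_group inertiaV.

End GaloisGroup.

Definition contains_mu (n : nat) : Prop :=
  forall z : F, z ^+ n = 1 -> exists k : K, iota k = z.

End Galois.

Arguments galois_group {K F} iota S.
Arguments inertia_group {K F} iota S v.

Definition unicritical (R : nzRingType) (p : nat) (c z : R) : R := z ^+ p - c.

Section Tower.
Variables (K : fieldType) (F : closedFieldType) (iota : {rmorphism K -> F}).
Variables (p : nat) (c a : K).

Definition preimages (n : nat) : set F :=
  [set z | iter n (unicritical p (iota c)) z = iota a].

(* The polynomial [f^n(X) - a] has no multiple root, i.e. the [p ^ n] solutions
   of [f^n(z) = a] counted with multiplicity are distinct. *)
Definition distinct_preimages (n : nat) : Prop :=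
  exists2 s : seq F, uniq s &
    iter n (unicritical p (iota c)%:P) 'X - (iota a)%:P =
      \prod_(z <- s) ('X - z%:P).

Definition tower (n : nat) : {pred F} := adjoin iota (preimages n).
HB.instance Definition _ n := GRing.DivringClosed.on (tower n).

Lemma towerS n : (0 < n)%N -> {subset tower n <= tower n.+1}.
Proof.
move=> n0; apply: adjoin_min => [k|z /= zn]; first exact: base_adjoin.
have [p0|p_gt0] := posnP p.
  apply: sub_adjoin; rewrite /preimages /= -zn -(prednK n0) /=.
  by rewrite /unicritical p0 !expr0.
have [w wz] : exists w, unicritical p (iota c) w = z.
  have : size ('X^p - (z + iota c)%:P : {poly F}) != 1%N.
    by rewrite size_XnsubC// eqSS -lt0n.
  case/closed_rootP => w; rewrite rootE !hornerE subr_eq0 => /eqP wE.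
  by exists w; rewrite /unicritical wE addrK.
have w_tower : w \in tower n.+1.
  by apply: sub_adjoin; rewrite /preimages /= -iterS iterSr wz.
by rewrite -wz rpredB ?rpredX//; exact: base_adjoin.
Qed.

Lemma tower_mono m n : (0 < m)%N -> (m <= n)%N ->
  {subset tower m <= tower n}.
Proof.
move=> m0 /subnK <-; elim: (n - m)%N => // k IH x /IH.
by rewrite addSn; apply: towerS; rewrite addn_gt0 m0 orbT.
Qed.

Definition tower_infty : {pred F} :=
  fun x => `[< exists2 n, (0 < n)%N & x \in tower n >].

Lemma tower_infty_closed : divring_closed tower_infty.
Proof.
have join x y : x \in tower_infty -> y \in tower_infty ->
    exists n, [/\ (0 < n)%N, x \in tower n & y \in tower n].
  move=> /asboolP[m m0 xm] /asboolP[n n0 yn]; exists (maxn m n); split.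
  - by rewrite leq_max m0.
  - exact: tower_mono m0 (leq_maxl m n) _ xm.
  - exact: tower_mono n0 (leq_maxr m n) _ yn.
split=> [|x y xT yT|x y xT yT].
- by apply/asboolP; exists 1%N => //; exact: rpred1.
- have [n [n0 xn yn]] := join x y xT yT.
  by apply/asboolP; exists n => //; exact: rpredB.
- have [n [n0 xn yn]] := join x y xT yT.
  by apply/asboolP; exists n => //; exact: rpred_div.
Qed.
HB.instance Definition _ :=
  GRing.isDivringClosed.Build F tower_infty tower_infty_closed.

End Tower.

(* Main.v *)
From Pilot Require Import Defs.
From HB Require Import structures.
From mathcomp Require Import all_boot all_order all_algebra fieldext separable.
From mathcomp Require fingroup perm cyclic pgroup algebraics_fundamentals.
From mathcomp Require Import mathcomp_extra boolp classical_sets functions.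
From mathcomp Require Import ring lra.
From mathcomp Require Import cardinality constructive_ereal topology normedtype.

Set Implicit Arguments.
Unset Strict Implicit.
Unset Printing Implicit Defensive.

Import Order.TTheory GRing.Theory Num.Theory.

Local Open Scope classical_set_scope.
Local Open Scope ring_scope.
Import Pilot.Defs.

(** Put [rho = -1/(p-1)], so that [v c = p * rho]. For [v x = rho] all
    coefficients of the polynomial [f (x + d) - f x] in [d] are integral: the
    negative valuation of a power of [x] is made up for by the factor [p] of the
    binomial coefficient. The coefficients of [d ^ p] and of [d] are moreover
    units. Hence [f (x + d) - f x] is integral exactly when [d] is; it has the
    valuation of [d] if [v d > 0], and [p] times that valuation if [v d < 0]
    ([diff_int], [diff_gt0], [diff_neg]). Measuring distances by [v], this says
    that [f] is an isometry at positive distances from [x], so that two points with the same image under an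
    iterate of [f] along an orbit of points of valuation [rho] lie at an integral
    distance and coincide as soon as this distance is positive ([iter_int],
    [iter_sep]): such points are governed by the residue field.

    Two facts link this to inertia. If [z] is a primitive p-th root of unity,
    then [(z - 1) ^ p * c] is a unit, and an inertia element must fix its
    residue; this forces it to fix [z] ([inertia_fixes_mu]). An automorphism that
    fixes the p-th roots of unity satisfies [s ^ (p ^ n) = 1] on the n-th field,
    because each extraction of a p-th root contributes one factor [p]
    ([mu_fixed_torsion]). This gives (b), and the order of the quotient in (a);
    the quotient is cyclic because the residue field of [K_n] is finite
    ([residue_gal_cyclic]).

    If [a - b] is integral, then all iterated preimages of [a] lie at an integral
    distance from [a] and inertia moves them by a positive distance: they are
    fixed, which is (f). If [v a > v c], then the preimages of all positive levels
    have valuation [rho] and differences of preimages of the same level are integral.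
    Inertia translates them all by the same amount modulo the maximal ideal;
    translations commute, have order [p], and are known from one point, which is
    (c).

    If [v (a - b) < 0], differences of successive preimages have the valuations
    [v (a - b) / p ^ k], while a finite inertia group would bound the
    denominators of the valuations of [K_oo]: the product of a finite inertia
    orbit is fixed by inertia, and the fixed field of inertia has the same
    valuations as [K] ([inertia_fixed_val], [infinite_inertia]). When moreover
    [v a > v c], the subgroups of [I(oo)] that fix [K_n] form a filtration with
    steps of order at most [p] and with infinitely many nontrivial steps. The
    digits along this filtration identify the compact group [I(oo)] with a
    product of copies of Z/p ([elementary_abelian_isog]).

    For (d), the preimages of high level have valuation [rho], so that by
    [iter_sep] those above a given point are told apart by the residues of their
    differences; hence the residue field of [K_oo] is infinite
    ([residues_infinite]). By compactness one automorphism generates the Galois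
    groups of the residue fields of all the levels. They are cyclic of orders
    [p ^ e n], with [e] unbounded since otherwise all residues would have a
    bounded degree over the finite residue field of [K]. The inverse limit is Z_p
    ([procyclic_iso]).

    Three general tools carry the argument. The valuation is invariant under
    automorphisms, because the powers of an integral element have bounded
    coordinates in a finite dimensional space over the complete field [Qp]
    ([bounded_coords], [gact_val]). Limits of automorphisms are taken along
    ultrafilters ([ultra_limit]); they give compactness and the passage from the
    levels to [K_oo]. Frobenius powers describe the action on residues
    ([frob_actsP]). *)

(** * Finite groups *)

Section FiniteGroups.
Import fingroup.fingroup fingroup.perm solvable.cyclic solvable.pgroup.
Variable H : groupType.

Lemma finite_enum : finite_set [set: H] ->
  exists2 s : seq H, uniq s & forall x, x \in s.
Proof.
move=> /finite_seqP[s sE]; exists (undup s); first exact: undup_uniq.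
by move=> x; rewrite mem_undup; have : [set: H] x by []; rewrite sE.
Qed.

Lemma has_order_enum m : has_order H m <->
  exists s : seq H, [/\ uniq s, forall x, x \in s & size s = m].
Proof.
split=> [Hm|[s [us sT sm]]].
  have [s us sT] := finite_enum (ex_intro _ m Hm : finite_set _).
  exists s; split=> //; apply/card_eq_II.
  apply: card_eq_trans (Hm : [set: H] #= `I_m)%card.
  apply/card_esym; apply/card_set_bijP; exists (fun x => index x s); split.
  - by move=> x _ /=; rewrite index_mem.
  - by move=> x y _ _ /(congr1 (nth 1%g s)); rewrite !nth_index.
  - by move=> i /= im; exists (nth 1%g s i); rewrite ?index_uniq.
apply/card_set_bijP; exists (fun x => index x s); split.
- by move=> x _ /=; rewrite -sm index_mem.
- by move=> x y _ _ /(congr1 (nth 1%g s)); rewrite !nth_index.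
- by move=> i /=; rewrite -sm => im; exists (nth 1%g s i); rewrite ?index_uniq.
Qed.

(** By Cauchy's theorem a prime dividing the order is the order of an element.
    The group is replaced by the group of its translations, which lives in a
    finite permutation group. *)
Lemma finite_torsion_pgroup p N : prime p -> finite_set [set: H] ->
  (forall x : H, (x ^+ (p ^ N) = 1)%g) -> finite_pgroup p H.
Proof.
move=> pp /finite_enum[s us sT] tors.
pose mulr (h : H) (t : seq_sub s) : seq_sub s := SeqSub (sT (ssval t * h)%g).
have mulr_inj h : injective (mulr h).
  by move=> x y /(congr1 (@ssval _ _)) /= /mulIg xy; exact: val_inj.
pose phi h : {perm seq_sub s} := perm (@mulr_inj h).
have phiM x y : phi (x * y)%g = (phi x * phi y)%g.
  by apply/permP => t; rewrite permM !permE; apply: val_inj; rewrite /= mulgA.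
have phi1 : phi 1%g = 1%g.
  by apply/permP => t; rewrite perm1 permE; apply: val_inj; rewrite /= mulg1.
have phiX x k : phi (x ^+ k)%g = (phi x ^+ k)%g.
  by elim: k => [|k IH]; rewrite ?expg0// !expgS phiM IH.
have phi_inj : injective phi.
  move=> x y /permP /(_ (SeqSub (sT 1%g))).
  by rewrite !permE => /(congr1 (@ssval _ _)) /=; rewrite !mul1g.
pose A := [set phi (ssval t) | t : seq_sub s]%SET.
have phiA h : phi h \in A by apply/imsetP; exists (SeqSub (sT h)).
have gA : group_set A.
  apply/group_setP; split=> [|_ _ /imsetP[x _ ->] /imsetP[y _ ->]].
    by rewrite -phi1 phiA.
  by rewrite -phiM phiA.
have pA : (p.-group (Group gA))%g.
  apply/pgroupP => q qp qA; have [_ /imsetP[x _ ->] xq] := Cauchy qp qA.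
  have : (#[phi (ssval x)]%g %| p ^ N)%N.
    by rewrite order_dvdn -phiX tors phi1.
  by rewrite xq Euclid_dvdX// dvdn_prime2// => /andP[].
have [k Ak] := p_natP pA; exists k; apply/has_order_enum; exists s; split=> //.
rewrite -Ak /= card_imset; last by move=> x y /phi_inj xy; exact: val_inj.
have us' : uniq [seq ssval t | t <- enum {: seq_sub s}].
  rewrite map_inj_in_uniq ?enum_uniq// => x y _ _ xy; exact: val_inj.
rewrite cardT -(size_map (@ssval _ s)); apply/esym/perm_size/uniq_perm => // x.
by rewrite sT; apply/mapP; exists (SeqSub (sT x)); rewrite ?mem_enum.
Qed.

Lemma inj_finite_group (T : eqType) (f : H -> T) (s : seq T) :
  injective f -> (forall x, f x \in s) -> finite_set [set: H].
Proof.
move=> fi fs; apply/finite_seqP.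
pose g t := if pselect (exists x, f x = t) is left e then sval (cid e) else 1%g.
exists (map g s); apply/seteqP; split=> // x _ /=.
apply/mapP; exists (f x) => //; rewrite /g.
by case: pselect => [e|[]]; [case: cid => y /= /fi|exists x].
Qed.

Lemma perm_mulg (h : H) (s : seq H) : uniq s -> (forall x, x \in s) ->
  perm_eq [seq (h * x)%g | x <- s] s.
Proof.
move=> us sT; apply: uniq_perm; rewrite ?map_inj_uniq//; first exact: mulgI.
move=> x; rewrite sT; apply/mapP; exists (h^-1 * x)%g => //.
by rewrite mulVKg.
Qed.

End FiniteGroups.

(** * Valuations and residue fields *)

Section ValuationMore.
Variables (F : fieldType) (v : valuation F).

Lemma val_neq0 x (r : rat) : v x = r%:E -> x != 0.
Proof. by move=> vx; apply/eqP => x0; rewrite x0 val0 in vx. Qed.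

Lemma valX_fin x (r : rat) n : v x = r%:E -> v (x ^+ n) = (r *+ n)%:E.
Proof.
move=> vx; elim: n => [|n IH]; first by rewrite expr0 val1.
by rewrite exprS valM vx IH -EFinD mulrS.
Qed.

Lemma valV_fin x (r : rat) : v x = r%:E -> v x^-1 = (- r)%:E.
Proof.
move=> vx; have x0 := val_neq0 vx; have [s vs] := @val_fin _ v x^-1 (invr_neq0 x0).
have := valM v x x^-1; rewrite mulfV// val1 vx vs -EFinD => -[] /esym/eqP.
by rewrite addrC addr_eq0 => /eqP ->.
Qed.

Lemma val_ltD x y : (v x < v y)%E -> v (x + y) = v x.
Proof.
move=> xy; apply/eqP; rewrite eq_le; apply/andP; split; last first.
  by apply: valD_ge => //; exact: ltW.
rewrite leNgt; apply/negP => xy'.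
have : (v x < v (x + y - y)%R)%E by apply: valD_gt => //; rewrite valN.
by rewrite addrK ltxx.
Qed.

Lemma val_sub_ge (r : \bar rat) x y :
  (r <= v x)%E -> (r <= v y)%E -> (r <= v (x - y)%R)%E.
Proof. by move=> rx ry; apply: valD_ge; rewrite ?valN. Qed.

Lemma val_sub_gt (r : \bar rat) x y :
  (r < v x)%E -> (r < v y)%E -> (r < v (x - y)%R)%E.
Proof. by move=> rx ry; apply: valD_gt; rewrite ?valN. Qed.

Lemma valM_ge0 x y : (0 <= v x)%E -> (0 <= v y)%E -> (0 <= v (x * y)%R)%E.
Proof. by move=> *; rewrite valM adde_ge0. Qed.

Lemma valM_gt0 x y : (0 < v x)%E -> (0 <= v y)%E -> (0 < v (x * y)%R)%E.
Proof. by move=> *; rewrite valM -(adde0 0%E) lte_leD. Qed.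

Lemma valX_ge0 x n : (0 <= v x)%E -> (0 <= v (x ^+ n)%R)%E.
Proof.
by move=> x0; elim: n => [|n IH]; rewrite ?expr0 ?val1// exprS valM_ge0.
Qed.

Lemma val_nat_ge0 n : (0 <= v n%:R)%E.
Proof. by elim: n => [|n IH]; rewrite ?val0// mulrS valD_ge// val1. Qed.

Lemma val_sum_ge (r : \bar rat) (I : Type) (s : seq I) (P : pred I) (f : I -> F) :
  (forall i, P i -> (r <= v (f i)%R)%E) ->
  (r <= v (\sum_(i <- s | P i) f i)%R)%E.
Proof.
move=> rf; apply: (big_ind (fun x => (r <= v x)%E)) => //.
  by rewrite val0 leey.
by move=> x y; exact: valD_ge.
Qed.

Lemma val_sum_gt (r : rat) (I : Type) (s : seq I) (P : pred I) (f : I -> F) :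
  (forall i, P i -> (r%:E < v (f i)%R)%E) ->
  (r%:E < v (\sum_(i <- s | P i) f i)%R)%E.
Proof.
move=> rf; apply: (big_ind (fun x => (r%:E < v x)%E)) => //.
  by rewrite val0 ltey.
by move=> x y; exact: valD_gt.
Qed.

Lemma val_prod_ge0 (I : eqType) (s : seq I) (f : I -> F) :
  {in s, forall i, (0 <= v (f i)%R)%E} -> (0 <= v (\prod_(i <- s) f i)%R)%E.
Proof.
move=> f0; rewrite big_seq; apply: (big_ind (fun x => (0 <= v x)%E)) => //.
  by rewrite val1.
by move=> x y; exact: valM_ge0.
Qed.

Lemma val_prod_const (I : eqType) (s : seq I) (f : I -> F) (r : rat) :
  {in s, forall i, v (f i) = r%:E} -> v (\prod_(i <- s) f i) = (r *+ size s)%:E.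
Proof.
elim: s => [|i s IH] fr; first by rewrite big_nil val1.
rewrite big_cons valM fr ?mem_head// IH; last first.
  by move=> j js; rewrite fr// in_cons js orbT.
by rewrite -EFinD mulrS.
Qed.

Lemma valX_gt0 x n : (0 < n)%N -> (0 < v (x ^+ n)%R)%E = (0 < v x)%E.
Proof.
move=> n0; have [->|x0] := eqVneq x 0.
  by rewrite expr0n eqn0Ngt n0 val0.
have [r vr] := val_fin v x0; rewrite (valX_fin _ vr) vr !lte_fin.
by rewrite pmulrn_lgt0.
Qed.

Lemma valX_lt0 x n : (0 < n)%N -> (v (x ^+ n)%R < 0)%E = (v x < 0)%E.
Proof.
move=> n0; have [->|x0] := eqVneq x 0.
  by rewrite expr0n eqn0Ngt n0 val0.
have [r vr] := val_fin v x0; rewrite (valX_fin _ vr) vr !lte_fin.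
by rewrite pmulrn_llt0.
Qed.

End ValuationMore.

Section ResidueField.
Variables (F : fieldType) (v : valuation F).

Lemma val_ring_mul : mulr_closed (val_ring v).
Proof.
by split=> [|x y]; rewrite !inE ?val1//; exact: valM_ge0.
Qed.

Fact vring_subring : subring_closed (val_ring v).
Proof.
have [_ sub] := val_ring_zmod v; have [one mul] := val_ring_mul.
by split.
Qed.

Definition vring : Type := {x : F | x \in val_ring v}.
HB.instance Definition _ := SubType.on vring.
HB.instance Definition _ := [Choice of vring by <:].
HB.instance Definition _ :=
  GRing.SubChoice_isSubComNzRing.Build F _ vring vring_subring.

Definition max_ideal : {pred vring} := [pred x : vring | (0 < v (val x)%R)%E].

Lemma max_ideal_closed : idealr_closed max_ideal.
Proof.
split; rewrite ?inE /= ?val0 ?val1 ?ltxx//.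
move=> a x y; rewrite !inE /= => x0 y0; apply: valD_gt => //.
by rewrite mulrC; apply: valM_gt0 => //; exact: (valP a).
Qed.
HB.instance Definition _ := isIdealr.Build vring max_ideal max_ideal_closed.

Definition residue : Type := {ideal_quot max_ideal}.
HB.instance Definition _ := GRing.ComNzRing.on residue.

(** [red x] is zero when [x] is not integral, so that no proof of integrality
    has to be carried around. *)
Definition red (x : F) : residue := (\pi_({ideal_quot max_ideal})%qT (insubd (0 : vring) x)).

Lemma insubdE x : (0 <= v x)%E -> val (insubd (0 : vring) x) = x.
Proof. by move=> x0; rewrite val_insubd inE x0. Qed.

Lemma redP x y : (0 <= v x)%E -> (0 <= v y)%E ->
  (red x == red y) = (0 < v (x - y)%R)%E.
Proof.
by move=> x0 y0; rewrite /red -Quotient.idealrBE inE /= !insubdE.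
Qed.

Lemma red_eq x y : (0 <= v x)%E -> (0 <= v y)%E ->
  red x = red y <-> (0 < v (x - y)%R)%E.
Proof. by move=> x0 y0; rewrite -redP//; split=> /eqP. Qed.

Lemma redD x y : (0 <= v x)%E -> (0 <= v y)%E -> red (x + y) = red x + red y.
Proof.
move=> x0 y0; rewrite /red -[RHS]rmorphD; congr (\pi_ _)%qT; apply: val_inj.
by rewrite /= !insubdE// valD_ge.
Qed.

Lemma redM x y : (0 <= v x)%E -> (0 <= v y)%E -> red (x * y) = red x * red y.
Proof.
move=> x0 y0; rewrite /red -[RHS]rmorphM; congr (\pi_ _)%qT; apply: val_inj.
by rewrite /= !insubdE// valM_ge0.
Qed.

Lemma red0 : red 0 = 0.
Proof.
rewrite /red -[RHS](rmorph0 (\pi_({ideal_quot max_ideal})%qT)).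
congr (\pi_ _)%qT; apply: val_inj.
by rewrite /= !insubdE ?val0.
Qed.

Lemma red1 : red 1 = 1.
Proof.
rewrite /red -[RHS](rmorph1 (\pi_({ideal_quot max_ideal})%qT)).
congr (\pi_ _)%qT; apply: val_inj.
by rewrite /= !insubdE ?val1.
Qed.

Lemma red_eq0 x : (0 <= v x)%E -> (red x == 0) = (0 < v x)%E.
Proof. by move=> x0; rewrite -red0 redP ?val0// subr0. Qed.

Lemma red_surj y : exists2 x, (0 <= v x)%E & red x = y.
Proof.
exists (val (repr (y : {ideal_quot max_ideal}))).
  exact: (valP (repr (y : {ideal_quot max_ideal}))).
rewrite /red -[RHS](reprK (y : {ideal_quot max_ideal})); congr (\pi_ _)%qT.
by apply: val_inj; rewrite insubdE//; exact: (valP (repr (y : {ideal_quot max_ideal}))).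
Qed.

Lemma res_field_ex (y : residue) : y != 0 -> exists z, z * y = 1.
Proof.
have [x x0 <-] := red_surj y; rewrite red_eq0// => x0'.
have [x_eq0|xn0] := eqVneq x 0; first by rewrite x_eq0 val0 in x0'.
have [r vr] := val_fin v xn0.
have r0 : r = 0.
  by move: x0 x0'; rewrite vr lte_fin lee_fin le_eqVlt => /orP[/eqP//|->].
rewrite r0 in vr; have vV := valV_fin vr; rewrite oppr0 in vV.
by exists (red x^-1); rewrite -redM ?vV// mulVf// red1.
Qed.

Definition res_inv (y : residue) : residue :=
  if pselect (exists z, z * y = 1) is left e then sval (cid e) else 0.

Lemma res_mulVf (y : residue) : y != 0 -> res_inv y * y = 1.
Proof.
by move=> /res_field_ex y0; rewrite /res_inv; case: pselect => // e; case: cid.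
Qed.

Lemma res_inv0 : res_inv 0 = 0.
Proof.
rewrite /res_inv; case: pselect => // e; case: (cid e) => z /= /eqP.
by rewrite mulr0 eq_sym oner_eq0.
Qed.

HB.instance Definition _ := GRing.ComNzRing_isField.Build residue res_mulVf res_inv0.

Lemma redN x : (0 <= v x)%E -> red (- x) = - red x.
Proof.
move=> x0; apply/eqP; rewrite -addr_eq0 -redD ?valN//.
by rewrite addNr red0.
Qed.

Lemma redB x y : (0 <= v x)%E -> (0 <= v y)%E -> red (x - y) = red x - red y.
Proof. by move=> x0 y0; rewrite redD ?redN ?valN. Qed.

Lemma redX x n : (0 <= v x)%E -> red (x ^+ n) = red x ^+ n.
Proof.
move=> x0; elim: n => [|n IH]; first by rewrite !expr0 red1.
by rewrite !exprS redM ?IH// valX_ge0.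
Qed.

Lemma red_nat n : red n%:R = n%:R.
Proof.
elim: n => [|n IH]; first by rewrite red0.
by rewrite !mulrS redD ?red1 ?IH ?val1// val_nat_ge0.
Qed.

Lemma red_neq0 x : (0 <= v x)%E -> red x != 0 -> v x = 0%E.
Proof.
by move=> x0; rewrite red_eq0// -leNgt => x0'; apply/eqP; rewrite eq_le x0' x0.
Qed.

Lemma red_sum (I : Type) (s : seq I) (f : I -> F) :
  (forall i, (0 <= v (f i)%R)%E) ->
  red (\sum_(i <- s) f i) = \sum_(i <- s) red (f i).
Proof.
move=> f0; elim: s => [|i s IH]; first by rewrite !big_nil red0.
by rewrite !big_cons redD ?IH//; apply: val_sum_ge.
Qed.

Lemma red_prod (I : eqType) (s : seq I) (f : I -> F) :
  {in s, forall i, (0 <= v (f i)%R)%E} ->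
  red (\prod_(i <- s) f i) = \prod_(i <- s) red (f i).
Proof.
elim: s => [|i s IH] f0; first by rewrite !big_nil red1.
have f0' : {in s, forall i, (0 <= v (f i)%R)%E}.
  by move=> j js; rewrite f0// in_cons js orbT.
by rewrite !big_cons redM ?IH ?f0 ?mem_head//; apply: val_prod_ge0.
Qed.

End ResidueField.

(** * Automorphisms as maps of the closure *)

Section Action.
Variables (K F : fieldType) (iota : {rmorphism K -> F}) (S : divringClosed F).
Hypothesis KS : forall k, iota k \in S.
Local Notation G := (galois_group iota S).
Implicit Types (s t : G) (x y : F).

(** Extending [s] by the identity outside of [S] turns automorphisms of
    different subfields into maps of one type, so that they can be compared. *)
Definition gact s x : F :=
  if insub x is Some u then val (s (u : subfield_of S)) else x.

Lemma gactE s (u : subfield_of S) : gact s (val u) = val (s u).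
Proof. by rewrite /gact valK. Qed.

Lemma gact_out s x : x \notin S -> gact s x = x.
Proof. by move=> xS; rewrite /gact insubN. Qed.

Lemma subfield_ofP x : x \in S -> exists u : subfield_of S, val u = x.
Proof. by move=> xS; exists (Sub x xS); rewrite SubK. Qed.

Lemma gact_in s x : (gact s x \in S) = (x \in S).
Proof.
have [xS|xS] := boolP (x \in S); last by rewrite gact_out// (negPf xS).
have [u <-] := subfield_ofP xS; rewrite gactE; exact: valP.
Qed.

Lemma gactD s : {in S &, {morph gact s : x y / x + y}}.
Proof.
move=> x y /subfield_ofP[u <-] /subfield_ofP[w <-].
by rewrite -[val u + val w]/(val (u + w)) !gactE (galD (galP s)).
Qed.

Lemma gactM s : {in S &, {morph gact s : x y / x * y}}.
Proof.
move=> x y /subfield_ofP[u <-] /subfield_ofP[w <-].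
by rewrite -[val u * val w]/(val (u * w)) !gactE (galM (galP s)).
Qed.

Lemma gactK s k : gact s (iota k) = iota k.
Proof. by have [u uk] := subfield_ofP (KS k); rewrite -uk gactE (galK (galP s) uk). Qed.

Lemma gact0 s : gact s 0 = 0.
Proof. by rewrite -(rmorph0 iota) gactK. Qed.

Lemma gact1 s : gact s 1 = 1.
Proof. by rewrite -(rmorph1 iota) gactK. Qed.

Lemma gactN s : {in S, {morph gact s : x / - x}}.
Proof.
move=> x xS; apply/eqP; rewrite -addr_eq0 -gactD ?rpredN// addNr gact0//.
Qed.

Lemma gactB s : {in S &, {morph gact s : x y / x - y}}.
Proof. by move=> x y xS yS; rewrite gactD ?rpredN// gactN. Qed.

Lemma gactX s n : {in S, {morph gact s : x / x ^+ n}}.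
Proof.
move=> x xS; elim: n => [|n IH]; first by rewrite !expr0 gact1.
by rewrite !exprS gactM ?IH ?rpredX.
Qed.

Lemma gact_mul s t x : gact (s * t)%g x = gact s (gact t x).
Proof.
have [xS|xS] := boolP (x \in S); last by rewrite !gact_out.
by have [u <-] := subfield_ofP xS; rewrite !gactE.
Qed.

Lemma gact_one x : gact 1%g x = x.
Proof.
have [xS|xS] := boolP (x \in S); last by rewrite !gact_out.
by have [u <-] := subfield_ofP xS; rewrite !gactE.
Qed.

Lemma gactVK s : cancel (gact s) (gact s^-1%g).
Proof. by move=> x; rewrite -gact_mul mulVg gact_one. Qed.

Lemma gactKV s : cancel (gact s^-1%g) (gact s).
Proof. by move=> x; rewrite -gact_mul mulgV gact_one. Qed.

Lemma gact_inj s : injective (gact s).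
Proof. exact: can_inj (gactVK s). Qed.

Lemma gact_expg s n x : gact (s ^+ n)%g x = iter n (gact s) x.
Proof.
elim: n => [|n IH]; first by rewrite expg0 gact_one.
by rewrite expgS gact_mul IH.
Qed.

Lemma gactV s : {in S, {morph gact s : x / x^-1}}.
Proof.
move=> x xS; have [->|x0] := eqVneq x 0; first by rewrite invr0 gact0 invr0.
have sx0 : gact s x != 0.
  by apply: contra_neq x0 => sx; apply: (@gact_inj s); rewrite gact0.
by apply: (mulfI sx0); rewrite -gactM ?rpredV// !mulfV// gact1.
Qed.

Lemma gact_sum s (I : Type) (r : seq I) (f : I -> F) :
  (forall i, f i \in S) ->
  gact s (\sum_(i <- r) f i) = \sum_(i <- r) gact s (f i).
Proof.
move=> fS; elim: r => [|i r IH]; first by rewrite !big_nil gact0.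
by rewrite !big_cons gactD ?IH// rpred_sum.
Qed.

Lemma gact_prod s (I : eqType) (r : seq I) (f : I -> F) :
  {in r, forall i, f i \in S} ->
  gact s (\prod_(i <- r) f i) = \prod_(i <- r) gact s (f i).
Proof.
elim: r => [|i r IH] fS; first by rewrite !big_nil gact1.
have fS' : {in r, forall i, f i \in S}.
  by move=> j js; rewrite fS// in_cons js orbT.
rewrite !big_cons gactM ?IH ?fS ?mem_head//.
by rewrite big_seq rpred_prod.
Qed.

Lemma horner_in (P : {poly K}) x : x \in S -> (map_poly iota P).[x] \in S.
Proof.
move=> xS; rewrite horner_coef rpred_sum// => i _.
by rewrite rpredM ?rpredX// coef_map /= KS.
Qed.

Lemma gact_horner s (P : {poly K}) x : x \in S ->
  gact s (map_poly iota P).[x] = (map_poly iota P).[gact s x].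
Proof.
move=> xS; rewrite !horner_coef gact_sum => [|i]; last first.
  by rewrite rpredM ?rpredX// coef_map /= KS.
by apply: eq_bigr => i _; rewrite coef_map /= gactM ?rpredX ?KS// gactX// gactK.
Qed.

Lemma gact_root s (P : {poly K}) x : x \in S ->
  root (map_poly iota P) x -> root (map_poly iota P) (gact s x).
Proof. by move=> xS; rewrite !rootE -gact_horner// => /eqP ->; rewrite gact0. Qed.

Lemma gact_ext s t : {in S, gact s =1 gact t} -> s = t.
Proof.
move=> st; apply: galE => u; apply: val_inj.
by rewrite -!gactE st//; exact: valP.
Qed.

Lemma inertiaP (v : valuation F) s :
  s \in inertia_group iota S v <->
  (forall x, x \in S -> (0 <= v x)%E -> (0 < v (gact s x - x)%R)%E).
Proof.
split=> [/asboolP sI x /subfield_ofP[u <-]|sI]; first by rewrite gactE; exact: sI.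
by apply/asboolP => u u0; rewrite -gactE; apply: sI => //; exact: valP.
Qed.

(** A nonzero ring morphism between fields is injective, so that surjectivity
    is all that has to be asked of [h]. *)
Lemma gact_intro (h : F -> F) :
  {in S, forall x, h x \in S} ->
  {in S &, {morph h : x y / x + y}} ->
  {in S &, {morph h : x y / x * y}} ->
  (forall k, h (iota k) = iota k) ->
  {in S, forall y, exists2 x, x \in S & h x = y} ->
  exists s, {in S, forall x, gact s x = h x}.
Proof.
move=> hS hD hM hK hsurj.
pose f (u : subfield_of S) : subfield_of S := Sub (h (val u)) (hS _ (valP u)).
have fE u : val (f u) = h (val u) by rewrite SubK.
have fD : {morph f : x y / x + y}.
  move=> x y; apply: val_inj; rewrite fE -[RHS]/(val (f x) + val (f y)) !fE.
  by rewrite -hD//; exact: valP.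
have fM : {morph f : x y / x * y}.
  move=> x y; apply: val_inj; rewrite fE -[RHS]/(val (f x) * val (f y)) !fE.
  by rewrite -hM//; exact: valP.
have h0 : h 0 = 0 by rewrite -(rmorph0 iota) hK.
have h1 : h 1 = 1 by rewrite -(rmorph1 iota) hK.
have hinj : {in S &, injective h}.
  have hker x : x \in S -> h x = 0 -> x = 0.
    move=> xS hx; apply/eqP; apply: contraT => x0.
    have := hM x x^-1 xS; rewrite rpredV xS mulfV// h1 hx mul0r => /(_ isT)/eqP.
    by rewrite oner_eq0.
  move=> x y xS yS xy; apply/eqP; rewrite -subr_eq0; apply/eqP; apply: hker.
    by rewrite rpredB.
  have := hD (x - y) y; rewrite subrK rpredB// yS => /(_ isT isT) e.
  by apply: (addIr (h y)); rewrite add0r -e.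
have fB : bijective f.
  have fs u : exists w, f w = u.
    have [x xS xu] := hsurj _ (valP u); have [w wx] := subfield_ofP xS.
    by exists w; apply: val_inj; rewrite fE wx.
  pose g u := sval (cid (fs u)).
  have gK : cancel g f by move=> u; rewrite /g; case: cid.
  exists g => // u; apply: val_inj; apply: hinj; try exact: valP.
  by rewrite -!fE gK.
have fK k (x : subfield_of S) : val x = iota k -> f x = x.
  by move=> xk; apply: val_inj; rewrite fE xk hK.
exists (Gal (IsGal fD fM fK fB)) => x /subfield_ofP[u <-].
by rewrite gactE -fE.
Qed.

(** Automorphisms that preserve integrality preserve the maximal ideal: if a
    conjugate of an element of positive valuation had valuation at most 0, the
    inverse of this conjugate would be integral and conjugate to an element
    that is not. *)
Lemma gact_normal (v : valuation F) :
  (forall s x, x \in S -> (0 <= v x)%E -> (0 <= v (gact s x)%R)%E) ->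
  is_normal (inertia_group iota S v : groupClosed G).
Proof.
move=> vS s t /inertiaP sI; apply/inertiaP => x xS x0.
have tx : (0 <= v (gact t x)%R)%E by exact: vS.
have := sI _ _ tx; rewrite gact_in => /(_ xS) h.
have h' : gact t^-1%g (gact s (gact t x) - gact t x) = gact (s ^ t)%g x - x.
  by rewrite gactB ?gact_in// gactVK /conjg !gact_mul.
rewrite -h'.
set y := gact s _ - _ in h *.
have yS : y \in S by rewrite rpredB ?gact_in.
have [y0|y0] := eqVneq y 0; first by rewrite y0 gact0 val0.
have gy0 : gact t^-1%g y != 0.
  by apply: contra_neq y0 => sy; apply: (@gact_inj t^-1%g); rewrite gact0.
have [r vr] := val_fin v y0; have [q vq] := val_fin v gy0.
rewrite ltNge; apply/negP => y_le0.
have : (0 <= v (gact t (gact t^-1%g y)^-1)%R)%E.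
  by apply: vS; rewrite ?rpredV ?gact_in// (valV_fin vq) lee_fin oppr_ge0 -lee_fin -vq.
rewrite gactV ?gact_in// gactKV (valV_fin vr) lee_fin oppr_ge0.
by move: h; rewrite vr lte_fin ltNge => /negP.
Qed.

End Action.

(** * Limits of automorphisms and primitive elements *)

Lemma roots_enum (F : fieldType) (P : {poly F}) : P != 0 ->
  exists rs : seq F, forall z, root P z -> z \in rs.
Proof.
move: {2}(size P).+1 (ltnSn (size P)) => n.
elim: n P => // n IH P Pn P0.
have [[z Pz]|nz] := pselect (exists z, root P z); last first.
  by exists [::] => z Pz; case: nz; exists z.
have /factor_theorem[Q PQ] := Pz.
have Q0 : Q != 0 by apply: contraNneq P0 => Q0; rewrite PQ Q0 mul0r.
have [|rs rsP] := IH Q _ Q0.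
  by move: Pn; rewrite PQ size_Mmonic ?monicXsubC// size_XsubC addn2.
exists (z :: rs) => y; rewrite PQ rootM in_cons root_XsubC orbC.
by move=> /orP[->//|/rsP ->]; rewrite orbT.
Qed.

Section UltraLimit.
Variables (K F : fieldType) (iota : {rmorphism K -> F}) (S : divringClosed F).
Hypothesis KS : forall k, iota k \in S.
Variables (T : Type) (U : set_system T).
Hypothesis UU : UltraFilter U.

Lemma ultra_seq (E : eqType) (h : T -> E) (s : seq E) :
  U [set t | h t \in s] -> exists2 y, y \in s & U [set t | h t = y].
Proof.
elim: s => [|y s IH] Us.
  have : U set0 by apply: filterS Us => t /=; rewrite in_nil.
  by move/(@filter_not_empty _ U (@ultra_proper _ _ UU)).
have [Uy|Uy] := in_ultra_setVsetC [set t | h t = y] UU.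
  by exists y; rewrite ?mem_head.
have [|z zs Uz] := IH.
  apply: filterS (filterI Us Uy) => t [] /=.
  by rewrite in_cons => /orP[/eqP|].
by exists z; rewrite // in_cons zs orbT.
Qed.

(** For each [x] the map [fun t => h t x] takes finitely many values, hence is
    constant on a member of the ultrafilter; these constants define the limit.
    An identity between values of [h] that holds on a member of the ultrafilter
    holds in the limit. The last hypothesis confines the preimages of [y] to a
    finite set, which makes the limit surjective. *)
Lemma ultra_limit (h : T -> F -> F) :
  (forall x, x \in S -> exists s : seq F, U [set t | h t x \in s]) ->
  (forall x, x \in S -> U [set t | h t x \in S]) ->
  (forall x y, x \in S -> y \in S -> U [set t | h t (x + y) = h t x + h t y]) ->
  (forall x y, x \in S -> y \in S -> U [set t | h t (x * y) = h t x * h t y]) ->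
  (forall k, U [set t | h t (iota k) = iota k]) ->
  (forall y, y \in S -> exists s : seq F, {subset s <= S} /\
     U [set t | exists2 x, x \in s & h t x = y]) ->
  exists s : galois_group iota S, forall x, x \in S ->
     U [set t | gact s x = h t x].
Proof.
move=> hfin hS hD hM hK hsurj.
have lim_ex x : exists y, x \in S -> U [set t | h t x = y].
  have [xS|xS] := boolP (x \in S); last by exists 0.
  by have [s Us] := hfin x xS; have [y _ Uy] := ultra_seq Us; exists y.
pose l x := sval (cid (lim_ex x)).
have lP x : x \in S -> U [set t | h t x = l x] by rewrite /l; case: cid.
have Uex (A : set T) : U A -> exists t, A t by exact: filter_ex.
have [||||y yS|s sl] := @gact_intro _ _ iota S l.
- move=> x xS; have [t [/= <-]] := Uex _ (filterI (lP x xS) (hS x xS)); exact.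
- move=> x y xS yS.
  have xyS : x + y \in S by rewrite rpredD.
  have [t [[[/= <- <-] <-] /=]] := Uex _ (filterI (filterI (filterI
    (lP _ xyS) (lP _ xS)) (lP _ yS)) (hD x y xS yS)); exact.
- move=> x y xS yS.
  have xyS : x * y \in S by rewrite rpredM.
  have [t [[[/= <- <-] <-] /=]] := Uex _ (filterI (filterI (filterI
    (lP _ xyS) (lP _ xS)) (lP _ yS)) (hM x y xS yS)); exact.
- move=> k; have [t [/= <- ->]//] := Uex _ (filterI (lP _ (KS k)) (hK k)).
- have [s [sS Us]] := hsurj y yS.
  have [x xs Ux] : exists2 x, x \in s & U [set t | h t x = y].
    elim: s {sS} Us => [|x s IH] Us; first by have [t []] := Uex _ Us.
    have [Ux|Ux] := in_ultra_setVsetC [set t | h t x = y] UU.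
      by exists x; rewrite ?mem_head.
    have [|z zs Uz] := IH.
      apply: filterS (filterI Us Ux) => t [/= [z]].
      by rewrite in_cons => /orP[/eqP ->//|zs hz _]; exists z.
    by exists z; rewrite // in_cons zs orbT.
  exists x; first exact: sS.
  by have [t [/= <- ->]] := Uex _ (filterI (lP x (sS x xs)) Ux).
by exists s => x xS; apply: filterS (lP x xS) => t /= ->; rewrite sl.
Qed.

End UltraLimit.

Section Primitive.
Variables (K : fieldType) (F : closedFieldType) (iota : {rmorphism K -> F}).
Hypothesis K0 : [pchar K] =i pred0.
Hypothesis F_alg : forall x : F, algebraicOver iota x.
Local Notation "P ^i" := (map_poly iota P) (at level 2, format "P ^i").

(** The ring [K[t]], which is the field [K(t)] because [t] is algebraic. *)
Definition polyvals (t : F) : {pred F} := fun x => `[< exists P : {poly K}, x = P^i.[t] >].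

Lemma polyvalsP t x : reflect (exists P : {poly K}, x = P^i.[t]) (x \in polyvals t).
Proof. exact: asboolP. Qed.

Lemma polyvals_base t k : iota k \in polyvals t.
Proof. by apply/polyvalsP; exists k%:P; rewrite map_polyC hornerC. Qed.

Lemma polyvals_comp t x y : x \in polyvals t -> y \in polyvals x -> y \in polyvals t.
Proof.
move=> /polyvalsP[P ->] /polyvalsP[Q ->]; apply/polyvalsP; exists (Q \Po P).
by rewrite map_comp_poly horner_comp.
Qed.

(** Inverses: a polynomial relation of [y] over [K] can be divided by [y] until
    its constant term is nonzero, and then it expresses the inverse of [y] as a
    polynomial in [y]. *)
Lemma polyvals_closed t : divring_closed (polyvals t).
Proof.
have mulc x y : x \in polyvals t -> y \in polyvals t -> x * y \in polyvals t.
  move=> /polyvalsP[P ->] /polyvalsP[Q ->]; apply/polyvalsP; exists (P * Q).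
  by rewrite rmorphM hornerM.
split=> [|x y /polyvalsP[P ->] /polyvalsP[Q ->]|x y xt yt].
- by rewrite -(rmorph1 iota) polyvals_base.
- by apply/polyvalsP; exists (P - Q); rewrite rmorphB hornerD hornerN.
- apply: mulc => //; apply: polyvals_comp yt _.
  have [->|y0] := eqVneq y 0; first by rewrite invr0 -(rmorph0 iota) polyvals_base.
  have [P P0 Py] := F_alg y.
  move: {2}(size P).+1 (ltnSn (size P)) P0 Py => n.
  elim: n P => // n IH P Pn P0 Py.
  have PE : P = (\poly_(i < (size P).-1) P`_i.+1) * 'X + (P`_0)%:P.
    apply/polyP => -[|i]; rewrite coefD coefMX coefC /= ?add0r// addr0 coef_poly.
    case: ltnP => // sPi; rewrite nth_default//.
    by move: sPi; rewrite -ltnS prednK// size_poly_gt0.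
  set Q := \poly_(i < _) _ in PE.
  have [P00|P00] := eqVneq P`_0 0.
    rewrite P00 addr0 in PE; apply: (IH Q).
    - move: Pn; rewrite PE size_mulX//.
      by apply: contraNneq P0 => Q0; rewrite PE Q0 mul0r.
    - by apply: contraNneq P0 => Q0; rewrite PE Q0 mul0r.
    - move: Py; rewrite PE rmorphM /= map_polyX rootM rootX.
      by rewrite (negPf y0) orbF.
  apply/polyvalsP; exists (- (P`_0)^-1 *: Q).
  rewrite map_polyZ hornerZ /= rmorphN fmorphV.
  have Py' : (Q^i).[y] * y = - iota P`_0.
    move: Py; rewrite rootE {1}PE rmorphD rmorphM /= map_polyX map_polyC.
    by rewrite hornerMXaddC addr_eq0 => /eqP.
  apply: (mulIf y0); rewrite mulVf// -mulrA Py' mulrN mulNr opprK mulVf//.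
  by rewrite fmorph_eq0.
Qed.
HB.instance Definition _ t := GRing.isDivringClosed.Build F (polyvals t) (polyvals_closed t).

(** Induction on [A] from the primitive element theorem for two generators. *)
Lemma primitive_element (A : seq F) :
  exists2 t, t \in adjoin iota [set` A] & {subset adjoin iota [set` A] <= polyvals t}.
Proof.
suff [t tA At] : exists2 t, t \in adjoin iota [set` A] & {subset A <= polyvals t}.
  exists t => //; apply: adjoin_min => [k|y /=]; first exact: polyvals_base.
  exact: At.
elim: A => [|x A [t tA At]].
  by exists 0; rewrite ?rpred0.
have [p p0 px] := F_alg x; have [q q0 qt] := F_alg t.
have [n [[P Px] [Q Qt]]] := pchar0_PET p0 px q0 qt K0.
set z := t *+ n - x in Px Qt.
have sub : {subset adjoin iota [set` A] <= adjoin iota [set` x :: A]}.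
  apply: adjoin_min => [k|y /= yA]; first exact: base_adjoin.
  by apply: sub_adjoin; rewrite /mkset in_cons yA orbT.
exists z.
  apply: rpredB; first by apply: rpredMn; exact: sub.
  by apply: sub_adjoin; exact: mem_head.
have tz : t \in polyvals z by apply/polyvalsP; exists Q.
move=> y; rewrite in_cons => /orP[/eqP ->|yA]; first by apply/polyvalsP; exists P.
by apply: polyvals_comp tz _; exact: At.
Qed.

Lemma minpoly_ex x : exists m : {poly K}, [/\ m \is monic, root m^i x & irreducible_poly m].
Proof.
have dec : algebraics_fundamentals.decidable_embedding iota.
  by move=> y; have [e|ne] := pselect (exists k, iota k = y);
    [left; case: e => k <-; exists k|right => -[k ky]; apply: ne; exists k].
have xint : integralOver iota x.
  by apply/integral_algebraic; exact: F_alg.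
by have [m] := algebraics_fundamentals.minPoly_decidable_closure dec xint; exists m.
Qed.

Lemma minpoly_dvd (m P : {poly K}) x : irreducible_poly m -> root m^i x ->
  root P^i x -> m %| P.
Proof.
move=> [m1 mirr] mx Px.
have gx : root (gcdp m P)^i x by rewrite gcdp_map root_gcd mx Px.
have g1 : size (gcdp m P) != 1%N.
  apply: contraTneq gx => /eqP /size_poly1P[c c0 ->].
  by rewrite map_polyC rootC fmorph_eq0.
have := mirr _ g1 (dvdp_gcdl m P); rewrite /eqp => /andP[_ mg].
exact: dvdp_trans mg (dvdp_gcdr m P).
Qed.

(** An irreducible polynomial is separable in characteristic zero, since its
    derivative is nonzero and of smaller degree. *)
Lemma minpoly_roots (m : {poly K}) : irreducible_poly m -> m \is monic ->
  exists rs : seq F, [/\ uniq rs, (size rs).+1 = size m &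
    m^i = \prod_(z <- rs) ('X - z%:P)].
Proof.
move=> mirr mmon; have [rs rsE] := closed_field_poly_normal m^i.
move: rsE; rewrite lead_coef_map (monicP mmon) rmorph1 scale1r => rsE.
have msep : separable_poly m.
  have [m1 mdiv] := mirr.
  rewrite unlock coprimep_def; apply: contraT => ncop.
  have := mdiv _ ncop (dvdp_gcdl m m^`()); rewrite /eqp => /andP[_ mg].
  have m'0 : m^`() != 0.
    apply/eqP => /polyP/(_ (size m).-2); rewrite coef_deriv coef0.
    have -> : (size m).-2.+1 = (size m).-1 by move: m1; case: (size m) => [|[]].
    rewrite -[m`_ _]/(lead_coef m) (monicP mmon) => /eqP.
    move/pcharf0P: K0 => ->; move: m1; case: (size m) => [|[]]//.
  have := dvdp_leq m'0 (dvdp_trans mg (dvdp_gcdr _ _)).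
  by rewrite leqNgt lt_size_deriv// -size_poly_gt0 (ltn_trans _ m1).
exists rs; split=> //.
- by rewrite -separable_prod_XsubC -rsE separable_map.
- by rewrite -(size_map_poly iota) rsE size_prod_XsubC.
Qed.

End Primitive.

(** * Fixed fields and extension of automorphisms *)

Section GalRMorphism.
Variables (K F : fieldType) (iota : {rmorphism K -> F}) (S : divringClosed F).
Local Notation G := (galois_group iota S).
Local Notation L := (subfield_of S).

Lemma gal_fun_zmod_morphism (s : G) : zmod_morphism (gal_fun s).
Proof.
have sD := galD (galP s); move=> x y; apply: (addIr (s y)).
by rewrite -sD !subrK.
Qed.

Lemma gal_fun_monoid_morphism (s : G) : monoid_morphism (gal_fun s).
Proof.
split; last exact: galM (galP s).
by apply: (galK (galP s) (k := 1)); rewrite rmorph1.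
Qed.

HB.instance Definition _ (s : G) :=
  GRing.isZmodMorphism.Build L L (gal_fun s) (gal_fun_zmod_morphism s).
HB.instance Definition _ (s : G) :=
  GRing.isMonoidMorphism.Build L L (gal_fun s) (gal_fun_monoid_morphism s).

(** The polynomial with the roots [O] only depends on [O] up to permutation, so
    that its coefficients are fixed by an automorphism that permutes [O]. *)
Lemma prod_XsubC_fixed (s : G) (O : seq F) i : {subset O <= S} ->
  perm_eq (map (gact s) O) O ->
  let c := (\prod_(z <- O) ('X - z%:P))`_i in c \in S /\ gact s c = c.
Proof.
move=> OS sO /=.
have [Ou OE] : exists Ou : seq L, O = map val Ou.
  elim: O OS {sO} => [|x O IH] OS; first by exists [::].
  have [u ux] : exists u : L, val u = x by apply: subfield_ofP; apply: OS; exact: mem_head.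
  have [|Ou ->] := IH; first by move=> y yO; apply: OS; rewrite in_cons yO orbT.
  by exists (u :: Ou); rewrite /= ux.
have prodE (f : {rmorphism L -> F}) (r : seq L) :
    \prod_(z <- map f r) ('X - z%:P) =
    map_poly f (\prod_(u <- r) ('X - u%:P)) :> {poly F}.
  rewrite rmorph_prod big_map; apply: eq_bigr => u _.
  by rewrite rmorphB /= map_polyX map_polyC.
set P := \prod_(u <- Ou) ('X - u%:P).
have PE : \prod_(z <- O) ('X - z%:P) = map_poly val P by rewrite OE (prodE val).
rewrite PE coef_map gactE; split; first exact: valP.
suff sP : map_poly (gal_fun s) P = P.
  by rewrite -[in RHS]sP coef_map.
apply: (map_poly_inj (val : {rmorphism L -> F})).
rewrite -[RHS]PE -(perm_big _ sO) OE -map_comp.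
have -> : map (gact s \o val) Ou = map val (map (gal_fun s) Ou).
  by rewrite -map_comp; apply: eq_map => u /=; rewrite gactE.
rewrite (prodE val); congr (map_poly _ _).
rewrite /P rmorph_prod big_map; apply: eq_bigr => u _.
by rewrite rmorphB /= map_polyX map_polyC.
Qed.

End GalRMorphism.

Section FixedField.
Variables (K : fieldType) (F : closedFieldType) (iota : {rmorphism K -> F}).
Hypothesis K0 : [pchar K] =i pred0.
Hypothesis F_alg : forall x : F, algebraicOver iota x.
Local Notation "P ^i" := (map_poly iota P) (at level 2, format "P ^i").

Section OneField.
Variable S : divringClosed F.
Hypothesis KS : forall k, iota k \in S.
Local Notation G := (galois_group iota S).

Lemma gal_conj x : x \in S ->
  exists rs : seq F, {subset rs <= S} /\ forall s : G, gact s x \in rs.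
Proof.
move=> xS; have [P P0 Px] := F_alg x.
have [|rs rsP] := @roots_enum _ (map_poly iota P); first by rewrite map_poly_eq0.
exists [seq y <- rs | y \in S]; split=> [y|s].
  by rewrite mem_filter => /andP[].
by rewrite mem_filter gact_in xS rsP// gact_root.
Qed.

Lemma orbit_enum (H : set G) x : x \in S ->
  exists O : seq F, uniq O /\ forall y, y \in O <-> exists2 s, H s & gact s x = y.
Proof.
move=> xS; have [rs [_ rsP]] := gal_conj xS.
exists (undup [seq y <- rs | `[< exists2 s, H s & gact s x = y >]]).
split; first exact: undup_uniq.
move=> y; rewrite mem_undup mem_filter; split=> [/andP[/asboolP]//|[s Hs sx]].
by apply/andP; split; [apply/asboolP; exists s|rewrite -sx].
Qed.

Lemma orbit_perm (H : set G) x (O : seq F) s : uniq O ->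
  (forall y, y \in O <-> exists2 s, H s & gact s x = y) ->
  (forall t, H t -> H (s * t)%g) -> (forall t, H t -> H (s^-1 * t)%g) ->
  perm_eq (map (gact s) O) O.
Proof.
move=> uO OP Hs Hs'; apply: uniq_perm => //.
  by rewrite map_inj_uniq//; exact: gact_inj.
move=> y; apply/mapP/idP => [[z /OP[t Ht <-] ->]|/OP[t Ht <-]].
  by apply/OP; exists (s * t)%g; rewrite ?gact_mul//; exact: Hs.
exists (gact (s^-1 * t)%g x); first by apply/OP; exists (s^-1 * t)%g => //; exact: Hs'.
by rewrite -gact_mul mulVKg.
Qed.

End OneField.

(** The elements on which both automorphisms are defined and agree form a
    subfield. *)
Lemma agree_adjoin (A : set F) (S1 S2 : divringClosed F)
    (s : galois_group iota S1) (t : galois_group iota S2) :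
  (forall k, iota k \in S1) -> (forall k, iota k \in S2) ->
  (forall x, A x -> [/\ x \in S1, x \in S2 & gact s x = gact t x]) ->
  {in adjoin iota A, forall x, gact s x = gact t x}.
Proof.
move=> KS1 KS2 Ast.
pose E : {pred F} := [pred x | [&& x \in S1, x \in S2 & gact s x == gact t x]].
have EC : divring_closed E.
  split=> [|x y /and3P[x1 x2 /eqP xe] /and3P[y1 y2 /eqP ye]|
             x y /and3P[x1 x2 /eqP xe] /and3P[y1 y2 /eqP ye]].
  - by rewrite inE !rpred1 !gact1//=.
  - by rewrite inE !rpredB//= !gactB// xe ye.
  - by rewrite inE !rpred_div//= !gactM ?rpredV// !gactV// xe ye.
pose EP := GRing.isDivringClosed.Build F E EC.
pose ED : divringClosed F := HB.pack E EP.
move=> x /(@adjoin_min _ _ iota A ED) xE; apply/eqP.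
have /and3P[] // : x \in ED; apply: xE => [k|y /Ast[y1 y2 ye]].
  by rewrite inE KS1 KS2 !gactK//=.
by rewrite inE y1 y2 ye /=.
Qed.

(** Write [S = K(t)] and [x = P(t)], with [P] reduced modulo the minimal
    polynomial [m] of [t]. For each root [t'] of [m], sending [t] to [t']
    defines a morphism [h] on [S]. It permutes the roots of [Q], so it is an
    automorphism of the splitting field [S], and therefore [P(t') = x]. The
    polynomial [P - x] then has as many roots as [m], more than its degree; it
    is zero and [x] is the constant coefficient of [P]. *)
Lemma fixed_field (A : set F) (S : divringClosed F) (Q : {poly K}) (rs : seq F) x :
  S =i adjoin iota A -> (forall z, A z <-> root Q^i z) -> [set` rs] = A ->
  x \in S -> (forall s : galois_group iota S, gact s x = x) -> exists k, x = iota k.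
Proof.
move=> SA AQ rsA xS xfix.
have KS k : iota k \in S by rewrite SA base_adjoin.
have AS z : A z -> z \in S by rewrite SA; exact: sub_adjoin.
have [t] := primitive_element K0 F_alg rs; rewrite rsA => tA At.
have tS : t \in S by rewrite SA.
have St y : y \in S -> exists P, y = P^i.[t] by rewrite SA => /At/polyvalsP.
have [m [mmon mt mirr]] := minpoly_ex F_alg t.
have [ts [uts szts mE]] := minpoly_roots iota K0 mirr mmon.
have [P0 xP0] := St x xS; pose P := P0 %% m.
have mn0 : m != 0 by rewrite monic_neq0.
have xP : x = P^i.[t].
  rewrite xP0 {1}(divp_eq P0 m) rmorphD rmorphM hornerD hornerM.
  by rewrite (rootP mt) mulr0 add0r.
have conjE t' : t' \in ts -> P^i.[t'] = x.
  move=> t'ts; have mt' : root m^i t' by rewrite mE root_prod_XsubC.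
  pose h y := if pselect (exists P, y = P^i.[t]) is left e
              then (sval (cid e))^i.[t'] else y.
  have hE (R : {poly K}) : h R^i.[t] = R^i.[t'].
    rewrite /h; case: pselect => [e|[]]; last by exists R.
    case: cid => R' /= RR'; apply/eqP; rewrite eq_sym -subr_eq0 -hornerN -hornerD.
    rewrite -rmorphB /= -rootE.
    have /dvdpP[D ->] : m %| R - R'.
      apply: (minpoly_dvd mirr mt); rewrite rootE rmorphB hornerD hornerN RR' subrr//.
    by rewrite rmorphM rootM mt' orbT.
  have hD : {in S &, {morph h : x y / x + y}}.
    move=> _ _ /St[R1 ->] /St[R2 ->]; rewrite -hornerD -rmorphD !hE.
    by rewrite rmorphD hornerD.
  have hM : {in S &, {morph h : x y / x * y}}.
    move=> _ _ /St[R1 ->] /St[R2 ->]; rewrite -hornerM -rmorphM !hE.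
    by rewrite rmorphM hornerM.
  have hK k : h (iota k) = iota k.
    by have := hE k%:P; rewrite map_polyC !hornerC.
  have h0 : h 0 = 0 by rewrite -(rmorph0 iota) hK.
  have h1 : h 1 = 1 by rewrite -(rmorph1 iota) hK.
  have hN : {in S, {morph h : x / - x}}.
    move=> y yS; apply/eqP; rewrite -addr_eq0 -hD ?rpredN// addNr h0//.
  have hn0 y : y \in S -> y != 0 -> h y != 0.
    move=> yS y0; have := hM y y^-1 yS; rewrite rpredV yS mulfV// h1 => /(_ isT) e.
    by apply: contra_eq_neq e => ->; rewrite mul0r oner_eq0.
  have hV : {in S, {morph h : x / x^-1}}.
    move=> y yS; have [->|y0] := eqVneq y 0; first by rewrite invr0 h0 invr0.
    by apply: (mulfI (hn0 y yS y0)); rewrite -hM ?rpredV// !mulfV ?hn0.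
  have hinj : {in S &, injective h}.
    move=> y z yS zS yz; apply/eqP; rewrite -subr_eq0; apply: contraT => yz0.
    by have := hn0 (y - z); rewrite rpredB// hD ?rpredN// hN// yz subrr eqxx => /(_ isT yz0).
  (* h fixes the coefficients of Q, so it permutes the roots of Q. *)
  have hA z : A z -> A (h z).
    move=> Az; have [R zR] := St z (AS z Az).
    have : h Q^i.[z] = Q^i.[h z].
      rewrite zR -horner_comp -map_comp_poly !hE.
      by rewrite map_comp_poly horner_comp.
    move/AQ: Az => /rootP ->; rewrite h0 => Qhz.
    by apply/AQ; rewrite rootE -Qhz.
  pose H1 : {pred F} := [pred y | (y \in S) && (h y \in S)].
  have H1C : divring_closed H1.
    split=> [|y z /andP[y1 y2] /andP[z1 z2]|y z /andP[y1 y2] /andP[z1 z2]].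
    - by rewrite inE h1 rpred1.
    - by rewrite inE rpredB// hD ?rpredN// hN// rpredB.
    - by rewrite inE rpred_div// hM ?rpredV// hV// rpred_div.
  pose H1P := GRing.isDivringClosed.Build F H1 H1C.
  pose H1D : divringClosed F := HB.pack H1 H1P.
  have hS : {in S, forall y, h y \in S}.
    move=> y; rewrite SA => /(@adjoin_min _ _ iota A H1D).
    have base k : iota k \in H1D by rewrite inE hK KS.
    have gen z : A z -> z \in H1D by move=> Az; rewrite inE !AS//; exact: hA.
    by move=> /(_ base gen) /andP[].
  pose H2 : {pred F} := fun y => `[< exists2 z, z \in S & h z = y >].
  have H2C : divring_closed H2.
    split=> [|_ _ /asboolP[y1 y1S <-] /asboolP[y2 y2S <-]|
               _ _ /asboolP[y1 y1S <-] /asboolP[y2 y2S <-]]; apply/asboolP.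
    - by exists 1; rewrite ?rpred1 ?h1.
    - by exists (y1 - y2); rewrite ?rpredB// hD ?rpredN// hN.
    - by exists (y1 / y2); rewrite ?rpred_div// hM ?rpredV// hV.
  pose H2P := GRing.isDivringClosed.Build F H2 H2C.
  pose H2D : divringClosed F := HB.pack H2 H2P.
  have hsurj : {in S, forall y, exists2 z, z \in S & h z = y}.
    move=> y; rewrite SA => /(@adjoin_min _ _ iota A H2D).
    have base k : iota k \in H2D by apply/asboolP; exists (iota k); rewrite ?KS ?hK.
    have gen z : A z -> z \in H2D.
      move=> Az; apply/asboolP.
      pose us := undup rs.
      have usA y' : y' \in us <-> A y' by rewrite mem_undup -rsA.
      have zs : z \in us by apply/usA.
      have hus : map h us =i us.
        have umap : uniq (map h us).
          rewrite map_inj_in_uniq ?undup_uniq// => y1 y2 /usA/AS y1S /usA/AS y2S.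
          exact: hinj.
        have hsub : {subset map h us <= us}.
          by move=> _ /mapP[y1 /usA y1A ->]; apply/usA; exact: hA.
        by case: (uniq_min_size umap hsub _) => //; rewrite size_map.
      move: zs; rewrite -hus => /mapP[y1 /usA/AS y1S ->].
      by exists y1.
    by move=> /(_ base gen) /asboolP.
  have [s sh] := gact_intro hS hD hM hK hsurj.
  by rewrite -(hE P) -xP -sh// xfix.
have sP : (size P < size m)%N by rewrite ltn_modp.
have : P^i = x%:P.
  apply/eqP; rewrite -subr_eq0; apply: contraT => Pn0.
  have Pr : all (root (P^i - x%:P)) ts.
    apply/allP => t' /conjE Pt'.
    by rewrite rootE hornerD hornerN hornerC Pt' subrr.
  have := max_poly_roots Pn0 Pr uts; rewrite ltnNge => /negP; case.
  rewrite -ltnS szts; apply: leq_ltn_trans (size_polyD _ _) _.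
  rewrite size_polyN size_map_poly gtn_max sP.
  apply: leq_ltn_trans (size_polyC_leq1 _) _.
  by case: mirr.
move=> /polyP/(_ 0%N); rewrite coef_map coefC eqxx /= => <-.
by exists P`_0.
Qed.

(** The polynomial whose roots are the conjugates of [t] over the larger field
    has coefficients in [K]. Hence [s t] is one of these conjugates [s' t], and
    [s'] extends [s] since [t] generates [S]. *)
Lemma gal_extend (S S' : divringClosed F) t (s : galois_group iota S) :
  (forall k, iota k \in S) -> {subset S <= S'} ->
  (forall (s : galois_group iota S') x, x \in S -> gact s x \in S) ->
  (forall x, x \in S -> (forall s : galois_group iota S', gact s x = x) ->
     exists k, x = iota k) ->
  t \in S -> {subset S <= polyvals iota t} ->
  exists s' : galois_group iota S', {in S, gact s' =1 gact s}.
Proof.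
move=> KS SS' stab fixS tS St.
have KS' k : iota k \in S' by apply: SS'.
have [O [uO OP]] := orbit_enum KS' setT (SS' t tS).
have OS : {subset O <= S} by move=> _ /OP[s' _ <-]; exact: stab.
have sO (s' : galois_group iota S') : perm_eq (map (gact s') O) O.
  by apply: orbit_perm OP _ _.
set P := \prod_(z <- O) ('X - z%:P).
have PK i : exists k, P`_i = iota k.
  apply: fixS => [|s'].
    have h : perm_eq (map (gact (1%g : galois_group iota S)) O) O.
      by rewrite (eq_map (@gact_one _ _ _ _)) map_id.
    by have [] := prod_XsubC_fixed i OS h.
  have OS' : {subset O <= S'} by move=> z /OS/SS'.
  by have [] := prod_XsubC_fixed i OS' (sO s').
pose kc i := sval (cid (PK i)).
pose P0 := \poly_(i < size P) kc i.
have P0E : P0^i = P.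
  apply/polyP => i; rewrite coef_map coef_poly; case: ltnP => iP.
    by rewrite /kc; case: cid.
  by rewrite /= rmorph0 nth_default.
have : gact s t \in O.
  rewrite -root_prod_XsubC -/P -P0E; apply: gact_root => //.
  rewrite P0E root_prod_XsubC; apply/OP; exists 1%g => //.
  exact: gact_one.
move=> /OP[s' _ s't]; exists s' => x /St/polyvalsP[R ->].
by rewrite !gact_horner// ?SS'// s't.
Qed.

(** Take the limit of [tau] along an ultrafilter that contains all final
    segments of the integers. *)
Lemma gal_cluster (S : nat -> divringClosed F) (Soo : divringClosed F)
    (tau : forall n, galois_group iota (S n)) :
  (forall n k, iota k \in S n) ->
  (forall m n, (m <= n)%N -> {subset S m <= S n}) ->
  (forall x, x \in Soo <-> exists n, x \in S n) ->
  exists s : galois_group iota Soo, forall (xs : seq F) N, {subset xs <= Soo} ->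
    exists2 m, (N <= m)%N & {in xs, gact s =1 gact (tau m)}.
Proof.
move=> KS Smon SooP.
have KSoo k : iota k \in Soo by apply/SooP; exists 0%N.
have [U [UU ooU]] := ultraFilterLemma eventually_filter.
have Uge N (A : set nat) : (forall n, (N <= n)%N -> A n) -> U A.
  by move=> NA; apply: ooU; exists N.
have [||||||s sU] := @ultra_limit _ _ iota Soo KSoo _ U UU (fun n => gact (tau n)).
- move=> x xS; have [P P0 Px] := F_alg x.
  have [|rs rsP] := @roots_enum _ (map_poly iota P); first by rewrite map_poly_eq0.
  exists rs; have /SooP[N xN] := xS; apply: (Uge N) => n Nn /=.
  by apply: rsP; apply: gact_root => //; exact: Smon xN.
- move=> x /SooP[N xN]; apply: (Uge N) => n Nn /=; apply/SooP; exists n.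
  by rewrite gact_in (Smon N).
- move=> x y /SooP[N xN] /SooP[M yM]; apply: (Uge (maxn N M)) => n.
  rewrite geq_max => /andP[Nn Mn] /=.
  by rewrite gactD//; [exact: Smon xN|exact: Smon yM].
- move=> x y /SooP[N xN] /SooP[M yM]; apply: (Uge (maxn N M)) => n.
  rewrite geq_max => /andP[Nn Mn] /=.
  by rewrite gactM//; [exact: Smon xN|exact: Smon yM].
- by move=> k; apply: (Uge 0%N) => n _ /=; rewrite gactK.
- move=> y yS; have [P P0 Py] := F_alg y.
  have [|rs rsP] := @roots_enum _ (map_poly iota P); first by rewrite map_poly_eq0.
  exists [seq x <- rs | x \in Soo]; split; first by move=> x; rewrite mem_filter => /andP[].
  have /SooP[N yN] := yS; apply: (Uge N) => n Nn /=.
  have yn := Smon _ _ Nn _ yN.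
  exists (gact (tau n)^-1%g y); last by rewrite gactKV.
  rewrite mem_filter rsP ?gact_root//= andbT; apply/SooP; exists n.
  by rewrite gact_in.
exists s => xs N xsS.
have Uxs : U [set n | {in xs, gact s =1 gact (tau n)}].
  elim: xs xsS => [|x xs IH] xsS; first by apply: (Uge 0%N) => n _ x.
  have Ux := sU x (xsS x (mem_head _ _)).
  have xsS' : {subset xs <= Soo} by move=> y ys; apply: xsS; rewrite in_cons ys orbT.
  apply: filterS (filterI Ux (IH xsS')) => n [/= nx nxs] y.
  by rewrite in_cons => /orP[/eqP ->|/nxs].
have [n [/= ns Nn]] := filter_ex (filterI Uxs (Uge N [set n | (N <= n)%N] (fun n h => h))).
by exists n.
Qed.

End FixedField.

(** * Completeness of finite dimensional spaces *)

Lemma rat_bound (r : rat) : exists N : nat, r < N%:R.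
Proof.
exists (Num.bound `|r|); apply: le_lt_trans (ler_norm r) _.
exact: archi_boundP.
Qed.

Lemma val_ge_all0 (F : fieldType) (v : valuation F) (x : F) (C : rat) :
  (forall k : nat, ((k%:R - C)%:E <= v x)%E) -> x = 0.
Proof.
move=> vx; apply/eqP; apply: contraT => x0; have [r vr] := val_fin v x0.
have [N rN] := rat_bound (r + C).
by have := vx N; rewrite vr lee_fin lerBlDr leNgt rN.
Qed.

Section Completeness.
Variables (p : nat) (p_prime : prime p).
Variables (Qp : fieldType) (vp : valuation Qp) (QpP : is_Qp p vp).
Variables (E : fieldType) (j : {rmorphism Qp -> E}) (v : valuation E).
Hypothesis v_ext : forall x, v (j x) = vp x.

Lemma vp_p : vp p%:R = 1%:E.
Proof.
have p0 := prime_gt0 p_prime.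
by rewrite (Qp_val QpP)// -[X in logn _ X]expn1 pfactorK.
Qed.

Lemma vp_pX k : vp (p%:R ^+ k) = k%:R%:E.
Proof. by rewrite (valX_fin _ vp_p). Qed.

Lemma v_pX k : v (p%:R ^+ k) = k%:R%:E.
Proof. by rewrite -(rmorph_nat j) -rmorphXn v_ext vp_pX. Qed.

Lemma series_limit (c : nat -> Qp) (C : rat) :
  (forall k, ((k%:R - C)%:E <= vp (c k)%R)%E) ->
  exists l, forall k, ((k%:R - C)%:E <= vp (l - \sum_(i < k) c i)%R)%E.
Proof.
move=> cC; pose s n := \sum_(i < n) c i.
have sub m n : (n <= m)%N -> ((n%:R - C)%:E <= vp (s m - s n)%R)%E.
  move=> nm; rewrite /s -!(big_mkord xpredT c) (big_cat_nat (leq0n n) nm)//= addrAC subrr add0r.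
  rewrite big_nat; apply: val_sum_ge => i /andP[ni _].
  by apply: le_trans (cC i); rewrite lee_fin lerD2r ler_nat.
have [r|l lP] := Qp_complete QpP (u := s).
  have [N rN] := rat_bound (r + C); exists N => m n Nm Nn.
  have big k : (N <= k)%N -> (r%:E < vp (s k - s N)%R)%E.
    move=> Nk; apply: lt_le_trans (sub _ _ Nk).
    by rewrite lte_fin ltrBrDr.
  have -> : s m - s n = (s m - s N) - (s n - s N) by ring.
  by apply: val_sub_gt; apply: big.
exists l => k; have [N NP] := lP (k%:R - C).
have -> : l - s k = (s (maxn N k) - s k) - (s (maxn N k) - l).
  by ring.
apply: val_sub_ge; first by apply: sub; exact: leq_maxr.
by apply/ltW/NP; exact: leq_maxl.
Qed.

(** [qspan e x] says that [x] is a linear combination of [e] over [Qp]. The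
    recursion peels off one vector at a time, which is how the proofs below
    proceed. *)
Fixpoint qspan (e : seq E) (x : E) : Prop :=
  if e is y :: e' then exists c : Qp, qspan e' (x - j c * y) else x = 0.

(** As [qspan], with coefficients of valuation at least [r]. *)
Fixpoint bspan (r : rat) (e : seq E) (x : E) : Prop :=
  if e is y :: e' then
    exists2 c : Qp, (r%:E <= vp c)%E & bspan r e' (x - j c * y)
  else x = 0.

Lemma bspan_le r s e x : s <= r -> bspan r e x -> bspan s e x.
Proof.
move=> sr; elim: e x => [|y e IH] x //= [c rc /IH h]; exists c => //.
by apply: le_trans rc; rewrite lee_fin.
Qed.

Lemma span0 e : qspan e 0.
Proof. by elim: e => [|y e IH] //=; exists 0; rewrite rmorph0 mul0r subr0. Qed.

Lemma spanD e x y : qspan e x -> qspan e y -> qspan e (x + y).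
Proof.
elim: e x y => [|z e IH] x y /=; first by move=> -> ->; rewrite addr0.
move=> [c xc] [d yd]; exists (c + d).
by rewrite rmorphD mulrDl opprD addrACA; exact: IH.
Qed.

Lemma spanZ e c x : qspan e x -> qspan e (j c * x).
Proof.
elim: e x => [|z e IH] x /=; first by move=> ->; rewrite mulr0.
move=> [d xd]; exists (c * d); rewrite rmorphM -mulrA -mulrBr; exact: IH.
Qed.

Lemma spanN e x : qspan e x -> qspan e (- x).
Proof. by move=> h; rewrite -mulN1r -(rmorph1 j) -rmorphN; exact: spanZ. Qed.

Lemma spanB e x y : qspan e x -> qspan e y -> qspan e (x - y).
Proof. by move=> xe ye; apply: spanD => //; exact: spanN. Qed.

Lemma span_sum e (I : Type) (r : seq I) (f : I -> E) :
  (forall i, qspan e (f i)) -> qspan e (\sum_(i <- r) f i).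
Proof. by move=> fe; apply: big_ind => //; [exact: span0|exact: spanD]. Qed.

Lemma span_mem e y : y \in e -> qspan e y.
Proof.
elim: e => // z e IH; rewrite in_cons => /orP[/eqP ->|/IH ye] /=.
  by exists 1; rewrite rmorph1 mul1r subrr; exact: span0.
by exists 0; rewrite rmorph0 mul0r subr0.
Qed.

Lemma bspanZ r s e c x : (s%:E <= vp c)%E -> bspan r e x ->
  bspan (r + s) e (j c * x).
Proof.
move=> cs; elim: e x => [|z e IH] x /=; first by move=> ->; rewrite mulr0.
move=> [d rd xd]; exists (c * d); last by rewrite rmorphM -mulrA -mulrBr; exact: IH.
by rewrite valM addrC EFinD; apply: leeD.
Qed.

Lemma bspan_val e : exists B : rat, forall r x, bspan r e x -> ((r - B)%:E <= v x)%E.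
Proof.
elim: e => [|y e [B IH]]; first by exists 0 => r x ->; rewrite val0 leey.
have [->|y0] := eqVneq y 0.
  by exists B => r x /= [c _]; rewrite mulr0 subr0; exact: IH.
have [s vs] := val_fin v y0; exists (Num.max B (- s)) => r x /= [c rc /IH xB].
rewrite -(subrK (j c * y) x); apply: valD_ge.
  by apply: le_trans xB; rewrite lee_fin lerD2l lerN2 le_max lexx.
rewrite valM v_ext vs; apply: (@le_trans _ _ (r%:E + s%:E)%E).
  by rewrite -EFinD lee_fin lerD2l lerNl le_max lexx orbT.
exact: leeD.
Qed.

Lemma bspan_series e (u : nat -> E) (C : rat) :
  (forall k : nat, bspan (k%:R - C) e (u k)) ->
  exists w (D : rat), qspan e w /\
    forall k : nat, ((k%:R - D)%:E <= v (w - \sum_(i < k) u i)%R)%E.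
Proof.
elim: e u => [|y e IH] u /= uC.
  exists 0, 0; split=> // k; rewrite big1 => [|i _]; last exact: uC.
  by rewrite !subr0 val0 leey.
have cex k : exists c : Qp, ((k%:R - C)%:E <= vp c)%E /\
    bspan (k%:R - C) e (u k - j c * y) by have [c] := uC k; exists c.
pose c k := sval (cid (cex k)).
have cP k : ((k%:R - C)%:E <= vp (c k)%R)%E /\ bspan (k%:R - C) e (u k - j (c k) * y).
  by rewrite /c; case: cid.
have [l lP] := series_limit (fun k => proj1 (cP k)).
have [w [D [we wD]]] := IH _ (fun k => proj2 (cP k)).
have [y0|y0] := eqVneq y 0.
  exists w, D; split=> [|k]; first by exists 0; rewrite rmorph0 mul0r subr0.
  have := wD k; congr (_ <= v _)%E; congr (_ - _); apply: eq_bigr => i _.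
  by rewrite y0 mulr0 subr0.
have [s vs] := val_fin v y0; exists (w + j l * y), (Num.max D (C - s)); split.
  by exists l; rewrite addrK.
move=> k; have -> : w + j l * y - \sum_(i < k) u i =
    (w - \sum_(i < k) (u i - j (c i) * y)) + j (l - \sum_(i < k) c i) * y.
  rewrite sumrB rmorphB rmorph_sum mulrBl mulr_suml; ring.
apply: valD_ge.
  by apply: le_trans (wD k); rewrite lee_fin lerD2l lerN2 le_max lexx.
rewrite valM v_ext vs; apply: (@le_trans _ _ ((k%:R - C)%:E + s%:E)%E).
  by rewrite -EFinD lee_fin -addrA lerD2l lerNl opprD opprK le_max lexx orbT.
by apply: leeD => //; exact: lP.
Qed.

(** If [y] is not in the span of [e], it stays at a positive distance from this
    span: otherwise the differences of closer and closer approximations have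
    small coordinates by induction, their sum converges in the span, and its
    limit is [y] up to sign. The distance bounds the coefficient of [y] in an
    integral combination, and the rest of the combination is bounded by
    induction. *)
Lemma bounded_coords e : exists C : rat, forall x, qspan e x -> (0 <= v x)%E ->
  bspan (- C) e x.
Proof.
elim: e => [|y e [C IH]]; first by exists 0.
have IHs k x : qspan e x -> ((k%:R : rat)%:E <= v x)%E -> bspan (k%:R - C) e x.
  move=> xe kx; rewrite -[x](_ : j (p%:R ^+ k) * (j (p%:R ^- k) * x) = x).
    rewrite addrC; apply: bspanZ; first by rewrite vp_pX.
    apply: IH; first exact: spanZ.
    rewrite valM v_ext (valV_fin (vp_pX k)) -[0%E]/((0 : rat)%:E).
    by rewrite -(addNr (k%:R : rat)) EFinD; exact: leeD.
  rewrite mulrA -rmorphM mulfV ?rmorph1 ?mul1r//.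
  exact: val_neq0 (vp_pX k).
have [ye|ynot] := pselect (qspan e y).
  exists C => x [c xe] x0 /=.
  have xe' : qspan e x.
    by rewrite -(subrK (j c * y) x); apply: spanD => //; exact: spanZ.
  exists 0; first by rewrite val0 leey.
  by rewrite rmorph0 mul0r subr0; exact: IH.
(* B measures the distance from y to the span of e. *)
have [B yB] : exists B : nat, forall w, qspan e w -> (v (y + w)%R <= (B%:R : rat)%:E)%E.
  apply: contrapT => nB.
  have wex k : exists w, qspan e w /\ ((k%:R : rat)%:E <= v (y + w)%R)%E.
    apply: contrapT => nw; apply: nB; exists k => w we.
    rewrite leNgt; apply/negP => kw; apply: nw; exists w; split=> //.
    exact: ltW.
  pose w k := sval (cid (wex k)).
  have wP k : qspan e (w k) /\ ((k%:R : rat)%:E <= v (y + w k)%R)%E by rewrite /w; case: cid.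
  have dP k : bspan (k%:R - C) e (w k.+1 - w k).
    apply: IHs; first by apply: spanB; case: (wP k.+1); case: (wP k).
    have -> : w k.+1 - w k = (y + w k.+1) - (y + w k).
      by rewrite opprD addrACA subrr add0r.
    apply: val_sub_ge; last by case: (wP k).
    by apply: le_trans (proj2 (wP k.+1)); rewrite lee_fin ler_nat.
  have [z [D [ze zD]]] := bspan_series dP.
  apply: ynot; have -> : y = - (z + w 0%N).
    apply/eqP; rewrite -addr_eq0; apply/eqP.
    apply: (@val_ge_all0 _ v _ (Num.max D 0)) => k.
    have -> : y + (z + w 0%N) =
        (y + w k) + (z - \sum_(i < k) (w i.+1 - w i)).
      rewrite -(big_mkord xpredT (fun i => w i.+1 - w i)) telescope_sumr//.
      by ring.
    apply: valD_ge.
      apply: le_trans (proj2 (wP k)); rewrite lee_fin lerBlDr lerDl.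
      by rewrite le_max lexx orbT.
    by apply: le_trans (zD k); rewrite lee_fin lerD2l lerN2 le_max lexx.
  by apply: spanN; apply: spanD => //; case: (wP 0%N).
have y0 : y != 0 by apply: contra_not_neq ynot => ->; exact: span0.
have [s vs] := val_fin v y0.
have [N NP] := rat_bound (B%:R - s).
have m0 : 0 <= Num.max C 0 by rewrite le_max lexx orbT.
have mC : C <= Num.max C 0 by rewrite le_max lexx.
have N0 : 0 <= N%:R :> rat by exact: ler0n.
exists (B%:R + N%:R + Num.max C 0) => x [c xe] x0 /=.
have cB : ((- B%:R)%:E <= vp c)%E.
  have [->|c0] := eqVneq c 0; first by rewrite val0 leey.
  have [t vt] := val_fin vp c0; rewrite vt lee_fin.
  have jc0 : j c != 0 by rewrite fmorph_eq0.
  have : (v (y + j c^-1 * (x - j c * y)%R)%R <= (B%:R : rat)%:E)%E.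
    by apply: yB; exact: spanZ.
  rewrite mulrBr mulrA -rmorphM mulVf// rmorph1 mul1r addrC subrK.
  have [->|xn0] := eqVneq x 0; first by rewrite mulr0 val0.
  have [q vq] := val_fin v xn0.
  rewrite valM v_ext (valV_fin vt) vq -EFinD lee_fin => h.
  move: x0; rewrite vq lee_fin => q0.
  by lra.
exists c.
  by apply: le_trans cB; rewrite lee_fin; lra.
have -> : x - j c * y = j (p%:R ^- (B + N)) * (j (p%:R ^+ (B + N)) * (x - j c * y)).
  rewrite mulrA -rmorphM mulVf ?rmorph1 ?mul1r//; exact: val_neq0 (vp_pX _).
apply: (@bspan_le ((0%:R - C) + - (B + N)%:R)); first by rewrite natrD; lra.
apply: bspanZ; first by rewrite (valV_fin (vp_pX _)).
apply: (IHs 0%N); first exact: spanZ.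
rewrite valM v_ext vp_pX.
have : ((- (B + N)%:R : rat)%:E <= v (x - j c * y)%R)%E.
  apply: val_sub_ge.
    by apply: le_trans x0; rewrite lee_fin oppr_le0.
  rewrite valM v_ext vs; apply: (@le_trans _ _ ((- B%:R)%:E + s%:E)%E).
    rewrite -EFinD lee_fin natrD opprD lerD2l lerNl.
    by apply: ltW; apply: le_lt_trans NP; rewrite lerDr.
  exact: leeD.
have [->|xy0] := eqVneq (x - j c * y) 0; first by rewrite val0 leey.
have [q ->] := val_fin v xy0.
by rewrite -EFinD !lee_fin addrC -lerBlDr sub0r.
Qed.

End Completeness.

(** * Values and residues of p-adic numbers *)

(** There are finitely many polynomials of bounded size with coefficients in
    [cs], and each has finitely many roots. *)
Lemma poly_roots_enum (k : fieldType) (cs : seq k) d :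
  exists rs : seq k, forall P : {poly k}, P != 0 -> (size P <= d)%N ->
    (forall i, P`_i \in cs) -> forall z, root P z -> z \in rs.
Proof.
have [Ps PsP] : exists Ps : seq {poly k}, forall P : {poly k}, (size P <= d)%N ->
    (forall i, P`_i \in cs) -> P \in Ps.
  elim: d => [|d [Ps IH]].
    by exists [:: 0] => P; rewrite leqn0 size_poly_eq0 mem_seq1.
  exists [seq Q * 'X + c%:P | Q <- Ps, c <- cs] => P Pd Pcs.
  apply/allpairsP; exists (\poly_(i < d) P`_i.+1, P`_0); split=> //=.
    apply: IH; first exact: size_poly.
    move=> i; rewrite coef_poly; case: ifP => // _.
    by rewrite -(nth_default 0 Pd) Pcs.
  apply/polyP => -[|i]; rewrite coefD coefMX coefC /= ?add0r// addr0 coef_poly.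
  by case: ltnP => // di; rewrite nth_default// (leq_trans Pd).
have [rs rsP] : exists rs : seq k, forall P, P \in Ps -> P != 0 ->
    forall z, root P z -> z \in rs.
  elim: Ps {PsP} => [|Q Ps [rs IH]]; first by exists [::].
  have [Q0|Q0] := eqVneq Q 0.
    exists rs => P; rewrite in_cons => /orP[/eqP -> /eqP//|/IH]; exact.
  have [qs qsP] := roots_enum Q0; exists (qs ++ rs) => P.
  rewrite in_cons => /orP[/eqP -> _|PPs P0] z Pz; rewrite mem_cat.
    by rewrite qsP.
  by rewrite (IH P)// orbT.
by exists rs => P P0 Pd Pcs; apply: rsP => //; exact: PsP.
Qed.

Section QpValues.
Variables (p : nat) (p_prime : prime p).
Variables (Qp : fieldType) (vp : valuation Qp) (QpP : is_Qp p vp).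

Lemma Qp_natr_neq0 n : (0 < n)%N -> n%:R != 0 :> Qp.
Proof. by move=> n0; apply: val_neq0 (Qp_val QpP n0). Qed.

Lemma Qp_pchar : [pchar Qp] =i pred0.
Proof.
apply/pcharf0P => n; have [->|n0] := posnP n; first by rewrite eqxx.
by rewrite (negPf (Qp_natr_neq0 n0)); move: n0; case: n.
Qed.

Lemma vp_int (z : int) : z != 0 -> vp z%:~R = (logn p `|z|)%:R%:E.
Proof.
case: z => n n0; first by rewrite (Qp_val QpP)// lt0n.
by rewrite NegzE rmorphN /= valN (Qp_val QpP).
Qed.

Lemma Qp_ratr0 : ratr 0 = 0 :> Qp.
Proof. by rewrite /ratr -[numq 0]/(0 : int) mul0r. Qed.

Lemma Qp_approx (x : Qp) : x != 0 -> exists q : rat, vp x = vp (ratr q) /\ q != 0.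
Proof.
move=> x0; have [r vr] := val_fin vp x0; have [q qx] := Qp_dense QpP x r.
exists q; have e : vp x = vp (ratr q).
  by rewrite -[ratr q](subKr x) val_ltD// valN vr.
split=> //; apply: contra_neq x0 => q0; move: e.
by rewrite q0 Qp_ratr0 val0 => /val_pinfty.
Qed.

Lemma Qp_ratr (q : rat) : ratr q = (numq q)%:~R / (denq q)%:~R :> Qp.
Proof. by []. Qed.

Lemma vp_Z (x : Qp) : x != 0 -> exists z : int, vp x = (z%:~R)%:E.
Proof.
move=> /Qp_approx[q [-> q0]].
have n0 : numq q != 0 by rewrite numq_eq0.
exists ((logn p `|numq q|)%:Z - (logn p `|denq q|)%:Z).
by rewrite Qp_ratr valM (valV_fin (vp_int (denq_neq0 q))) (vp_int n0) -EFinB rmorphB.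
Qed.

(** Approximate [x] by a rational number. If it is integral its denominator is
    prime to [p], hence invertible modulo [p]. *)
Lemma Qp_residue (x : Qp) : (0 <= vp x)%E -> exists m : nat, (0 < vp (x - m%:R)%R)%E.
Proof.
move=> x0; have [q qx] := Qp_dense QpP x 0.
have q0 : (0 <= vp (ratr q)%R)%E.
  by rewrite -[ratr q](subKr x); apply: val_sub_ge => //; exact: ltW.
suff [m qm] : exists m : nat, (0 < vp (ratr q - m%:R)%R)%E.
  by exists m; rewrite -(subrKA (ratr q)); apply: valD_gt.
have [->|qn0] := eqVneq q 0; first by exists 0%N; rewrite Qp_ratr0 subrr val0.
have n0 : numq q != 0 by rewrite numq_eq0.
set D := `|denq q|%N.
have DE : denq q = D :> int by rewrite /D absz_denq.
have D0 : (0 < D)%N by rewrite /D absz_gt0 denq_neq0.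
have pD : coprime p D.
  rewrite prime_coprime//; apply/negP => pD.
  have pn : ~~ (p %| `|numq q|)%N.
    apply/negP => pn; have := coprime_num_den q; rewrite /coprime -/D => /eqP g1.
    have : (p %| gcdn `|numq q| D)%N by rewrite dvdn_gcd pn pD.
    by rewrite g1 Euclid_dvd1.
  move: q0; rewrite Qp_ratr valM (valV_fin (vp_int (denq_neq0 q))) (vp_int n0).
  rewrite -EFinB lee_fin -/D.
  have -> : logn p `|numq q| = 0%N.
    by apply/eqP; rewrite -leqn0 leqNgt logn_gt0 mem_primes (negPf pn) !andbF.
  rewrite sub0r oppr_ge0 lern0 => /eqP lD.
  have : (0 < logn p D)%N by rewrite logn_gt0 mem_primes p_prime D0.
  by rewrite lD.
have [u uD] : exists u : nat, (u * D = 1 %[mod p])%N.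
  have [a b ab _] := egcdnP p D0.
  exists a; rewrite /= in ab *; rewrite ab gcdnC (eqP pD) mulnC.
  by rewrite mulnC modnMDl.
have [w wn] : exists w : nat, (w%:Z = numq q %[mod p%:Z])%Z.
  exists `|(numq q %% p%:Z)%Z|%N.
  by rewrite gez0_abs ?modz_ge0 ?modz_mod// eqz_nat -lt0n prime_gt0.
exists (u * w)%N.
have D0' : D%:R != 0 :> Qp by rewrite Qp_natr_neq0.
have vD : (0%:E <= vp (D%:R^-1 : Qp)%R)%E.
  rewrite (valV_fin (Qp_val QpP D0)).
  have -> : logn p D = 0%N; last by rewrite oppr0.
  apply/eqP; rewrite -leqn0 leqNgt logn_gt0 mem_primes p_prime D0 /=.
  by rewrite -prime_coprime.
have -> : ratr q - (u * w)%N%:R = (numq q - (u * w * D)%N%:Z)%:~R / D%:R :> Qp.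
  rewrite Qp_ratr DE rmorphB /= mulrBl; congr (_ - _).
  by rewrite -pmulrn [in RHS]natrM mulfK.
have [z zE] : exists z : int, numq q - (u * w * D)%N%:Z = p%:Z * z.
  have : (p%:Z %| numq q - (u * w * D)%N%:Z)%Z.
    rewrite -eqz_mod_dvd; apply/eqP; rewrite -wn.
    apply/eqP; rewrite !modz_nat eqz_nat.
    by rewrite -mulnA mulnCA -modnMmr uD modnMmr muln1.
  by move=> /dvdzP[z ->]; exists z; rewrite mulrC.
rewrite zE rmorphM /= -mulrA; apply: valM_gt0.
  by rewrite (vp_p p_prime QpP) lte_fin.
apply: valM_ge0 => //.
have [->|z0] := eqVneq z 0; first by rewrite val0.
by rewrite (vp_int z0) lee_fin ler0n.
Qed.
End QpValues.

(** * Values and residues in a finite dimensional space *)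

Section FiniteDim.
Variables (p : nat) (p_prime : prime p).
Variables (Qp : fieldType) (vp : valuation Qp) (QpP : is_Qp p vp).
Variables (E : fieldType) (j : {rmorphism Qp -> E}) (v : valuation E).
Hypothesis v_ext : forall x, v (j x) = vp x.

Lemma span_coords (e : seq E) x : qspan j e x ->
  exists c : nat -> Qp, x = \sum_(k < size e) j (c k) * e`_k.
Proof.
elim: e x => [|y e IH] x /=; first by exists (fun _ => 0); rewrite big_ord0.
move=> [d /IH[c xc]]; exists (fun k => if k is k'.+1 then c k' else d).
by rewrite big_ord_recl /= -(subrK (j d * y) x) xc addrC.
Qed.

(** There is one power of [y] more than there are vectors in [e], so that the
    powers are linearly dependent. *)
Lemma span_annihilator (e : seq E) y : (forall i, qspan j e (y ^+ i)) ->
  exists P : {poly Qp}, [/\ P != 0, (size P <= (size e).+1)%N & root (map_poly j P) y].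
Proof.
move=> ye.
have cex i : exists c : nat -> Qp, y ^+ i = \sum_(k < size e) j (c k) * e`_k.
  exact: span_coords.
pose c i := sval (cid (cex i)).
have cE i : y ^+ i = \sum_(k < size e) j (c i k) * e`_k by rewrite /c; case: cid.
set D := size e in cE *.
pose M := \matrix_(i < D.+1, k < D) c i k.
have : kermx M != 0.
  rewrite -mxrank_eq0 mxrank_ker subn_eq0 -ltnNge.
  exact: leq_ltn_trans (rank_leq_col M) _.
move=> /rowV0Pn[u /sub_kermxP uM u0].
pose P := \poly_(i < D.+1) u 0 (inord i).
have PE (i : 'I_D.+1) : P`_i = u 0 i by rewrite coef_poly ltn_ord inord_val.
exists P; split.
- apply: contra_neq u0 => P0; apply/rowP => i.
  by rewrite -PE P0 coef0 mxE.
- exact: size_poly.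
- rewrite rootE (@horner_coef_wide _ D.+1); last first.
    by rewrite size_map_poly size_poly.
  under eq_bigr => i _.
    rewrite coef_map /= PE cE mulr_sumr.
    under eq_bigr => k _ do rewrite mulrA -rmorphM.
    over.
  rewrite exchange_big /=; apply/eqP/big1 => k _.
  rewrite -mulr_suml -rmorph_sum /=.
  have -> : \sum_(i < D.+1) u 0 i * c i k = (u *m M) 0 k.
    by rewrite mxE; apply: eq_bigr => i _; rewrite mxE.
  by rewrite uM mxE rmorph0 mul0r.
Qed.

(** In a vanishing sum the smallest valuation is attained twice. *)
Lemma root_val_eq (P : {poly Qp}) y : P != 0 -> y != 0 -> root (map_poly j P) y ->
  exists i k : nat, [/\ (i < size P)%N, (k < size P)%N, i != k, P`_i != 0 &
    P`_k != 0 /\ v (j P`_i * y ^+ i) = v (j P`_k * y ^+ k)].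
Proof.
move=> P0 y0 Py; set n := size P; pose T (i : 'I_n) := j P`_i * y ^+ i.
have n0 : (0 < n)%N by rewrite size_poly_gt0.
have ltn : (n.-1 < n)%N by rewrite ltn_predL.
pose i0 : 'I_n := Ordinal ltn.
have T0 (i : 'I_n) : (T i == 0) = (P`_i == 0).
  by rewrite /T mulf_eq0 expf_eq0 (negPf y0) andbF orbF fmorph_eq0.
have Pi0 : P`_i0 != 0 by rewrite -/(lead_coef P) lead_coef_eq0.
pose i := [arg min_(i < i0 | P`_i != 0) v (T i)]%O.
have [Pi mini] : P`_i != 0 /\ forall k : 'I_n, P`_k != 0 -> (v (T i)%R <= v (T k)%R)%E.
  by rewrite /i; case: arg_minP.
have sum0 : \sum_(k < n) T k = 0.
  move: Py; rewrite rootE horner_coef size_map_poly => /eqP e; rewrite -[RHS]e.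
  by apply: eq_bigr => k _; rewrite coef_map.
have Tin0 : T i != 0 by rewrite T0.
have [r vr] := val_fin v Tin0.
apply: contrapT => none.
have : (r%:E < v (\sum_(k < n | k != i) T k)%R)%E.
  apply: val_sum_gt => k ki; have [Pk|Pk] := eqVneq P`_k 0.
    by have /eqP -> : T k == 0; rewrite ?T0 ?Pk// val0 ltey.
  rewrite -vr lt_neqAle mini// andbT; apply/eqP => e.
  apply: none; exists i, k; split=> //; first by rewrite val_eqE eq_sym.
have -> : \sum_(k < n | k != i) T k = - T i.
  by move: sum0; rewrite (bigD1 i)//= addrC => /eqP; rewrite addr_eq0 => /eqP.
by rewrite valN vr ltxx.
Qed.

(** By [root_val_eq] the multiple [(k - i) * v y] is a difference of valuations
    of elements of [Qp], that is an integer; the factorial is a common multiple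
    of all the possible [k - i]. *)
Lemma span_val_denom (e : seq E) y : (forall i, qspan j e (y ^+ i)) -> y != 0 ->
  exists z : int, v y = (z%:~R / ((size e)`!)%:R)%:E.
Proof.
move=> ye y0; have [P [P0 Pe Py]] := span_annihilator ye.
have [i [k [iP kP ik Pi [Pk]]]] := root_val_eq P0 y0 Py.
wlog ltik : i k iP kP ik Pi Pk / (i < k)%N => [W|].
  move=> e'; have [lt|gt|eq] := ltngtP i k; first exact: (W i k).
    by apply: (W k i) => //; rewrite eq_sym.
  by rewrite eq eqxx in ik.
have [s vs] := val_fin v y0.
have [z1 vz1] := vp_Z QpP Pi; have [z2 vz2] := vp_Z QpP Pk.
rewrite !valM !v_ext vz1 vz2 !(valX_fin _ vs) -!EFinD => -[] h.
have d0 : (0 < k - i)%N by rewrite subn_gt0.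
have ddiv : (k - i %| (size e)`!)%N.
  apply: dvdn_fact; rewrite d0 /=; apply: leq_trans (leq_subr _ _) _.
  by rewrite -ltnS; exact: leq_trans Pe.
have [q qE] := dvdnP ddiv.
exists ((z1 - z2) * q%:Z); rewrite vs; congr (_%:E).
have f0 : ((size e)`!)%:R != 0 :> rat by rewrite pnatr_eq0 -lt0n fact_gt0.
apply: (mulIf f0); rewrite divfK// qE natrM rmorphM rmorphB /=.
have -> : z1%:~R - z2%:~R = s * (k - i)%:R :> rat.
  rewrite natrB ?(ltnW ltik)// mulrBr !mulr_natr.
  by move: h; lra.
by rewrite -mulrA [X in _ = _ * X]mulrC pmulrn.
Qed.

(** Divide an annihilating polynomial of [y] by one of its coefficients of
    smallest valuation: its reduction is a nonzero polynomial of bounded degree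
    over the prime field, and has the residue of [y] as a root. *)
Lemma span_residues_finite (e : seq E) :
  exists rs : seq (residue v), forall y, (forall i, qspan j e (y ^+ i)) ->
    (0 <= v y)%E -> red v y \in rs.
Proof.
have [rs rsP] := poly_roots_enum [seq m%:R : residue v | m <- iota 0 p] (size e).+1.
exists rs => y ye y0; have [P [P0 Pe Py]] := span_annihilator ye.
set n := size P.
have n0 : (0 < n)%N by rewrite size_poly_gt0.
have ltn : (n.-1 < n)%N by rewrite ltn_predL.
pose i := [arg min_(i < Ordinal ltn | P`_i != 0) vp P`_i]%O.
have [Pi mini] : P`_i != 0 /\ forall k : 'I_n, P`_k != 0 -> (vp P`_i <= vp P`_k)%E.
  rewrite /i; case: arg_minP => //=.
  by rewrite -/(lead_coef P) lead_coef_eq0.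
have [r vr] := val_fin vp Pi.
pose Q := (P`_i)^-1 *: P.
have Qint k : (0 <= vp Q`_k)%E.
  rewrite coefZ; have [Pk|Pk] := eqVneq P`_k 0; first by rewrite Pk mulr0 val0.
  have kn : (k < n)%N by rewrite ltnNge; apply: contra_neqN Pk; exact: nth_default.
  have := mini (Ordinal kn) Pk; rewrite /= vr valM (valV_fin vr).
  have [t ->] := val_fin vp Pk.
  by rewrite -EFinD !lee_fin addrC subr_ge0.
have Qi : Q`_i = 1 by rewrite coefZ mulVf.
have Qy : root (map_poly j Q) y by rewrite map_polyZ rootZ// fmorph_eq0 invr_eq0.
have p_red : p%:R = 0 :> residue v.
  apply/eqP; rewrite -(red_nat v) red_eq0 ?val_nat_ge0//.
  by rewrite -(rmorph_nat j) v_ext (vp_p p_prime QpP) lte_fin.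
pose R := \poly_(k < n) red v (j Q`_k).
have sQ : size Q = n by rewrite size_scale// invr_eq0.
have jint k : (0 <= v (j Q`_k)%R)%E by rewrite v_ext.
have RE k : R`_k = red v (j Q`_k).
  rewrite coef_poly; case: ltnP => // nk.
  by rewrite [Q`_k]nth_default ?sQ// rmorph0 red0.
apply: (rsP R).
- apply/eqP => R0; have := RE i; rewrite R0 coef0 Qi rmorph1 red1 => /eqP.
  by rewrite eq_sym oner_eq0.
- by apply: leq_trans Pe; exact: size_poly.
- move=> k; rewrite RE; have [m qm] := Qp_residue p_prime QpP (Qint k).
  have -> : red v (j Q`_k) = m%:R.
    rewrite -(red_nat v); apply/red_eq; rewrite ?val_nat_ge0//.
    by rewrite -(rmorph_nat j) -rmorphB v_ext.
  apply/mapP; exists (m %% p)%N.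
    by rewrite mem_iota /= add0n ltn_pmod// prime_gt0.
  by rewrite {1}(divn_eq m p) natrD natrM p_red mulr0 add0r.
- rewrite rootE (@horner_coef_wide _ n) ?size_poly//.
  have : red v (map_poly j Q).[y] = 0 by rewrite (rootP Qy) red0.
  rewrite horner_coef size_map_poly sQ -(big_mkord xpredT (fun k => (map_poly j Q)`_k * y ^+ k)).
  rewrite red_sum => [|k]; last by rewrite coef_map; apply: valM_ge0; [exact: jint|exact: valX_ge0].
  rewrite big_mkord => e0; apply/eqP; rewrite -[RHS]e0; apply: eq_bigr => k _.
  by rewrite coef_map /= RE redM ?redX ?valX_ge0.
Qed.

End FiniteDim.

(** * Invariance of the valuation *)

Section LocalField.
Variables (p : nat) (p_prime : prime p).
Variables (Qp : fieldType) (vp : valuation Qp) (QpP : is_Qp p vp).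
Variables (K : fieldExtType Qp) (F : closedFieldType) (iota : {rmorphism K -> F}).
Hypothesis F_alg : forall x : F, algebraicOver iota x.
Variables (v : valuation F).
Hypothesis v_ext : forall x : Qp, v (iota x%:A) = vp x.
Local Notation "P ^i" := (map_poly iota P) (at level 2, format "P ^i").

Definition Qp_to : {rmorphism Qp -> F} := (iota \o GRing.in_alg K)%FUN.
Local Notation j := Qp_to.

Lemma K_pchar : [pchar K] =i pred0.
Proof. by move=> q; rewrite pchar_lalg (Qp_pchar QpP). Qed.

Lemma v_p : v p%:R = 1%:E.
Proof. by rewrite -(rmorph_nat j) [LHS]v_ext (vp_p p_prime QpP). Qed.

Lemma base_span : exists B : seq F,
  (forall b, b \in B -> exists k, b = iota k) /\ forall k, qspan j B (iota k).
Proof.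
pose B := vbasis (fullv : {vspace K}).
exists (map iota B); split=> [_ /mapP[k _ ->]|k]; first by exists k.
rewrite (coord_vbasis (memvf k)) rmorph_sum; apply: span_sum => i.
rewrite -mulr_algl rmorphM; apply: spanZ; apply: span_mem.
by apply: map_f; apply: mem_nth; rewrite size_tuple.
Qed.

Lemma qspan_mulr (B e : seq F) x y : qspan j B x ->
  (forall b, b \in B -> qspan j e (b * y)) -> qspan j e (x * y).
Proof.
elim: B x => [|b B IH] x /=; first by move=> -> _; rewrite mul0r; exact: span0.
move=> [c xc] By; rewrite -(subrK (j c * b) x) mulrDl; apply: spanD.
  by apply: IH => // b' b'B; apply: By; rewrite in_cons b'B orbT.
by rewrite -mulrA; apply: spanZ; apply: By; exact: mem_head.
Qed.

(** The products of a basis of [K] with the powers of [t] below the degree of a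
    polynomial that annihilates [t]. *)
Lemma alg_span t : exists e : seq F,
  (forall y, y \in e -> exists P : {poly K}, y = P^i.[t]) /\
  forall P : {poly K}, qspan j e P^i.[t].
Proof.
have [m m0 mt] := F_alg t; have [B [BK BP]] := base_span.
exists [seq b * t ^+ i | b <- B, i <- seq.iota 0 (size m)]; split.
  move=> _ /allpairsP[[b i] /= [/BK[k ->] _ ->]]; exists (k *: 'X^i).
  by rewrite map_polyZ map_polyXn hornerZ hornerXn.
move=> P; have [d mE] : exists d, size m = d by exists (size m).
have -> : P^i.[t] = (P %% m)^i.[t].
  by rewrite {1}(divp_eq P m) rmorphD rmorphM hornerD hornerM (rootP mt) mulr0 add0r.
rewrite (@horner_coef_wide _ (size m)); last by rewrite size_map_poly ltnW// ltn_modp.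
apply: span_sum => i; rewrite coef_map; apply: qspan_mulr (BP _) _ => b bB.
apply: span_mem; apply/allpairsP; exists (b, i : nat); split=> //=.
by rewrite mem_iota /= add0n.
Qed.

Lemma v_pXz (z : int) : v (p%:R ^ z) = (z%:~R)%:E.
Proof.
case: z => n; first exact: (v_pX p_prime QpP (v_ext : forall x, v (j x) = vp x)).
rewrite NegzE -exprnN.
by rewrite (valV_fin (v_pX p_prime QpP (v_ext : forall x, v (j x) = vp x) _)) rmorphN.
Qed.

Lemma K_val_denom : exists M : nat, (0 < M)%N /\ forall k : K, k != 0 ->
  exists z : int, v (iota k) = (z%:~R / M%:R)%:E.
Proof.
have [B [_ BP]] := base_span; exists (size B)`!; split; first exact: fact_gt0.
move=> k k0; apply: (span_val_denom QpP (j := j)) => // [i|].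
  by rewrite -rmorphXn; exact: BP.
by rewrite fmorph_eq0.
Qed.

Lemma residues_finite (S : {pred F}) t :
  (forall x n, x \in S -> x ^+ n \in S) -> {subset S <= polyvals iota t} ->
  exists rs : seq (residue v), forall x, x \in S -> (0 <= v x)%E -> red v x \in rs.
Proof.
move=> SX St; have [e [_ eP]] := alg_span t.
have [rs rsP] := span_residues_finite p_prime QpP (v_ext : forall x, v (j x) = vp x) e.
exists rs => x xS x0; apply: rsP => // i.
by have /St/polyvalsP[P ->] := SX x i xS; exact: eP.
Qed.

Section PreservesValuation.
Variable S : divringClosed F.
Hypothesis KS : forall k, iota k \in S.
Local Notation G := (galois_group iota S).

Lemma gact_bspan (s : G) r e x : {subset e <= S} -> x \in S ->
  bspan vp j r e x -> bspan vp j r (map (gact s) e) (gact s x).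
Proof.
elim: e x => [|y e IH] x eS xS /=; first by move=> ->; rewrite gact0.
have yS : y \in S by apply: eS; exact: mem_head.
have jS c : j c \in S by exact: KS.
move=> [c rc xc]; exists c => //.
have -> : gact s x - j c * gact s y = gact s (x - j c * y).
  by rewrite gactB ?gactM ?rpredM// (gactK KS).
apply: IH => //; last by rewrite rpredB ?rpredM.
by move=> z ze; apply: eS; rewrite in_cons ze orbT.
Qed.

(** The powers of [x] are integral and lie in a finite dimensional space, so
    their coordinates are bounded. Those of the powers of [gact s x] in the
    conjugate generators are the same. The valuations of these powers are thus
    bounded below, which excludes [v (gact s x) < 0]. *)
Lemma gact_val_ge0 (s : G) x : x \in S -> (0 <= v x)%E -> (0 <= v (gact s x)%R)%E.
Proof.
move=> xS x0; have [e [eK eP]] := alg_span x.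
have v_ext' : forall x, v (j x) = vp x by exact: v_ext.
have [C CP] := bounded_coords p_prime QpP v_ext' e.
have [B BP] := bspan_val v_ext' (map (gact s) e).
have eS : {subset e <= S} by move=> y /eK[P ->]; exact: horner_in.
have bnd n : ((- C - B)%:E <= v (gact s x ^+ n)%R)%E.
  apply: BP; rewrite -gactX//; apply: gact_bspan; rewrite ?rpredX//.
  apply: CP; last exact: valX_ge0.
  by have := eP 'X^n; rewrite map_polyXn hornerXn.
rewrite leNgt; apply/negP => sx.
have sx0 : gact s x != 0 by apply: contraTneq sx => ->; rewrite val0.
have [r vr] := val_fin v sx0; rewrite vr lte_fin in sx.
have [N NP] := rat_bound ((C + B) / - r).
have := bnd N; rewrite (valX_fin _ vr) lee_fin -mulr_natr.
rewrite ltr_pdivrMr ?oppr_gt0// in NP.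
by lra.
Qed.

(** A power of [y] multiplied by a power of [p] has valuation zero, and
    [gact_val_ge0] applies to it. *)
Lemma gact_val (s : G) x : x \in S -> v (gact s x) = v x.
Proof.
have main (t : G) y : y \in S -> (v y <= v (gact t y)%R)%E.
  move=> yS; have [->|y0] := eqVneq y 0; first by rewrite gact0.
  have ty0 : gact t y != 0.
    by apply: contra_neq y0 => ty; apply: (@gact_inj _ _ _ _ t); rewrite gact0.
  have [r vr] := val_fin v y0; have [q vq] := val_fin v ty0.
  pose d := `|denq r|%N; pose w := y ^+ d * p%:R ^ (- numq r).
  have d0 : (0 < d)%N by rewrite absz_gt0 denq_neq0.
  have dE : d%:R = (denq r)%:~R :> rat by rewrite pmulrn /d absz_denq.
  have pS : p%:R ^ (- numq r) \in S.
    by case: (- numq r) => m; rewrite /= ?rpredV rpredX// rpred_nat.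
  have pfix : gact t (p%:R ^ (- numq r)) = p%:R ^ (- numq r).
    have -> : p%:R ^ (- numq r) = iota (p%:R ^ (- numq r)).
      by rewrite fmorphXz rmorph_nat.
    by rewrite gactK.
  have rE : (numq r)%:~R = r * d%:R by rewrite dE -{2}(divq_num_den r) divfK ?intr_eq0.
  have w0 : (0 <= v w)%E.
    rewrite valM (valX_fin _ vr) v_pXz -EFinD lee_fin rmorphN /= rE mulr_natr.
    by rewrite subrr.
  have := @gact_val_ge0 t w; rewrite rpredM ?rpredX// => /(_ isT w0).
  rewrite gactM ?rpredX// gactX// pfix valM (valX_fin _ vq) v_pXz -EFinD lee_fin.
  rewrite rmorphN /= rE -[q *+ d]mulr_natr -mulrBl pmulr_lge0 ?ltr0n// subr_ge0.
  by rewrite vr vq lee_fin.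
move=> xS; apply/eqP; rewrite eq_le main// andbT.
by have := main s^-1%g (gact s x); rewrite gact_in gactVK => /(_ xS).
Qed.

Lemma inertia_normal : is_normal (inertia_group iota S v : groupClosed G).
Proof. by apply: gact_normal => // s x xS; rewrite gact_val. Qed.

End PreservesValuation.

End LocalField.

(** * The Frobenius map in characteristic p *)

Section CharP.
Variables (p : nat) (k : fieldType) (pk : p \in [pchar k]).

Lemma pchar_prime : prime p. Proof. exact: pcharf_prime pk. Qed.

Lemma frobX_inj i : injective (fun x : k => x ^+ (p ^ i)).
Proof.
elim: i => [|i IH] x y; first by rewrite !expr1.
rewrite expnSr !exprM => xy; apply: IH.
exact: (fmorph_inj (pFrobenius_aut pk)).
Qed.

(** The [p] integers are already the roots of [X^p - X]. *)
Lemma frob_fixed (c : k) : c ^+ p = c -> exists m : nat, c = m%:R.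
Proof.
move=> cp; apply: contrapT => nc.
have p1 := prime_gt1 pchar_prime.
pose rs := c :: [seq m%:R | m <- iota 0 p].
pose P : {poly k} := 'X^p - 'X.
have sP : size P = p.+1.
  rewrite size_polyDl; first by rewrite size_polyXn.
  by rewrite size_polyN size_polyX size_polyXn.
have P0 : P != 0 by rewrite -size_poly_gt0 sP.
have urs : uniq rs.
  rewrite /= map_inj_in_uniq ?iota_uniq ?andbT.
    by apply/mapP => -[m _ cm]; apply: nc; exists m.
  move=> m1 m2; rewrite !mem_iota /= !add0n.
  wlog le12 : m1 m2 / (m1 <= m2)%N => [W m1p m2p e|m1p m2p /eqP].
    by case/orP: (leq_total m1 m2) => le; [exact: W|apply/esym/W].
  rewrite eq_sym -subr_eq0 -natrB// -(dvdn_pcharf pk) => d.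
  apply/eqP; rewrite eqn_leq le12 -subn_eq0.
  rewrite -[(_ - _)%N](@modn_small _ p); last exact: leq_ltn_trans (leq_subr _ _) m2p.
  by [].
have rP : all (root P) rs.
  apply/allP => x; rewrite in_cons => /orP[/eqP ->|/mapP[m _ ->]].
    by rewrite rootE !hornerE cp subrr.
  rewrite rootE !hornerE -(pFrobenius_autE pk) pFrobenius_aut_nat subrr//.
by have := max_poly_roots P0 rP urs; rewrite sP /= size_map size_iota ltnn.
Qed.

(** The Frobenius map permutes the factors, hence fixes the coefficients. An
    integral coefficient is the point: the polynomial lifts to characteristic
    zero with coefficients that every automorphism fixes. *)
Lemma frob_orbit_poly (w : k) N : w ^+ (p ^ N) = w ->
  exists m : nat -> nat, \prod_(0 <= i < N) ('X - (w ^+ (p ^ i))%:P) =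
    \poly_(i < N.+1) (m i)%:R :> {poly k}.
Proof.
move=> wN; set P := \prod_(0 <= i < N) _.
pose f : {rmorphism k -> k} := pFrobenius_aut pk.
have fP : map_poly f P = P.
  rewrite /P rmorph_prod /=.
  under eq_bigr => i _ do
    rewrite map_polyXsubC /f /= pFrobenius_autE -exprM -expnSr.
  case: N wN @P => [|N] wN P; first by rewrite !big_nil.
  rewrite [LHS]big_nat_recr//= [RHS]big_nat_recl//= mulrC; congr (_ * _).
  by rewrite wN expr1.
have Pc i : exists m : nat, P`_i = m%:R.
  by apply: frob_fixed; rewrite -[in RHS]fP coef_map.
pose m i := sval (cid (Pc i)).
exists m; apply/polyP => i; rewrite coef_poly.
have -> : (m i)%:R = P`_i by rewrite /m; case: cid.
case: ltnP => // Ni; rewrite nth_default//.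
rewrite /P -(big_map (fun i => w ^+ (p ^ i)) xpredT (fun z => 'X - z%:P)).
by rewrite size_prod_XsubC size_map size_iota subn0.
Qed.

End CharP.

(** * The action on residues *)

Section ResidueGenerator.
Variables (p : nat) (F : fieldType) (v : valuation F).
Hypothesis pk : p \in [pchar (residue v)].
Variable S : divringClosed F.
Variable rs : seq (residue v).
Hypothesis rsP : forall x, x \in S -> (0 <= v x)%E -> red v x \in rs.

Lemma residue_enum : exists ks : seq (residue v), uniq ks /\
  forall y, y \in ks <-> exists x, [/\ x \in S, (0 <= v x)%E & red v x = y].
Proof.
pose Q y := exists x, [/\ x \in S, (0 <= v x)%E & red v x = y].
exists (undup [seq y <- rs | `[< Q y >]]); split; first exact: undup_uniq.
move=> y; rewrite mem_undup mem_filter; split=> [/andP[/asboolP]//|Qy].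
apply/andP; split; first exact/asboolP.
by case: Qy => x [xS x0 <-]; exact: rsP.
Qed.

(** The nonzero residues form a finite multiplicative group of some order [q]
    in a field, so they are the powers of one of them. Since [q] is prime to
    [p], Euler's theorem makes [totient q] a period of the Frobenius map. *)
Lemma residue_generator : exists w N, [/\ w \in S, v w = 0%E, (0 < N)%N,
  red v w ^+ (p ^ N) = red v w &
  forall x, x \in S -> (0 <= v x)%E -> red v x = 0 \/ exists i, red v x = red v w ^+ i].
Proof.
have [ks [uks ksP]] := residue_enum.
pose us := [seq y <- ks | y != 0].
have uus : uniq us by rewrite filter_uniq.
have usP y : y \in us <-> exists x, [/\ x \in S, v x = 0%E & red v x = y].
  rewrite mem_filter; split=> [/andP[y0 /ksP[x [xS x0 xy]]]|[x [xS x0 <-]]].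
    by exists x; split=> //; apply: red_neq0; rewrite ?xy.
  rewrite red_eq0 ?x0// ltxx /=; apply/ksP.
  by exists x; rewrite x0.
have us1 : 1 \in us by apply/usP; exists 1; rewrite rpred1 val1 red1.
have usM y z : y \in us -> z \in us -> y * z \in us.
  move=> /usP[x [xS x0 <-]] /usP[x' [xS' x0' <-]]; apply/usP; exists (x * x').
  by rewrite rpredM// valM x0 x0' adde0 redM ?x0 ?x0'.
pose q := size us.
have q0 : (0 < q)%N by rewrite /q; case: (us) us1.
have us0 y : y \in us -> y != 0 by rewrite mem_filter => /andP[].
have usX y : y \in us -> y ^+ q = 1.
  move=> yus; have y0 := us0 y yus.
  have perm : perm_eq (map ( *%R y) us) us.
    apply: uniq_perm; rewrite ?map_inj_uniq//; first exact: mulfI.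
    have um : uniq (map ( *%R y) us) by rewrite map_inj_uniq//; exact: mulfI.
    have sub : {subset map ( *%R y) us <= us} by move=> _ /mapP[z zus ->]; exact: usM.
    by case: (uniq_min_size um sub) => //; rewrite size_map.
  have : \prod_(z <- map ( *%R y) us) z = \prod_(z <- us) z by apply: perm_big.
  rewrite big_map big_split /= big_const_seq count_predT iter_mulr_1 -/q => e.
  have P0 : \prod_(z <- us) z != 0 by rewrite prodf_seq_neq0; apply/allP => z /us0.
  by apply: (mulIf P0); rewrite e mul1r.
have /hasP[g gus gprim] : has q.-primitive_root us.
  apply: cyclic.has_prim_root => //; apply/allP => y yus.
  by apply/unity_rootP; exact: usX.
have [w [wS w0 wg]] := (usP g).1 gus.
have pp := pchar_prime pk.
have coqp : coprime p q.
  rewrite prime_coprime// (dvdn_pcharf pk).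
  by have := prim_root_dvd_eq0 gprim (dvdnn q).
exists w, (totient q); split=> //.
- by rewrite totient_gt0.
- by rewrite wg -(prim_expr_mod gprim) cyclic.Euler_exp_totient// prim_expr_mod// expr1.
- move=> x xS x0; have [->|rx0] := eqVneq (red v x) 0; first by left.
  right; have : red v x \in us.
    by apply/usP; exists x; split=> //; exact: red_neq0.
  by move=> /usX /(prim_rootP gprim)[i ->]; exists i; rewrite wg.
Qed.
End ResidueGenerator.

Section FrobeniusAction.
Variables (p : nat) (K F : fieldType) (iota : {rmorphism K -> F}) (v : valuation F).
Hypothesis pk : p \in [pchar (residue v)].
Variables (S S' : divringClosed F).
Hypothesis KS' : forall k, iota k \in S'.
Hypothesis SS' : {subset S <= S'}.
Local Notation G := (galois_group iota S').
Hypothesis stab : forall (s : G) x, x \in S -> gact s x \in S.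
Hypothesis v_act : forall (s : G) x, x \in S' -> v (gact s x) = v x.
Variable rs : seq (residue v).
Hypothesis rsP : forall x, x \in S -> (0 <= v x)%E -> red v x \in rs.

Definition acts_as_frob (s : G) i :=
  forall x, x \in S -> (0 <= v x)%E -> red v (gact s x) = red v x ^+ (p ^ i).

Lemma frob_period : exists2 N, (0 < N)%N &
  forall x, x \in S -> (0 <= v x)%E -> red v x ^+ (p ^ N) = red v x.
Proof.
have [w [N [wS w0 N0 wN wP]]] := residue_generator pk rsP.
exists N => // x xS x0; have [->|[i ->]] := wP x xS x0.
  by rewrite expr0n expn_eq0 eqn0Ngt (prime_gt0 (pchar_prime pk)).
by rewrite -exprM mulnC exprM wN.
Qed.

(** A lift of [frob_orbit_poly] vanishes modulo the maximal ideal at the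
    generator [w], hence also at its conjugate: the residue of [gact s w] is a
    Frobenius conjugate of that of [w]. All nonzero residues are powers of this
    one. *)
Lemma frob_actsP (s : G) : exists i, acts_as_frob s i.
Proof.
have [w [N [wS w0 N0 wN wP]]] := residue_generator pk rsP.
have w0' : (0 <= v w)%E by rewrite w0.
have [m mE] := frob_orbit_poly pk wN.
have swS := stab s wS.
have sw0 : (0 <= v (gact s w)%R)%E by rewrite v_act ?SS'// w0.
have prodE x : x \in S -> (0 <= v x)%E ->
    red v (\sum_(i < N.+1) (m i)%:R * x ^+ i) =
    (\prod_(0 <= i < N) ('X - (red v w ^+ (p ^ i))%:P)).[red v x].
  move=> xS x0; rewrite mE horner_poly -(big_mkord xpredT (fun i => (m i)%:R * x ^+ i)).
  rewrite red_sum => [|i]; last by rewrite valM_ge0 ?val_nat_ge0 ?valX_ge0.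
  rewrite big_mkord; apply: eq_bigr => i _.
  by rewrite redM ?val_nat_ge0 ?valX_ge0// red_nat redX.
have zS x : x \in S -> \sum_(i < N.+1) (m i)%:R * x ^+ i \in S.
  by move=> xS; rewrite rpred_sum// => i _; rewrite rpredM ?rpred_nat ?rpredX.
have z0 x : (0 <= v x)%E -> (0 <= v (\sum_(i < N.+1) (m i)%:R * x ^+ i)%R)%E.
  by move=> x0; apply: val_sum_ge => i _; rewrite valM_ge0 ?val_nat_ge0 ?valX_ge0.
have rz : red v (\sum_(i < N.+1) (m i)%:R * w ^+ i) = 0.
  rewrite prodE//; case: (N) N0 => // N' _.
  by rewrite big_nat_recl//= hornerM hornerXsubC expr1 subrr mul0r.
have szE : gact s (\sum_(i < N.+1) (m i)%:R * w ^+ i) =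
    \sum_(i < N.+1) (m i)%:R * gact s w ^+ i.
  have wS' := SS' wS.
  rewrite (gact_sum KS') => [|i]; last by rewrite rpredM ?rpred_nat ?rpredX.
  apply: eq_bigr => i _; rewrite gactM ?rpred_nat ?rpredX// (gactX KS')//.
  by rewrite -(rmorph_nat iota) (gactK KS').
have : red v (\sum_(i < N.+1) (m i)%:R * gact s w ^+ i) = 0.
  move: rz => /eqP; rewrite red_eq0 ?z0// => rz.
  by apply/eqP; rewrite -szE red_eq0 v_act ?SS' ?zS// z0.
rewrite prodE// -(big_map (fun i => red v w ^+ (p ^ i)) xpredT (fun z => 'X - z%:P)).
move=> /eqP; rewrite -rootE root_prod_XsubC => /mapP[i _ swi].
exists i => x xS x0; have [rx|[k rx]] := wP x xS x0.
  rewrite rx expr0n expn_eq0 eqn0Ngt (prime_gt0 (pchar_prime pk)) /=.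
  by apply/eqP; rewrite red_eq0 v_act ?SS'// -red_eq0// rx.
have : (0 < v (x - w ^+ k)%R)%E.
  by apply/red_eq; rewrite ?valX_ge0// redX.
rewrite -(v_act s) ?SS' ?rpredB ?rpredX// gactB ?SS' ?rpredX//.
rewrite (gactX KS') ?SS'// => /red_eq -> //; rewrite ?valX_ge0 ?v_act ?SS'//.
by rewrite redX// swi rx -!exprM mulnC.
Qed.

Lemma acts_as_frobM (s t : G) i k : acts_as_frob s i -> acts_as_frob t k ->
  acts_as_frob (s * t)%g (i + k).
Proof.
move=> si tk x xS x0; rewrite gact_mul si ?stab ?v_act ?SS'//.
by rewrite tk// -exprM -expnD addnC.
Qed.

Lemma acts_as_frobX (s : G) d u : acts_as_frob s d -> acts_as_frob (s ^+ u)%g (u * d).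
Proof.
move=> sd; elim: u => [|u IH]; last by rewrite expgS mulSn; exact: acts_as_frobM.
by move=> x _ _; rewrite expg0 gact_one mul0n expr1.
Qed.

(** Let [g] act as the smallest positive power [d] of the Frobenius map that is
    realized; Euclidean division by [d] shows that the other automorphisms act
    as powers of [g]. *)
Lemma residue_gal_cyclic : exists g : G, forall s : G, exists u : nat,
  forall x, x \in S -> (0 <= v x)%E -> red v (gact s x) = red v (gact (g ^+ u)%g x).
Proof.
have [N N0 NP] := frob_period.
pose Q d := `[< (0 < d)%N /\ exists g, acts_as_frob g d >].
have exQ : exists d, Q d.
  exists N; apply/asboolP; split=> //; exists 1%g => x xS x0.
  by rewrite gact_one NP.
have [d /asboolP[d0 [g gd]] dmin] := ex_minnP exQ.
exists g => s; have [i si] := frob_actsP s.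
have [r sr] := frob_actsP (s * g ^- (i %/ d))%g.
have gu := acts_as_frobX (i %/ d) gd.
have sr' : acts_as_frob (s * g ^- (i %/ d))%g (i %% d).
  move=> x xS x0; rewrite sr//.
  have := acts_as_frobM sr gu xS x0; rewrite -mulgA mulVg mulg1 si//.
  by rewrite {1}(divn_eq i d) addnC !expnD !exprM => /(frobX_inj pk) ->.
have i0 : (i %% d = 0)%N.
  apply/eqP; rewrite -leqn0 leqNgt; apply/negP => id0.
  have Qid : Q (i %% d)%N.
    by apply/asboolP; split=> //; exists (s * g ^- (i %/ d))%g.
  by have := dmin _ Qid; rewrite leqNgt ltn_pmod.
exists (i %/ d)%N => x xS x0.
by rewrite si// gu// {1}(divn_eq i d) i0 addn0.
Qed.

End FrobeniusAction.

(** * The fixed field of inertia *)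

Lemma coef_prod_XsubC_ind (R : nzRingType) (Q : R -> Prop) (A : seq R) :
  Q 0 -> Q 1 -> (forall x y, Q x -> Q y -> Q (x - y)) ->
  (forall x y, Q x -> Q y -> Q (x * y)) ->
  (forall z, z \in A -> Q z) -> forall i, Q (\prod_(z <- A) ('X - z%:P))`_i.
Proof.
move=> Q0 Q1 QB QM; elim: A => [|z A IH] QA i.
  by rewrite big_nil coef1; case: eqP.
rewrite big_cons mulrBl coefB coefXM coefCM; apply: QB.
  by case: eqP => // _; apply: IH => y yA; apply: QA; rewrite in_cons yA orbT.
apply: QM; first by apply: QA; exact: mem_head.
by apply: IH => y yA; apply: QA; rewrite in_cons yA orbT.
Qed.

Lemma val_coef_prod_XsubC (F : fieldType) (v : valuation F) (A : seq F) j :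
  (forall z, z \in A -> (0 <= v z)%E) ->
  (0 <= v (\prod_(z <- A) ('X - z%:P))%R`_j)%E.
Proof.
move=> A0; apply: (@coef_prod_XsubC_ind _ (fun z => (0 <= v z)%E)) => //.
- by rewrite val0.
- by rewrite val1.
- by move=> x y; exact: val_sub_ge.
- by move=> x y; exact: valM_ge0.
Qed.

Section Unramified.
Variables (p : nat) (K F : fieldType) (iota : {rmorphism K -> F}) (v : valuation F).
Hypothesis pk : p \in [pchar (residue v)].
Variable S : divringClosed F.
Hypothesis KS : forall k, iota k \in S.
Local Notation G := (galois_group iota S).
Local Notation I := (inertia_group iota S v).
Hypothesis v_act : forall (s : G) x, x \in S -> v (gact s x) = v x.
Variable rs : seq (residue v).
Hypothesis rsP : forall x, x \in S -> (0 <= v x)%E -> red v x \in rs.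

Let SS : {subset S <= S}. Proof. by []. Qed.
Let stab : forall (s : G) x, x \in S -> gact s x \in S.
Proof. by move=> s x; rewrite gact_in. Qed.

Lemma inertia_redP (s : G) :
  s \in I <-> (forall x, x \in S -> (0 <= v x)%E -> red v (gact s x) = red v x).
Proof.
split=> [/inertiaP sI x xS x0|sI].
  by apply/red_eq; rewrite ?v_act// sI.
by apply/inertiaP => x xS x0; apply/red_eq; rewrite ?v_act// sI.
Qed.

Lemma gal_inertia_cyclic : exists g : G, forall s : G, exists u : nat,
  (g ^- u * s)%g \in I.
Proof.
have [g gP] := residue_gal_cyclic pk KS SS stab v_act rsP.
exists g => s; have [u uP] := gP s; exists u; apply/inertia_redP => x xS x0.
have := uP x xS x0; rewrite gact_mul => /red_eq.
rewrite !v_act// => /(_ x0 x0) h; apply/red_eq; rewrite ?v_act ?gact_in//.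
by rewrite -(v_act (g ^+ u)%g) ?rpredB ?gact_in// gactB ?gact_in// gactKV.
Qed.

Lemma gal_expg_inertia (g : G) : exists2 N, (0 < N)%N & (g ^+ N)%g \in I.
Proof.
have [N N0 NP] := frob_period pk rsP.
have [d gd] := frob_actsP pk KS SS stab v_act rsP g.
exists N => //; apply/inertia_redP => x xS x0.
rewrite (acts_as_frobX SS stab v_act N gd)//.
elim: d {gd} => [|d IH]; first by rewrite muln0 expr1.
by rewrite mulnS expnD exprM NP.
Qed.

Hypothesis fixG : forall x, x \in S -> (forall s : G, gact s x = x) -> exists k, x = iota k.
Hypothesis Ip : finite_pgroup p (subgroup_of (I : groupClosed G)).

Lemma inertia_enum : exists sI : seq G, [/\ uniq sI,
  forall s, (s \in sI) = (s \in I) & exists k, size sI = (p ^ k)%N].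
Proof.
have [k /has_order_enum[s [us sT sk]]] := Ip.
exists (map val s); split; last by exists k; rewrite size_map.
- by rewrite map_inj_uniq//; exact: val_inj.
- move=> t; apply/mapP/idP => [[u _ ->]|tI]; first exact: (valP u).
  by exists (Sub t tI); rewrite ?sT// SubK.
Qed.

(** Let [o] be the order of a generator [g] of the group modulo inertia. The
    norm [w1] over inertia of a generator of the residues is fixed by inertia;
    its residue is a Frobenius power of that generator because inertia is a
    p-group, so that the first [o] conjugates of [w1] under [g] have distinct
    residues. Let [P] vanish at these conjugates except [w1] itself: then
    [P.[w1]] is a unit, and [y * P.[w1]] is a combination, with the integral
    coefficients of [P], of the traces [T (y * w1 ^+ j)]. These traces lie in
    [K] and have valuation at least [v y], so one of them has valuation [v y].
    *)
Lemma inertia_fixed_val y : y \in S -> y != 0 ->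
  (forall s, s \in I -> gact s y = y) -> exists k, v (iota k) = v y.
Proof.
move=> yS y0 yI.
have [g gP] := gal_inertia_cyclic.
have [o /andP[o0 goI] omin] : exists2 o, (0 < o)%N && ((g ^+ o)%g \in I) &
    forall i, (0 < i)%N -> (i < o)%N -> (g ^+ i)%g \notin I.
  have [N N0 gN] := gal_expg_inertia g.
  have ex : exists o, (0 < o)%N && ((g ^+ o)%g \in I) by exists N; rewrite N0.
  have [o oP omin] := ex_minnP ex; exists o => // i i0 io; apply/negP => giI.
  by have := omin i; rewrite i0 giI leqNgt io => /(_ isT).
have [d gd] := frob_actsP pk KS SS stab v_act rsP g.
have [w [N [wS w0 N0 wN wP]]] := residue_generator pk rsP.
have w0' : (0 <= v w)%E by rewrite w0.
have [sI [uI sIP [k sk]]] := inertia_enum.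
pose w1 := \prod_(t <- sI) gact t w.
have w1S : w1 \in S by rewrite rpred_prod// => t _; rewrite gact_in.
have v0 x : x \in S -> v x = 0%E -> (0 <= v x)%E by move=> _ ->.
have rw1 : red v w1 = red v w ^+ (p ^ k).
  rewrite red_prod => [|t _]; last by rewrite v_act// w0.
  rewrite (eq_big_seq (fun=> red v w)) => [|t]; last first.
    by rewrite sIP => /inertia_redP ->.
  by rewrite big_const_seq count_predT iter_mulr_1 sk.
have w10 : (0 <= v w1)%E by apply: val_prod_ge0 => t _; rewrite v_act// w0.
have Ifix s : s \in I -> gact s w1 = w1.
  move=> sI'; rewrite /w1 (gact_prod KS) => [|t _]; last by rewrite gact_in.
  have sperm : perm_eq (map (fun t => s * t)%g sI) sI.
    apply: uniq_perm; rewrite ?map_inj_uniq//; first exact: mulgI.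
    move=> t; rewrite sIP; apply/mapP/idP => [[t' + ->]|tI].
      by rewrite sIP => t'I; rewrite gpredM.
    exists (s^-1 * t)%g; last by rewrite mulVKg.
    by rewrite sIP gpredM ?gpredV.
  rewrite -[RHS](perm_big _ sperm) big_map; apply: eq_bigr => t _.
  by rewrite gact_mul.
(* A coincidence of residues would put a smaller power of g in inertia. *)
have sep i : (0 < i)%N -> (i < o)%N -> v (w1 - gact (g ^+ i)%g w1) = 0%E.
  move=> i0 io; have giw : (0 <= v (gact (g ^+ i)%g w1)%R)%E by rewrite v_act.
  have d0 : (0 <= v (w1 - gact (g ^+ i)%g w1)%R)%E by apply: val_sub_ge.
  apply/eqP; rewrite eq_le d0 andbT leNgt; apply/negP => dpos.
  have rdi := acts_as_frobX SS stab v_act i gd.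
  have : red v w1 = red v (gact (g ^+ i)%g w1) by apply/red_eq.
  rewrite rdi// rw1 -!exprM mulnC exprM => /(frobX_inj pk) rwi.
  have := omin i i0 io; apply/negP; rewrite negbK; apply/inertia_redP => x xS x0.
  rewrite rdi//; have [->|[m ->]] := wP x xS x0.
    by rewrite expr0n expn_eq0 eqn0Ngt (prime_gt0 (pchar_prime pk)).
  by rewrite -exprM mulnC exprM -rwi.
pose T z := \sum_(0 <= i < o) gact (g ^+ i)%g z.
have TK z : z \in S -> (forall s, s \in I -> gact s z = z) -> exists k, T z = iota k.
  move=> zS zI.
  have TS : T z \in S by rewrite rpred_sum// => i _; rewrite gact_in.
  have giS i : gact (g ^+ i)%g z \in S by rewrite gact_in.
  have gT : gact g (T z) = T z.
    rewrite /T (gact_sum KS)//.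
    have -> : \sum_(0 <= i < o) gact g (gact (g ^+ i)%g z) =
              \sum_(0 <= i < o) gact (g ^+ i.+1)%g z.
      by apply: eq_bigr => i _; rewrite expgS gact_mul.
    case: (o) o0 goI => // o' _ goI; rewrite [LHS]big_nat_recr//= [RHS]big_nat_recl//=.
    by rewrite expg0 gact_one zI// addrC.
  have guT u : gact (g ^+ u)%g (T z) = T z.
    by elim: u => [|u IH]; rewrite ?expg0 ?gact_one// expgS gact_mul IH.
  have tT t : t \in I -> gact t (T z) = T z.
    move=> tI; rewrite /T (gact_sum KS)//; apply: eq_bigr => i _.
    have tgI : (t ^ (g ^+ i))%g \in I.
      by apply: (gact_normal KS) => // s x xS x0; rewrite v_act.
    rewrite -[in RHS](zI _ tgI) -!gact_mul /conjg; congr (gact _ z).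
    by rewrite !mulgA mulgV mul1g.
  apply: fixG => // s; have [u uI'] := gP s.
  have -> : s = (g ^+ u * (g ^- u * s))%g by rewrite mulVKg.
  by rewrite gact_mul tT// guT.
pose A := [seq gact (g ^+ i)%g w1 | i <- seq.iota 1 o.-1].
pose P := \prod_(z <- A) ('X - z%:P).
have AS z : z \in A -> z \in S by move=> /mapP[i _ ->]; rewrite gact_in.
have A0 z : z \in A -> (0 <= v z)%E by move=> /mapP[i _ ->]; rewrite v_act.
have P0 j : (0 <= v P`_j)%E by exact: val_coef_prod_XsubC.
have vPw : v P.[w1] = 0%E.
  rewrite /P horner_prod big_map.
  rewrite (@val_prod_const _ v _ _ _ 0) ?mul0rn// => i.
  rewrite mem_iota add1n prednK// => /andP[i0 io].
  by rewrite hornerXsubC sep.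
(* P vanishes at all the conjugates but the first. *)
have sumE : \sum_(0 <= i < o) gact (g ^+ i)%g y * P.[gact (g ^+ i)%g w1] = y * P.[w1].
  rewrite (big_ltn o0) expg0 !gact_one big_nat big1 ?addr0// => i /andP[i1 io].
  have /rootP -> : root P (gact (g ^+ i)%g w1); last by rewrite mulr0.
  by rewrite root_prod_XsubC; apply: map_f; rewrite mem_iota i1 add1n prednK.
have sumE' : \sum_(0 <= i < o) gact (g ^+ i)%g y * P.[gact (g ^+ i)%g w1] =
    \sum_(j < size P) P`_j * T (y * w1 ^+ j).
  under eq_bigr => i _ do rewrite horner_coef mulr_sumr.
  rewrite exchange_big /=; apply: eq_bigr => j _; rewrite /T mulr_sumr.
  apply: eq_bigr => i _; rewrite gactM ?rpredX// (gactX KS)//.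
  by rewrite mulrCA.
have [r vr] := val_fin v y0.
have [j vj] : exists j : 'I_(size P), (v (T (y * w1 ^+ j))%R <= v y)%E.
  apply: contrapT => nj.
  have : (r%:E < v (\sum_(j < size P) P`_j * T (y * w1 ^+ j))%R)%E.
    apply: val_sum_gt => j _; rewrite valM -[r%:E]add0e lee_ltD//.
    by rewrite -vr ltNge; apply/negP => le; apply: nj; exists j.
  by rewrite -sumE' sumE valM vPw adde0 vr ltxx.
have ywS : y * w1 ^+ j \in S by rewrite rpredM ?rpredX.
have [|q qE] := TK (y * w1 ^+ j) ywS.
  by move=> s sI'; rewrite gactM ?rpredX// (gactX KS)// yI// Ifix.
exists q; rewrite -qE; apply/eqP; rewrite eq_le vj /=.
apply: val_sum_ge => i _; rewrite v_act// valM -[leLHS]adde0.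
by apply: leeD => //; exact: valX_ge0.
Qed.

End Unramified.

(** * The dynamics around points of valuation rho *)

Lemma exprDn_ends (R : comNzRingType) n (x d : R) :
  (x + d) ^+ n.+1 = x ^+ n.+1 +
    (d ^+ n.+1 + \sum_(i < n) (x ^+ (n - i) *+ 'C(n.+1, i.+1)) * d ^+ i.+1).
Proof.
rewrite exprDn big_ord_recl/= subn0 expr0 mulr1 bin0 mulr1n; congr (_ + _).
rewrite big_ord_recr /= /bump /= add1n subnn expr0 mul1r binn mulr1n addrC.
congr (_ + _); apply: eq_bigr => i _.
by rewrite /bump /= add1n subSS mulrnAl.
Qed.

Section Dynamics.
Variables (p : nat) (p_prime : prime p) (F : fieldType) (v : valuation F).
Hypothesis v_p : v p%:R = 1%:E.
Variable c : F.
Hypothesis v_c : v c = (- (p%:R / (p%:R - 1)))%:E.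
Local Notation f := (unicritical p c).
Local Notation q := p.-1.

(** The valuation of the solutions of [x ^ p = c]. *)
Definition rho : rat := - (q%:R)^-1.

Lemma q_gt0 : (0 < q)%N.
Proof. by case: p p_prime => [|[]]. Qed.

Lemma q_gt0R : 0 < q%:R :> rat. Proof. by rewrite ltr0n q_gt0. Qed.

Lemma prime_predK : p = q.+1. Proof. by rewrite prednK// prime_gt0. Qed.

Lemma prime_predKR : p%:R = q%:R + 1 :> rat. Proof. by rewrite {1}prime_predK -natr1. Qed.

Lemma rho_mulq : rho *+ q = -1.
Proof. by rewrite /rho -[LHS]mulr_natr mulNr mulVf// gt_eqF// q_gt0R. Qed.

Lemma rho_lt0 : rho < 0.
Proof. by rewrite /rho oppr_lt0 invr_gt0 q_gt0R. Qed.

Lemma vc_rho : v c = (rho *+ p)%:E.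
Proof.
rewrite v_c -[rho *+ p]mulr_natr prime_predKR /rho; congr (_%:E).
by rewrite addrK mulNr mulrC.
Qed.

Definition diff_coef (x : F) (i : nat) : F := x ^+ (q - i) *+ 'C(p, i.+1).

Lemma unicritical_diff x d :
  f (x + d) - f x = d ^+ p + \sum_(i < q) diff_coef x i * d ^+ i.+1.
Proof.
have := exprDn_ends q x d; rewrite -!prime_predK /unicritical => ->.
by rewrite /diff_coef opprB addrA subrK addrC addKr.
Qed.

(** The inner binomial coefficients are divisible by [p], and the valuation of
    a power of [x] with exponent at most [p - 1] is at least [-1]. *)
Lemma diff_coef_ge0 x i : v x = rho%:E -> (i < q)%N -> (0 <= v (diff_coef x i)%R)%E.
Proof.
move=> vx iq; have pC : (p %| 'C(p, i.+1))%N.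
  by apply: prime_dvd_bin => //; rewrite /= prime_predK ltnS.
have [m mE] := dvdnP pC; rewrite /diff_coef -mulr_natr mE natrM mulrA [_ * p%:R]mulrC.
rewrite mulrA valM; apply: adde_ge0; last exact: val_nat_ge0.
rewrite mulrC valM v_p (valX_fin _ vx) -EFinD lee_fin.
have : rho *+ q <= rho *+ (q - i) by apply: ler_wnMn2l; [exact: ltW rho_lt0|exact: leq_subr].
by rewrite rho_mulq -[leRHS]opprK lerNl; move=> h; lra.
Qed.

Lemma diff_coef0 x : v x = rho%:E -> v (diff_coef x 0) = 0%E.
Proof.
move=> vx; rewrite /diff_coef bin1 subn0 -mulr_natr valM v_p (valX_fin _ vx).
by rewrite rho_mulq -EFinD addNr.
Qed.

Lemma diff_ge0 x d : v x = rho%:E -> (0 <= v d)%E -> (0 <= v (f (x + d) - f x)%R)%E.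
Proof.
move=> vx d0; rewrite unicritical_diff; apply: valD_ge; first exact: valX_ge0.
apply: val_sum_ge => i _; apply: valM_ge0; last exact: valX_ge0.
exact: diff_coef_ge0.
Qed.

(** The term [d ^ p] dominates. *)
Lemma diff_lt0 x d (s : rat) : v x = rho%:E -> v d = s%:E -> s < 0 ->
  v (f (x + d) - f x) = (s *+ p)%:E.
Proof.
move=> vx vd s0; rewrite unicritical_diff.
rewrite val_ltD (valX_fin _ vd)//; apply: val_sum_gt => i _.
rewrite valM (valX_fin _ vd); apply: (@lt_le_trans _ _ (0 + (s *+ i.+1)%:E)%E).
  rewrite add0e lte_fin ltr_nMn2l//.
  by have := ltn_ord i; rewrite -ltnS -prime_predK.
by apply: leeD => //; exact: diff_coef_ge0.
Qed.

Lemma diff_int x d : v x = rho%:E -> (0 <= v (f (x + d) - f x)%R)%E -> (0 <= v d)%E.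
Proof.
move=> vx; rewrite !leNgt; apply: contra => d0.
have dn0 : d != 0 by apply: contraTneq d0 => ->; rewrite val0.
have [s vs] := val_fin v dn0; rewrite vs lte_fin in d0.
by rewrite (diff_lt0 vx vs)// lte_fin pmulrn_llt0 ?prime_gt0.
Qed.

Lemma diff_neg x d (t : rat) : v x = rho%:E -> v (f (x + d) - f x) = t%:E -> t < 0 ->
  v d = (t / p%:R)%:E.
Proof.
move=> vx vt t0.
have d0 : (v d < 0)%E.
  rewrite ltNge; apply/negP => /(diff_ge0 vx); rewrite vt lee_fin leNgt t0//.
have dn0 : d != 0 by apply: contraTneq d0 => ->; rewrite val0.
have [s vs] := val_fin v dn0; rewrite vs lte_fin in d0 *.
move: vt; rewrite (diff_lt0 vx vs)// => -[<-]; congr (_%:E).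
by rewrite -[s *+ p]mulr_natr mulfK// pnatr_eq0 -lt0n prime_gt0.
Qed.

(** The linear term dominates, and its coefficient is a unit. *)
Lemma diff_gt0 x d : v x = rho%:E -> (0 < v d)%E -> v (f (x + d) - f x) = v d.
Proof.
move=> vx d0; have [->|dn0] := eqVneq d 0; first by rewrite addr0 subrr.
have [s vs] := val_fin v dn0; rewrite vs lte_fin in d0.
rewrite unicritical_diff.
have -> : \sum_(i < q) diff_coef x i * d ^+ i.+1 =
    diff_coef x 0 * d + \sum_(i < q.-1) diff_coef x i.+1 * d ^+ i.+2.
  by case: q q_gt0 => // m _; rewrite big_ord_recl expr1.
have small (e : F) i : (0 <= v e)%E -> (1 < i)%N -> (s%:E < v (e * d ^+ i)%R)%E.
  move=> e0 i1; rewrite valM (valX_fin _ vs).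
  apply: (@lt_le_trans _ _ (0 + (s *+ i)%:E)%E); last by apply: leeD.
  by rewrite add0e lte_fin -[ltLHS]mulr1n ltr_pMn2l.
rewrite addrCA val_ltD.
  by rewrite valM diff_coef0// add0e.
rewrite valM diff_coef0// add0e vs; apply: valD_gt.
  by rewrite -[d ^+ p]mul1r small ?val1// prime_gt1.
apply: val_sum_gt => i _; apply: small => //; apply: diff_coef_ge0 => //.
by rewrite -ltn_predRL; exact: ltn_ord.
Qed.

Lemma iter_int k x y : (forall i, (i < k)%N -> v (iter i f x) = rho%:E) ->
  (0 <= v (iter k f y - iter k f x)%R)%E -> (0 <= v (y - x)%R)%E.
Proof.
elim: k x y => [|k IH] x y // vx; rewrite !iterSr => /IH h.
apply: (diff_int (vx 0%N isT)); rewrite addrCA subrr addr0; apply: h => i ik.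
by rewrite -iterSr; exact: vx.
Qed.

Lemma iter_sep k x y : (forall i, (i < k)%N -> v (iter i f x) = rho%:E) ->
  iter k f y = iter k f x -> (0 < v (y - x)%R)%E -> y = x.
Proof.
elim: k x y => [|k IH] x y // vx; rewrite !iterSr => e d0.
have vd : v (f y - f x) = v (y - x).
  by rewrite -(diff_gt0 (vx 0%N isT) d0) addrCA subrr addr0.
have fyx : f y = f x.
  apply: IH => //; last by rewrite vd.
  by move=> i ik; rewrite -iterSr; exact: vx.
apply/eqP; rewrite -subr_eq0; apply/eqP/(val_pinfty v).
by rewrite -vd fyx subrr val0.
Qed.

Lemma preimage_val x y : f x = y -> (v c < v y)%E -> v x = rho%:E.
Proof.
rewrite /unicritical => /eqP; rewrite subr_eq => /eqP xy cy.
have vxp : v (x ^+ p) = (rho *+ p)%:E by rewrite xy addrC val_ltD// vc_rho.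
have x0 : x != 0.
  apply: contra_eq_neq vxp => ->; rewrite expr0n.
  by rewrite eqn0Ngt prime_gt0//= val0.
have [s vs] := val_fin v x0; move: vxp; rewrite vs (valX_fin _ vs) => -[/eqP].
by rewrite -[s *+ p]mulr_natr -[rho *+ p]mulr_natr => /eqP/mulIf -> //; rewrite pnatr_eq0 -lt0n prime_gt0.
Qed.

Lemma vc_lt_rho : (v c < rho%:E)%E.
Proof.
by rewrite vc_rho lte_fin -[ltRHS]mulr1n ltr_nMn2l ?rho_lt0 ?prime_gt1.
Qed.

(** Otherwise [v b <= v c < 0], and [b ^ p = b + c] has valuation at least [v
    b], whereas [p * v b < v b]. *)
Lemma fixed_point_val b : f b = b -> v b = rho%:E.
Proof.
move=> fb; apply: (preimage_val fb); rewrite ltNge; apply/negP => bc.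
have c0 : (v c < 0)%E by apply: lt_trans vc_lt_rho _; rewrite lte_fin rho_lt0.
have b0 : b != 0.
  by apply: contraTneq (le_lt_trans bc c0) => ->; rewrite val0.
have [s vs] := val_fin v b0.
have s0 : s < 0 by rewrite -lte_fin -vs (le_lt_trans bc c0).
have : (v b <= v (b ^+ p)%R)%E.
  have -> : b ^+ p = b + c by rewrite -[in RHS]fb /unicritical subrK.
  by apply: valD_ge.
rewrite (valX_fin _ vs) vs lee_fin -[leLHS]mulr1n ler_nMn2l//.
by rewrite leqNgt prime_gt1.
Qed.

End Dynamics.

(** * Roots of unity *)

Lemma prime_unity_root_primitive (F : fieldType) p (z : F) : prime p ->
  z ^+ p = 1 -> z != 1 -> p.-primitive_root z.
Proof.
move=> p_prime zp z1.
have [m mz mp] := prim_order_exists (prime_gt0 p_prime) zp.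
have [_ /(_ _ mp)/orP[] /eqP me] := primeP p_prime; rewrite me in mz; last by [].
by have := prim_expr_order mz; rewrite expr1 => /eqP; rewrite (negPf z1).
Qed.

Section RootsOfUnity.
Variables (p : nat) (p_prime : prime p) (K F : fieldType) (iota : {rmorphism K -> F}).
Variable (v : valuation F).
Hypothesis v_p : v p%:R = 1%:E.
Variables (c : K) (a : K).
Hypothesis v_c : v (iota c) = (- (p%:R / (p%:R - 1)))%:E.
Local Notation f := (unicritical p (iota c)).
Variable S : divringClosed F.
Hypothesis KS : forall k, iota k \in S.
Local Notation G := (galois_group iota S).

Lemma residue_pchar : p \in [pchar (residue v)].
Proof.
rewrite inE p_prime -(red_nat v) red_eq0 ?val_nat_ge0//.
by rewrite v_p lte_fin.
Qed.

Lemma v_binomial i : (i < p.-1)%N -> (1%:E <= v 'C(p, i.+1)%:R)%E.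
Proof.
move=> iq; have pC : (p %| 'C(p, i.+1))%N.
  by apply: prime_dvd_bin => //; rewrite /= -ltn_predRL.
have [m ->] := dvdnP pC; rewrite natrM valM v_p -[leLHS]add0e.
by apply: leeD => //; exact: val_nat_ge0.
Qed.

(** With [z = 1 + t], the binomial expansion of [z ^ p = 1] divided by [t] says
    that [t ^ (p - 1)] is [-p] plus terms of larger valuation. *)
Lemma unity_root_val z : z ^+ p = 1 -> z != 1 -> v (z - 1) = (- rho p)%:E.
Proof.
move=> zp z1; pose t := z - 1; have zE : z = 1 + t by rewrite addrC subrK.
have t0 : t != 0 by rewrite subr_eq0.
have pp := prime_gt0 p_prime.
have z0 : (0 <= v z)%E.
  by rewrite leNgt -(valX_lt0 _ _ pp) zp val1 ltxx.
have vt0 : (0 <= v t)%E by apply: val_sub_ge; rewrite ?val1.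
have := exprDn_ends p.-1 1 t; rewrite -!(prime_predK p_prime) -zE zp expr1n.
rewrite -[X in X = _]addr0 => /addrI /esym e.
have vt : (0 < v t)%E.
  rewrite -(valX_gt0 _ _ pp).
  move/eqP: e; rewrite addr_eq0 => /eqP ->; rewrite valN.
  apply: val_sum_gt => i _; rewrite expr1n.
  apply: lt_le_trans (_ : (1%:E <= _)%E); first by rewrite lte_fin.
  rewrite valM -[leLHS]adde0; apply: leeD; last exact: valX_ge0.
  exact: v_binomial.
have e' : t ^+ p.-1 = - (p%:R + \sum_(i < p.-2) 'C(p, i.+2)%:R * t ^+ i.+1).
  apply: (mulIf t0); apply/eqP; rewrite mulNr -addr_eq0.
  rewrite -exprSr -(prime_predK p_prime) -[X in _ == X]e; apply/eqP; congr (_ + _).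
  have := q_gt0 p_prime; case: p.-1 => // m _; rewrite big_ord_recl/= bin1 expr1n expr1.
  rewrite mulrDl; congr (_ + _); rewrite mulr_suml; apply: eq_bigr => i _.
  by rewrite expr1n -mulrA -exprSr.
have [s vs] := val_fin v t0; rewrite vs lte_fin in vt.
have : v (t ^+ p.-1) = 1%:E.
  rewrite e' valN val_ltD ?v_p//; apply: val_sum_gt => i _.
  rewrite valM (valX_fin _ vs); apply: (@lt_le_trans _ _ (1%:E + (s *+ i.+1)%:E)%E).
    by rewrite -EFinD lte_fin ltrDl pmulrn_lgt0.
  apply: leeD => //; apply: v_binomial.
  by rewrite -ltn_predRL; exact: ltn_ord.
rewrite (valX_fin _ vs) -/t vs => -[] h; congr (_%:E).
rewrite /rho opprK; apply: (mulIf (lt0r_neq0 (q_gt0R p_prime))).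
by rewrite mulVf ?(lt0r_neq0 (q_gt0R p_prime))// mulr_natr.
Qed.

Hypothesis v_act : forall (s : G) x, x \in S -> v (gact s x) = v x.

(** The element [u = (z - 1) ^ p * c] is a unit. If [gact s z = z ^ j], then
    [gact s u = th ^ p * u] with [th = 1 + z + ... + z ^ (j - 1)], whose
    residue is [j]. As [s] fixes the residue of [u], the residue of [j ^ p],
    which is [j], is 1. *)
Lemma inertia_fixes_mu (s : G) z : s \in inertia_group iota S v ->
  z \in S -> z ^+ p = 1 -> gact s z = z.
Proof.
move=> /inertiaP sI zS zp; have [->|z1] := eqVneq z 1; first by rewrite gact1.
have zprim := prime_unity_root_primitive p_prime zp z1.
have szp : gact s z ^+ p = 1 by rewrite -(gactX KS)// zp gact1.
have [j sz] := prim_rootP zprim szp.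
have pk := residue_pchar.
have vz := unity_root_val zp z1.
have tS : z - 1 \in S by rewrite rpredB ?rpred1.
pose u := (z - 1) ^+ p * iota c.
have uS : u \in S by rewrite rpredM ?rpredX.
have vu : v u = 0%E.
  by rewrite valM (valX_fin _ vz) (vc_rho p_prime v_c) -EFinD mulNrn addNr.
pose th := \sum_(i < j) z ^+ i.
have su : gact s u = th ^+ p * u.
  rewrite gactM ?rpredX// (gactK KS) (gactX KS)// gactB ?rpred1// gact1// sz.
  by rewrite subrX1 exprMn mulrA [th ^+ p * _]mulrC.
have z0 : (0 <= v z)%E.
  by rewrite leNgt -(valX_lt0 _ _ (prime_gt0 p_prime)) zp val1 ltxx.
have rz : red v z = 1.
  rewrite -(red1 v); apply/red_eq; rewrite ?val1// vz lte_fin oppr_gt0.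
  exact: rho_lt0.
have th0 : (0 <= v th)%E by apply: val_sum_ge => i _; exact: valX_ge0.
have rth : red v th = (j : nat)%:R.
  rewrite /th red_sum => [|i]; last exact: valX_ge0.
  rewrite (eq_bigr (fun=> 1)) => [|i _]; last by rewrite redX// rz expr1n.
  by rewrite sumr_const card_ord.
have := sI u uS; rewrite vu => /(_ (lexx _)).
rewrite su -{2}[u]mul1r -mulrBl valM vu adde0 => /red_eq.
rewrite valX_ge0 ?val1// => /(_ isT isT).
rewrite redX// rth red1 -(pFrobenius_autE pk) pFrobenius_aut_nat => j1.
have j0 : (0 < j)%N.
  rewrite lt0n; apply: contra_eq_neq j1 => ->; rewrite eq_sym oner_eq0//.
have : (p %| j.-1)%N.
  rewrite (dvdn_pcharf pk); apply/eqP/(addIr 1).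
  by rewrite natr1 prednK// add0r.
rewrite sz; case: (nat_of_ord j) j0 (ltn_ord j) => // -[|m] _ mp; first by rewrite expr1.
by rewrite /= gtnNdvd// ltnW.
Qed.

(** Inductively [t = s ^ (p ^ k)] fixes [f z], so it multiplies [z] by a p-th
    root of unity, which [t] fixes; hence [t ^ p] fixes [z]. *)
Lemma mu_fixed_torsion (s : G) n :
  (forall z, z \in S -> z ^+ p = 1 -> gact s z = z) ->
  (forall k z, (k <= n)%N -> iter k f z = iota a -> z \in S) ->
  forall k z, (k <= n)%N -> iter k f z = iota a -> gact (s ^+ (p ^ k))%g z = z.
Proof.
move=> smu preS; elim=> [|k IH] z kn.
  by rewrite /= => ->; rewrite (gactK KS).
move=> zk; have zS := preS _ _ kn zk.
have fzk : iter k f (f z) = iota a by rewrite -iterSr.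
have := IH _ (ltnW kn) fzk; set t := (s ^+ _)%g => tfz.
have tzp : gact t z ^+ p = z ^+ p.
  move: tfz; rewrite /unicritical gactB ?rpredX// (gactX KS)// (gactK KS).
  by move=> /addIr.
have [->|z0] := eqVneq z 0; first by rewrite gact0.
pose w := gact t z / z.
have tz : gact t z = w * z by rewrite divfK.
have wS : w \in S by rewrite rpred_div ?gact_in.
have wp : w ^+ p = 1 by rewrite expr_div_n tzp divff// expf_neq0.
have tw : gact t w = w.
  rewrite /t gact_expg; elim: (p ^ k)%N => //= m ->; exact: smu.
have tm m : gact (t ^+ m)%g z = w ^+ m * z.
  elim: m => [|m IHm]; first by rewrite expg0 gact_one mul1r.
  rewrite expgS gact_mul IHm gactM ?rpredX// (gactX KS)// tw tz.
  by rewrite mulrA -exprSr.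
by rewrite expnSr expgnA tm wp mul1r.
Qed.

End RootsOfUnity.

(** * The Krull topology *)

Section KrullTopology.
Variables (K : fieldType) (F : closedFieldType) (iota : {rmorphism K -> F}).
Hypothesis F_alg : forall x : F, algebraicOver iota x.
Variable S : divringClosed F.
Hypothesis KS : forall k, iota k \in S.
Local Notation G := (galois_group iota S).

Lemma gal_open_agree (s : G) (xs : seq F) : open [set t : G | {in xs, gact s =1 gact t}].
Proof.
suff : gal_open [set t : G | {in xs, gact s =1 gact t}] by [].
move=> t /= st; exists (pmap insub xs) => u tu x xxs.
rewrite st//; have [xS|xS] := boolP (x \in S); last by rewrite !gact_out.
have [y yx] := subfield_ofP xS; rewrite -yx !gactE tu//.
by rewrite mem_pmap_sub /= yx.
Qed.

Lemma gal_nbhsP (s : G) (U : set G) :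
  nbhs s U <-> exists xs : seq F, [set t : G | {in xs, gact s =1 gact t}] `<=` U.
Proof.
split=> [|[xs xsU]].
  rewrite nbhsE => -[B [oB Bs] BU].
  have [xs xsB] : exists xs : seq (subfield_of S),
    forall t : G, {in xs, s =1 t} -> B t by exact: oB.
  exists (map val xs) => t st; apply/BU/xsB => x xxs; apply: val_inj.
  by rewrite -!gactE; apply: st; exact: map_f.
by apply: filterS xsU _; apply: open_nbhs_nbhs; split; [exact: gal_open_agree|].
Qed.

Lemma gal_openP (U : set G) : open U <-> forall s, U s ->
  exists xs : seq F, [set t : G | {in xs, gact s =1 gact t}] `<=` U.
Proof.
split=> [oU s Us|h].
  by apply/gal_nbhsP; apply: open_nbhs_nbhs.
by rewrite openE => s /h/gal_nbhsP.
Qed.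

(** Every ultrafilter converges, by [ultra_limit]: conjugates of an element
    form a finite set. *)
Lemma gal_compact : compact [set: G].
Proof.
rewrite compact_ultra => U UU _.
have [|||||y yS|s sU] := @ultra_limit _ _ iota S KS _ U UU (fun t => gact t).
- move=> x xS; have [rs [_ rsP]] := gal_conj F_alg KS xS.
  by exists rs; apply: filterS (@filterT _ U _) => t _ /=.
- by move=> x xS; apply: filterS (@filterT _ U _) => t _ /=; rewrite gact_in.
- by move=> x y xS yS; apply: filterS (@filterT _ U _) => t _ /=; rewrite gactD.
- by move=> x y xS yS; apply: filterS (@filterT _ U _) => t _ /=; rewrite gactM.
- by move=> k; apply: filterS (@filterT _ U _) => t _ /=; rewrite (gactK KS).
- have [rs [rsS rsP]] := gal_conj F_alg KS yS.
  exists rs; split=> //; apply: filterS (@filterT _ U _) => t _ /=.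
  by exists (gact t^-1%g y); rewrite ?gactKV.
exists s; split=> // A /gal_nbhsP[xs xsA]; apply: filterS xsA _.
have xsU : U [set t | {in [seq x <- xs | x \in S], gact s =1 gact t}].
  elim: xs => [|x xs IH]; first by apply: filterS (@filterT _ U _) => t _ x.
  rewrite /=; case: ifP => // xS.
  apply: filterS (filterI (sU x xS) IH) => t [/= sx sxs] y.
  by rewrite in_cons => /orP[/eqP ->|/sxs].
apply: filterS xsU => t /= st x xxs.
have [xS|xS] := boolP (x \in S); last by rewrite !gact_out.
by apply: st; rewrite mem_filter xS.
Qed.

Lemma gal_separated (s t : G) : s != t -> exists x, gact s x != gact t x.
Proof.
move=> st; apply: contrapT => nx; move/eqP: st; apply; apply: gact_ext => x xS.
by apply/eqP; apply: contraT => ne; case: nx; exists x.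
Qed.

Lemma inertia_closed (v : valuation F) :
  closed [set s : G | s \in inertia_group iota S v].
Proof.
rewrite -openC; apply/gal_openP => s /= sI.
have [x [xS x0 sx]] : exists x, [/\ x \in S, (0 <= v x)%E & ~ (0 < v (gact s x - x)%R)%E].
  apply: contrapT => nx; apply: sI; apply/inertiaP => x xS x0.
  by apply: contrapT => sx; apply: nx; exists x.
exists [:: x] => t /= st /inertiaP/(_ x xS x0).
by rewrite -st ?mem_head.
Qed.

Section Subgroup.
Variable H : groupClosed G.
Local Notation sH := (subgroup_of H).

Lemma sub_nbhsP (s : sH) (U : set sH) :
  nbhs s U <-> exists xs : seq F,
    [set t : sH | {in xs, gact (val s) =1 gact (val t)}] `<=` U.
Proof.
split=> [|[xs xsU]].
  rewrite nbhsE => -[B [[C oC CB] Bs] BU].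
  have Cs : C (val s) by rewrite -CB in Bs.
  have [xs xsC] := (gal_openP C).1 oC _ Cs.
  by exists xs => t st; apply: BU; rewrite -CB; apply: xsC.
apply: filterS xsU _; apply: open_nbhs_nbhs; split=> //.
by exists [set t : G | {in xs, gact (val s) =1 gact t}] => //; exact: gal_open_agree.
Qed.

Lemma sub_openP (U : set sH) : open U <-> forall s, U s ->
  exists xs : seq F, [set t : sH | {in xs, gact (val s) =1 gact (val t)}] `<=` U.
Proof.
split=> [oU s Us|h].
  by apply/sub_nbhsP; apply: open_nbhs_nbhs.
by rewrite openE => s /h/sub_nbhsP.
Qed.

Lemma sub_topological : is_topological_group sH.
Proof.
split=> [[s t]|s] U /= /sub_nbhsP[xs xsU].
  exists ([set s' : sH | {in map (gact (val t)) xs, gact (val s) =1 gact (val s')}],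
          [set t' : sH | {in xs, gact (val t) =1 gact (val t')}]).
    by split; apply/sub_nbhsP; [exists (map (gact (val t)) xs)|exists xs].
  move=> [s' t'] /= [ss tt]; apply: xsU => x xxs /=.
  rewrite !gact_mul -tt// ss//; exact: map_f.
apply/sub_nbhsP; exists (map (gact (val s^-1%g)) xs) => t st; apply: xsU => x xxs /=.
rewrite -[gact _ x](gactVK (val t)) -st; last exact: map_f.
by rewrite /= gactKV.
Qed.

(** The condition of sending [x] to a given value is clopen, and these
    conditions separate automorphisms. *)
Lemma sub_zero_dimensional : zero_dimensional sH.
Proof.
move=> s t st.
have [|x sx] := @gal_separated (val s) (val t).
  by apply: contra_neq st => /val_inj.
exists [set u : sH | gact (val s) x = gact (val u) x]; split=> //=; last first.
  by move/eqP: sx.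
split; first apply/sub_openP => u /= su.
  by exists [:: x] => w /= uw; rewrite su uw ?mem_head.
rewrite -openC; apply/sub_openP => u /= su.
by exists [:: x] => w /= uw sw; apply: su; rewrite sw uw ?mem_head.
Qed.

Lemma sub_hausdorff : hausdorff_space sH.
Proof.
move=> s t cl; apply: contrapT => /eqP st.
have [U [[oU cU] Us Ut]] := sub_zero_dimensional st.
have [||u [Uu nUu]] := cl U (~` U).
- exact: open_nbhs_nbhs.
- by apply: open_nbhs_nbhs; split=> //; rewrite openC.
- by [].
Qed.

Lemma sub_compact : closed [set s : G | s \in H] -> compact [set: sH].
Proof.
move=> cH; have HC : compact [set s : G | s \in H].
  by apply: subclosed_compact cH gal_compact _.
rewrite compact_ultra => U UU _.
pose V : set_system G := [set A | U (val @^-1` A)].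
have VP : ProperFilter V.
  split; first by rewrite /V /= preimage_set0; exact: filter_not_empty.
  split=> [|A B|A B AB]; rewrite /V /=.
  - by rewrite preimage_setT; exact: filterT.
  - by rewrite preimage_setI; exact: filterI.
  - by apply: filterS => x /AB.
have [|s [sH' sV]] := HC V VP.
  rewrite /V /=; apply: filterS (@filterT _ U _) => t _; exact: (valP (t : sH)).
exists (Sub s sH'); split=> // A /sub_nbhsP[xs xsA].
have [//|UA] := in_ultra_setVsetC A UU.
have VA : V (val @` (~` A)).
  by rewrite /V /=; apply: filterS UA => t tA; exists t.
have [|t [tA /= st]] := sV (val @` (~` A)) [set t : G | {in xs, gact s =1 gact t}] VA.
  by apply/gal_nbhsP; exists xs.
by case: tA => u uA ut; case: uA; apply: xsA => x xxs; rewrite ut; exact: st.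
Qed.

Lemma sub_profinite : closed [set s : G | s \in H] -> is_profinite sH.
Proof.
move=> cH; split; [exact: sub_topological|exact: sub_compact|exact: sub_hausdorff|].
by apply: zero_dimension_totally_disconnected; exact: sub_zero_dimensional.
Qed.

End Subgroup.
End KrullTopology.

Lemma compact_bij_continuous (X Y : topologicalType) (f : X -> Y) (g : Y -> X) :
  compact [set: X] -> hausdorff_space Y -> continuous f -> cancel f g -> cancel g f ->
  continuous g.
Proof.
move=> cX hY cf fg gf; apply/continuous_closedP => C cC.
have -> : g @^-1` C = f @` C.
  apply/seteqP; split=> [y Cy|_ [x Cx <-]]; first by exists (g y).
  by rewrite /preimage /= fg.
apply: compact_closed => //; apply: continuous_compact.
  exact: continuous_subspaceT.
by apply: subclosed_compact cC cX _.
Qed.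

(** * The tower of preimage fields *)

Section Tower.
Variables (p : nat) (p_prime : prime p).
Variables (K : fieldType) (F : closedFieldType) (iota : {rmorphism K -> F}).
Hypothesis K0 : [pchar K] =i pred0.
Hypothesis F_alg : forall x : F, algebraicOver iota x.
Variables (c a : K).
Hypothesis a_dist : forall m : nat, distinct_preimages iota p c a m.
Local Notation f := (unicritical p (iota c)).
Local Notation tower := (tower iota p c a).
Local Notation tower_infty := (tower_infty iota p c a).
Local Notation preimages := (preimages iota p c a).
Local Notation "P ^i" := (map_poly iota P) (at level 2, format "P ^i").

Definition iter_poly n : {poly K} := iter n (unicritical p c%:P) 'X - a%:P.

Lemma map_iter_poly n :
  (iter_poly n)^i = iter n (unicritical p (iota c)%:P) 'X - (iota a)%:P.
Proof.
rewrite rmorphB /= map_polyC; congr (_ - _).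
elim: n => [|n IH] /=; first by rewrite map_polyX.
by rewrite {1}/unicritical rmorphB rmorphXn /= IH map_polyC.
Qed.

Lemma preimagesP n z : preimages n z <-> root (iter_poly n)^i z.
Proof.
rewrite rootE map_iter_poly hornerD hornerN hornerC subr_eq0.
have -> : (iter n (unicritical p (iota c)%:P) 'X).[z] = iter n f z.
  elim: n => [|n IH] /=; first by rewrite hornerX.
  by rewrite /unicritical hornerD hornerN hornerC horner_exp IH.
by split=> [->|/eqP].
Qed.

Lemma size_iter_poly n : size (iter n (unicritical p (iota c)%:P) 'X) = (p ^ n).+1.
Proof.
elim: n => [|n IH]; first by rewrite /= size_polyX.
rewrite /= /unicritical; set P := iter _ _ _ in IH *.
have sPp : size (P ^+ p) = (p ^ n.+1).+1.
  have P0 : P != 0 by rewrite -size_poly_gt0 IH.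
  rewrite -(@prednK (size (P ^+ p))) ?size_poly_gt0 ?expf_neq0//.
  by rewrite size_exp IH /= expnSr.
rewrite size_polyDl ?sPp// size_polyN (leq_ltn_trans (size_polyC_leq1 _))//.
by rewrite ltnS expn_gt0 prime_gt0.
Qed.

Lemma preimages_enum n : exists rs : seq F,
  [/\ uniq rs, [set` rs] = preimages n & size rs = (p ^ n)%N].
Proof.
have [rs urs rsE] := a_dist n; exists rs; split=> //.
  apply/seteqP; split=> z /=.
    by move=> zrs; apply/preimagesP; rewrite map_iter_poly rsE root_prod_XsubC.
  by move=> /preimagesP; rewrite map_iter_poly rsE root_prod_XsubC.
have := congr1 (fun P : {poly F} => size P) rsE; rewrite size_prod_XsubC.
rewrite size_polyDl ?size_iter_poly => [[]//|].
rewrite size_polyN (leq_ltn_trans (size_polyC_leq1 _))//.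
by rewrite ltnS expn_gt0 prime_gt0.
Qed.

Lemma f_surj y : exists x, f x = y.
Proof.
have : size ('X^p - (y + iota c)%:P : {poly F}) != 1%N.
  by rewrite size_XnsubC ?prime_gt0// eqSS -lt0n prime_gt0.
case/closed_rootP => w; rewrite rootE !hornerE subr_eq0 => /eqP wE.
by exists w; rewrite /unicritical wE addrK.
Qed.

Lemma iter_surj k y : exists x, iter k f x = y.
Proof.
elim: k y => [|k IH] y; first by exists y.
have [x fx] := f_surj y; have [z zx] := IH x.
by exists z; rewrite /= zx.
Qed.

Lemma f_in (S : divringClosed F) x : iota c \in S -> x \in S -> f x \in S.
Proof. by move=> cS xS; rewrite rpredB ?rpredX. Qed.

Lemma iter_in (S : divringClosed F) k x : iota c \in S -> x \in S -> iter k f x \in S.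
Proof. by move=> cS xS; elim: k => //= k IH; exact: f_in. Qed.

Lemma base_tower n k : iota k \in tower n.
Proof. exact: base_adjoin. Qed.

(** A preimage of level [k] is the image under an iterate of [f] of a preimage
    of level [n]. *)
Lemma preim_tower n k z : (k <= n)%N -> iter k f z = iota a -> z \in tower n.
Proof.
move=> kn zk; have [w wz] := iter_surj (n - k) z.
rewrite -wz; apply: iter_in; first exact: base_tower.
by apply: sub_adjoin; rewrite /Defs.preimages /= -(subnKC kn) iterD wz.
Qed.

Lemma tower_le m n : (m <= n)%N -> {subset tower m <= tower n}.
Proof.
move=> mn; apply: adjoin_min => [k|z /= zm]; first exact: base_tower.
exact: preim_tower mn zm.
Qed.

Lemma tower_inftyP x : x \in tower_infty <-> exists n, x \in tower n.
Proof.
split=> [/asboolP[n _ xn]|[n xn]]; first by exists n.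
apply/asboolP; exists n.+1 => //.
exact: tower_le (leqnSn n) _ xn.
Qed.

Lemma tower_sub_infty n : {subset tower n <= tower_infty}.
Proof. by move=> x xn; apply/tower_inftyP; exists n. Qed.

Lemma base_infty k : iota k \in tower_infty.
Proof. by apply: (@tower_sub_infty 0); exact: base_tower. Qed.

Lemma tower_infty_seq (xs : seq F) : {subset xs <= tower_infty} ->
  exists n, {subset xs <= tower n}.
Proof.
elim: xs => [|x xs IH] xsT; first by exists 0%N.
have /tower_inftyP[m xm] := xsT x (mem_head _ _).
have [|n xsn] := IH; first by move=> y ys; apply: xsT; rewrite in_cons ys orbT.
exists (maxn m n) => y; rewrite in_cons => /orP[/eqP ->|/xsn yn].
  exact: tower_le (leq_maxl m n) _ xm.
exact: tower_le (leq_maxr m n) _ yn.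
Qed.

Section Over.
Variable S : divringClosed F.
Hypothesis KS : forall k, iota k \in S.
Local Notation G := (galois_group iota S).

Lemma gact_f (s : G) z : z \in S -> gact s (f z) = f (gact s z).
Proof. by move=> zS; rewrite /unicritical gactB ?rpredX// (gactX KS)// (gactK KS). Qed.

Lemma gact_iter (s : G) k z : z \in S -> gact s (iter k f z) = iter k f (gact s z).
Proof.
by move=> zS; elim: k => //= k IH; rewrite gact_f ?IH//; exact: iter_in.
Qed.

Lemma gact_preim (s : G) n z : z \in S -> preimages n z -> preimages n (gact s z).
Proof.
by rewrite /Defs.preimages /= => zS zn; rewrite -gact_iter// zn (gactK KS).
Qed.

Lemma tower_stable n (s : G) x : {subset tower n <= S} -> x \in tower n ->
  gact s x \in tower n.
Proof.
move=> nS.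
pose E : {pred F} := [pred x | (x \in S) && (gact s x \in tower n)].
have EC : divring_closed E.
  split=> [|y z /andP[yS yn] /andP[zS zn]|y z /andP[yS yn] /andP[zS zn]].
  - by rewrite inE rpred1 (gact1 KS) rpred1.
  - by rewrite inE rpredB// gactB// rpredB.
  - by rewrite inE rpred_div// gactM ?rpredV// (gactV KS)// rpred_div.
pose EP := GRing.isDivringClosed.Build F E EC.
pose ED : divringClosed F := HB.pack E EP.
move=> /(@adjoin_min _ _ iota (preimages n) ED) xE.
have /andP[_ //] : x \in ED; apply: xE => [k|z zn].
  by rewrite inE KS (gactK KS) base_tower.
have zS : z \in S by apply: nS; exact: sub_adjoin.
by rewrite inE zS /=; apply: sub_adjoin; exact: gact_preim.
Qed.

End Over.

Lemma tower_agree n (S1 S2 : divringClosed F)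
    (s : galois_group iota S1) (t : galois_group iota S2) :
  {subset tower n <= S1} -> {subset tower n <= S2} ->
  (forall z, preimages n z -> gact s z = gact t z) ->
  {in tower n, forall x, gact s x = gact t x}.
Proof.
move=> nS1 nS2 st; apply: agree_adjoin => [k|k|z zn].
- by apply: nS1; exact: base_tower.
- by apply: nS2; exact: base_tower.
- by split; [apply: nS1; exact: sub_adjoin|apply: nS2; exact: sub_adjoin|exact: st].
Qed.

Lemma tower_primitive n : exists2 t, t \in tower n & {subset tower n <= polyvals iota t}.
Proof.
have [rs [_ rsn _]] := preimages_enum n.
by have := primitive_element K0 F_alg rs; rewrite rsn.
Qed.

Lemma tower_fixed n x : x \in tower n ->
  (forall s : galois_group iota (tower n), gact s x = x) -> exists k, x = iota k.
Proof.
have [rs [_ rsn _]] := preimages_enum n.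
by apply: (fixed_field K0 F_alg _ (preimagesP n) rsn).
Qed.

Lemma tower_cluster (tau : forall n, galois_group iota (tower n)) :
  exists s : galois_group iota tower_infty, forall (xs : seq F) N,
    {subset xs <= tower_infty} ->
    exists2 m, (N <= m)%N & {in xs, gact s =1 gact (tau m)}.
Proof.
apply: (gal_cluster F_alg (S := fun n => tower n : divringClosed F) (Soo := tower_infty : divringClosed F)).
- by move=> n k; exact: base_tower.
- exact: tower_le.
- exact: tower_inftyP.
Qed.

Lemma infty_cluster (tau : nat -> galois_group iota tower_infty) :
  exists s : galois_group iota tower_infty, forall n N,
    exists2 m, (N <= m)%N & {in tower n, gact s =1 gact (tau m)}.
Proof.
have [|||s sP] := @gal_cluster _ _ iota F_alg (fun=> tower_infty) tower_infty tau.
- by move=> n k; exact: base_infty.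
- by move=> m n _ x.
- by move=> x; split=> [xT|[]//]; exists 0%N.
exists s => n N; have [rs [_ rsn _]] := preimages_enum n.
have [|m Nm ms] := sP rs N.
  move=> z zrs; apply: (@tower_sub_infty n); apply: sub_adjoin.
  by rewrite -rsn.
exists m => //; apply: tower_agree; try exact: tower_sub_infty.
by move=> z; rewrite -rsn => /ms.
Qed.

(** If at each level some automorphism moved [x], a cluster point of such
    automorphisms would move [x]. So [x] is fixed by the whole group of some
    level, where [tower_fixed] applies. *)
Lemma infty_fixed n x : x \in tower n ->
  (forall s : galois_group iota tower_infty, gact s x = x) -> exists k, x = iota k.
Proof.
move=> xn xfix; apply: contrapT => nk.
have tex m : exists s : galois_group iota (tower m), (n <= m)%N -> gact s x <> x.
  have [nm|_] := leqP n m; last by exists 1%g.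
  apply: contrapT => ns; apply: nk; apply: (@tower_fixed m).
    exact: tower_le nm _ xn.
  by move=> s; apply: contrapT => sx; apply: ns; exists s.
have [s sP] := tower_cluster (fun m => sval (cid (tex m))).
have [|m nm ms] := sP [:: x] n.
  by move=> y; rewrite mem_seq1 => /eqP ->; exact: tower_sub_infty xn.
have := ms x (mem_head _ _); rewrite xfix; case: cid => t tx /= e.
by apply: (tx nm); rewrite -e.
Qed.

Lemma infty_extend n (s : galois_group iota (tower n)) :
  exists s' : galois_group iota tower_infty, {in tower n, gact s' =1 gact s}.
Proof.
have [t tn tP] := tower_primitive n.
apply: (@gal_extend _ _ iota F_alg (tower n : divringClosed F) (tower_infty : divringClosed F) t s).
- by move=> k; exact: base_tower.
- exact: tower_sub_infty.
- move=> s' x xn; apply: tower_stable xn; first exact: base_infty.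
  exact: tower_sub_infty.
- by move=> x xn; exact: infty_fixed xn.
- exact: tn.
- exact: tP.
Qed.

End Tower.

(** * Finite levels, and the case of an integral difference *)

Lemma subgroup_valX (G : groupType) (H : groupClosed G) (s : subgroup_of H) n :
  val (s ^+ n)%g = (val s ^+ n)%g.
Proof. by elim: n => [|n IH]; rewrite ?expg0// !expgS -IH. Qed.

Section QuotientGroup.
Variables (G : groupType) (H : groupClosed G) (nH : is_normal H).
Local Notation Q := (quotient_group nH).
Local Notation pr := (\pi_Q)%qT.

Lemma quot_piM (x y : G) : pr (x * y)%g = (pr x * pr y)%g.
Proof. by rewrite -[RHS]/(quot_mul (pr x) (pr y)) quot_mulE. Qed.

Lemma quot_piX (x : G) n : pr (x ^+ n)%g = (pr x ^+ n)%g.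
Proof.
by elim: n => [|n IH]; rewrite ?expg0// !expgS quot_piM IH.
Qed.

Lemma quot_surj (q : Q) : exists x, pr x = q.
Proof. by exists (repr q); rewrite reprK. Qed.

Lemma quot_pi1 (x : G) : pr x = 1%g <-> x \in H.
Proof.
have -> : (1%g : Q) = pr 1%g by [].
rewrite quot_eqP /coset_rel mulg1; split=> h; last by rewrite gpredV.
by rewrite -gpredV.
Qed.

Lemma quot_finite : finite_set [set: G] -> finite_set [set: Q].
Proof.
move=> fG; apply: sub_finite_set (finite_image pr fG) => q _.
by have [x <-] := quot_surj q; exists x.
Qed.

End QuotientGroup.

Section FiniteLevel.
Variables (p : nat) (p_prime : prime p).
Variables (Qp : fieldType) (vp : valuation Qp) (QpP : is_Qp p vp).
Variables (K : fieldExtType Qp) (F : closedFieldType) (iota : {rmorphism K -> F}).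
Hypothesis F_alg : forall x : F, algebraicOver iota x.
Variables (v : valuation F).
Hypothesis v_ext : forall x : Qp, v (iota x%:A) = vp x.
Variables (c a : K).
Hypothesis v_c : v (iota c) = (- (p%:R / (p%:R - 1)))%:E.
Hypothesis a_dist : forall m : nat, distinct_preimages iota p c a m.
Local Notation f := (unicritical p (iota c)).
Local Notation tower := (tower iota p c a).
Local Notation tower_infty := (tower_infty iota p c a).
Local Notation preimages := (preimages iota p c a).

Let K0 : [pchar K] =i pred0 := K_pchar QpP K.
Let vp1 := v_p p_prime QpP v_ext.
Let pk := residue_pchar p_prime vp1.

Lemma level_residues n : exists rs : seq (residue v),
  forall x, x \in tower n -> (0 <= v x)%E -> red v x \in rs.
Proof.
have [t tn tP] := tower_primitive p_prime K0 F_alg a_dist n.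
apply: (residues_finite p_prime QpP F_alg v_ext (t := t)) => //.
by move=> x k xn; apply: rpredX.
Qed.

Lemma act_val (S : divringClosed F) (s : galois_group iota S) x :
  (forall k, iota k \in S) -> x \in S -> v (gact s x) = v x.
Proof. by move=> KS; exact: (gact_val p_prime QpP F_alg v_ext KS). Qed.

(** An automorphism is determined on the n-th field by its action on the finite
    set of preimages of level [n]. *)
Lemma tower_ffun n (S : divringClosed F) : (forall k, iota k \in S) ->
  {subset tower n <= S} ->
  exists (T : finType) (g : galois_group iota S -> T), forall s t, g s = g t ->
    {in tower n, gact s =1 gact t}.
Proof.
move=> KS nS.
have [rs [_ rsn _]] := preimages_enum p_prime a_dist n.
have rsP z : z \in rs <-> preimages n z by rewrite -rsn.
pose g (s : galois_group iota S) : {ffun seq_sub rs -> seq_sub rs} :=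
  [ffun x => insubd x (gact s (ssval x))].
exists {ffun seq_sub rs -> seq_sub rs}, g => s t st.
apply: tower_agree => // z zn.
have zrs : z \in rs by apply/rsP.
have ga (u : galois_group iota S) : gact u z \in rs.
  apply/rsP; apply: gact_preim => //.
  by apply: nS; exact: sub_adjoin.
have := congr1 (fun h : {ffun seq_sub rs -> seq_sub rs} => ssval (h (SeqSub zrs))) st.
by rewrite /g !ffunE /= -![ssval _]/(val _) !val_insubd !ga.
Qed.

Lemma level_finite n : finite_set [set: galois_group iota (tower n)].
Proof.
have KS k : iota k \in tower n by exact: base_tower.
have sub : {subset tower n <= tower n} by [].
have [T [g gP]] := tower_ffun KS sub.
apply: (inj_finite_group (f := g) (s := enum T)) => [s t /gP st|s].
  exact: gact_ext.
by rewrite mem_enum.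
Qed.

Lemma torsion_tower (S : divringClosed F) (s : galois_group iota S) n :
  (forall k, iota k \in S) -> {subset tower n <= S} ->
  (forall z, z \in S -> z ^+ p = 1 -> gact s z = z) ->
  {in tower n, gact (s ^+ (p ^ n))%g =1 id}.
Proof.
move=> KS nS smu x xn; have sub : {subset tower n <= tower n} by [].
rewrite -[RHS]/x -[RHS](@gact_one _ _ iota S x).
apply: (tower_agree nS nS) xn => z zn; rewrite gact_one.
apply: (mu_fixed_torsion KS smu (n := n) (a := a) (c := c)) => // k y kn yk.
by apply: nS; apply: preim_tower kn yk.
Qed.

Lemma inertia_mu (S : divringClosed F) (s : galois_group iota S) z :
  (forall k, iota k \in S) -> s \in inertia_group iota S v ->
  z \in S -> z ^+ p = 1 -> gact s z = z.
Proof.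
move=> KS sI zS zp; exact: (inertia_fixes_mu p_prime vp1 v_c KS sI zS zp).
Qed.

Lemma level_inertia_pgroup n :
  finite_pgroup p (subgroup_of (inertia_group iota (tower n) v :
     groupClosed (galois_group iota (tower n)))).
Proof.
apply: (finite_torsion_pgroup (N := n) p_prime).
  have [s us sT] := finite_enum (level_finite n).
  exact: (inj_finite_group (f := val) (s := s) val_inj).
move=> s; apply: val_inj; rewrite -[RHS]/(1%g).
rewrite subgroup_valX.
apply: gact_ext => x xn; rewrite gact_one (torsion_tower (n := n))//.
- exact: base_tower.
- move=> z; apply: inertia_mu; [exact: base_tower|exact: (valP s)].
Qed.

Lemma inertia_is_normal (S : divringClosed F) : (forall k, iota k \in S) ->
  is_normal (inertia_group iota S v : groupClosed (galois_group iota S)).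
Proof. by move=> KS; exact: (inertia_normal p_prime QpP F_alg v_ext KS). Qed.

Lemma level_quotient n (nI : is_normal (inertia_group iota (tower n) v :
     groupClosed (galois_group iota (tower n)))) : contains_mu iota p ->
  is_cyclic (quotient_group nI) /\ finite_pgroup p (quotient_group nI).
Proof.
move=> mu; split.
  have [rs rsP] := level_residues n.
  have KS : forall k, iota k \in tower n by exact: base_tower.
  have [g gP] := gal_inertia_cyclic pk KS (fun s x => @act_val _ s x KS) rsP.
  exists (\pi_(quotient_group nI) g)%qT => q; have [s <-] := quot_surj q.
  have [u uI] := gP s; exists u; left; rewrite -quot_piX; apply/quot_eqP.
  rewrite /coset_rel -gpredV invgM invgK.
  exact: uI.
apply: (finite_torsion_pgroup (N := n) p_prime).
  by apply: quot_finite; exact: level_finite.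
move=> q; have [s <-] := quot_surj q; rewrite -quot_piX.
suff -> : (s ^+ (p ^ n) = 1)%g by [].
apply: gact_ext => x xn; rewrite gact_one (torsion_tower (n := n))//.
- exact: base_tower.
- by move=> z _ /mu[k <-]; rewrite gactK//; exact: base_tower.
Qed.

Section GoodReduction.
Variable b : F.
Hypothesis b_fix : f b = b.
Hypothesis ab : (0 <= v (iota a - b)%R)%E.

Lemma val_near x y : v x = (rho p)%:E -> (0 <= v (y - x)%R)%E -> v y = (rho p)%:E.
Proof.
move=> vx yx; rewrite -(subrK x y) addrC val_ltD vx//.
by apply: lt_le_trans yx; rewrite lte_fin rho_lt0.
Qed.

(** Since [b] is fixed, [f a - a] is integral, so that preimages of points at
    an integral distance from [a] are again at an integral distance from [a].
    *)
Lemma preimages_near_base n z : preimages n z ->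
  v z = (rho p)%:E /\ (0 <= v (z - iota a)%R)%E.
Proof.
have vb := fixed_point_val p_prime v_c b_fix.
have va := val_near vb ab.
suff h k y : preimages k y -> (0 <= v (y - iota a)%R)%E.
  by move=> /h z0; split=> //; exact: val_near z0.
elim: k y => [|k IH] y; first by rewrite /Defs.preimages /= => ->; rewrite subrr val0.
rewrite /Defs.preimages /= -[f (iter _ _ _)]iterS iterSr => /IH fya.
apply: (diff_int p_prime vp1 (c := iota c) va); rewrite addrCA subrr addr0.
have -> : f y - f (iota a) = (f y - iota a) - ((f (iota a) - f b) - (iota a - b)).
  by rewrite b_fix; ring.
apply: val_sub_ge => //; apply: val_sub_ge => //.
have := diff_ge0 p_prime vp1 (iota c) vb ab; rewrite addrCA subrr addr0; exact.
Qed.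

(** The difference [z - a] is integral, so [s] moves the preimage [z] by a
    positive distance. As [z] and its conjugate have the same image [a], they
    are equal by [iter_sep]. *)
Lemma inertia_trivial s :
  s \in inertia_group iota tower_infty v -> s = 1%g.
Proof.
move=> /inertiaP sI; apply: gact_ext => x /(tower_inftyP p_prime)[n xn].
have sub n' := @tower_sub_infty p p_prime K F iota c a n'.
apply: (tower_agree (sub n) (sub n)) xn => z zn; rewrite gact_one.
have zT : z \in tower_infty by apply/(sub n)/sub_adjoin.
have KT k : iota k \in tower_infty by apply: (base_infty p_prime).
apply: (iter_sep p_prime vp1 (c := iota c) (k := n)) => [i im| |].
- have ziN : preimages (n - i) (iter i f z).
    by rewrite /Defs.preimages /= -iterD subnK ?(ltnW im).
  by have [] := preimages_near_base ziN.
- have zn' : iter n f z = iota a := zn.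
  by rewrite -(gact_iter p c KT)// zn' (gactK KT).
- have [_ z0] := preimages_near_base zn.
  have := sI (z - iota a); rewrite rpredB// => /(_ isT z0).
  by rewrite gactB// (gactK KT) opprB addrA subrK.
Qed.

End GoodReduction.

Section TotallyBad.
Hypothesis ca : (v (iota c)%R < v (iota a)%R)%E.

Lemma preimages_rho n z : preimages n.+1 z -> v z = (rho p)%:E.
Proof.
elim: n z => [|n IH] z; rewrite /Defs.preimages /=.
  by move=> fz; exact: (preimage_val p_prime v_c fz).
rewrite -[f (iter _ _ _)]iterS iterSr => /IH fz.
apply: (preimage_val p_prime v_c (y := f z)) => //.
by rewrite fz; exact: (vc_lt_rho p_prime v_c).
Qed.

Lemma preimages_iter_rho n z : preimages n z ->
  forall i, (i < n)%N -> v (iter i f z) = (rho p)%:E.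
Proof.
move=> zn i im; apply: (@preimages_rho (n - i).-1).
rewrite /Defs.preimages /= -[f (iter _ _ _)]iterS prednK ?subn_gt0//.
by rewrite -iterD subnK ?(ltnW im).
Qed.

Lemma preimages_diff n x y : preimages n x -> preimages n y -> (0 <= v (y - x)%R)%E.
Proof.
move=> xn yn; apply: (iter_int p_prime vp1 (preimages_iter_rho xn)).
by rewrite [iter n f y]yn [iter n f x]xn subrr val0.
Qed.

Lemma preimages_sep n x y : preimages n x -> preimages n y -> (0 < v (y - x)%R)%E -> y = x.
Proof.
move=> xn yn; apply: (iter_sep p_prime vp1 (preimages_iter_rho xn)).
by rewrite [iter n f y]yn [iter n f x]xn.
Qed.

Variable S : divringClosed F.
Hypothesis KS : forall k, iota k \in S.
Local Notation G := (galois_group iota S).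
Local Notation I := (inertia_group iota S v).

(** Modulo the maximal ideal, both sides are [z + (gact s z - z) + (gact t z -
    z)], because inertia acts trivially on the residues of the integral
    differences of preimages; congruent preimages are equal. *)
Lemma inertia_comm (s t : G) n z : z \in S -> s \in I -> t \in I -> preimages n z ->
  gact s (gact t z) = gact t (gact s z).
Proof.
move=> zS /inertiaP sI /inertiaP tI zn.
have szn : preimages n (gact s z) by exact: gact_preim.
have tzn : preimages n (gact t z) by exact: gact_preim.
apply: (@preimages_sep n); try by apply: gact_preim; rewrite ?gact_in.
have d1 : (0 < v (gact s (gact t z - z) - (gact t z - z))%R)%E.
  by apply: sI; rewrite ?rpredB ?gact_in//; exact: (preimages_diff zn tzn).
have d2 : (0 < v (gact t (gact s z - z) - (gact s z - z))%R)%E.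
  by apply: tI; rewrite ?rpredB ?gact_in//; exact: (preimages_diff zn szn).
have := val_sub_gt d1 d2; rewrite !gactB ?gact_in//.
by congr (_ < v _)%E; ring.
Qed.

(** Inductively [gact (s ^+ m) z] is congruent to [z + m * (gact s z - z)], and
    [p] lies in the maximal ideal. *)
Lemma inertia_exp_p (s : G) n z : z \in S -> s \in I -> preimages n z ->
  gact (s ^+ p)%g z = z.
Proof.
move=> zS /inertiaP sI zn.
have szn (u : G) : preimages n (gact u z) by exact: gact_preim.
apply: (@preimages_sep n) => //.
have main m : (0 < v (gact (s ^+ m)%g z - z - m%:R * (gact s z - z))%R)%E.
  elim: m => [|m IH]; first by rewrite expg0 gact_one mul0r subrr subr0 val0.
  have d1 : (0 < v (gact s (gact (s ^+ m)%g z - z) - (gact (s ^+ m)%g z - z))%R)%E.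
    by apply: sI; rewrite ?rpredB ?gact_in//; exact: (preimages_diff zn (szn _)).
  have := valD_gt d1 IH; rewrite gactB ?gact_in// expgS gact_mul -natr1.
  by congr (_ < v _)%E; ring.
have := main p => h.
have d : (0 < v (p%:R * (gact s z - z))%R)%E.
  apply: valM_gt0; first by rewrite vp1 lte_fin.
  exact: (preimages_diff zn (szn _)).
by have := valD_gt h d; rewrite subrK.
Qed.

(** The difference [y - z] is integral, so [s] and [t] move [y] by the same
    amounts as [z], modulo the maximal ideal. *)
Lemma inertia_inj (s t : G) n z y : z \in S -> y \in S -> s \in I -> t \in I ->
  preimages n z -> preimages n y -> gact s z = gact t z -> gact s y = gact t y.
Proof.
move=> zS yS /inertiaP sI /inertiaP tI zn yn st.
apply: (@preimages_sep n); try exact: gact_preim.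
have yz := preimages_diff zn yn.
have := val_sub_gt (sI (y - z) _ yz) (tI (y - z) _ yz).
rewrite rpredB// => /(_ isT isT); rewrite !gactB// st.
by congr (_ < v _)%E; ring.
Qed.

End TotallyBad.

(** The order divides [p ^ n] because evaluation at one of the [p ^ n]
    preimages is injective by [inertia_inj]. *)
Lemma level_inertia_pelem n : (v (iota c)%R < v (iota a)%R)%E ->
  let I := subgroup_of (inertia_group iota (tower n) v :
     groupClosed (galois_group iota (tower n))) in
  is_pelem p I /\ exists2 m, has_order I m & (m %| p ^ n)%N.
Proof.
move=> ca I.
have KS : forall k, iota k \in tower n by exact: base_tower.
have sub : {subset tower n <= tower n} by [].
have pre z : preimages n z -> z \in tower n by exact: sub_adjoin.
split; first split.
- move=> s t; apply: val_inj; apply: gact_ext; apply: tower_agree => // z zn.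
  rewrite !gact_mul; apply: (inertia_comm ca KS _ _ _ zn); first exact: pre.
    exact: (valP s).
  exact: (valP t).
- move=> s; apply: val_inj.
  rewrite subgroup_valX.
  apply: gact_ext; apply: tower_agree => // z zn; rewrite gact_one.
  by apply: (inertia_exp_p ca KS _ _ zn); [exact: pre|exact: (valP s)].
- have [k Ik] := level_inertia_pgroup n; exists (p ^ k)%N => //.
  have [ss [uss ssT sssz]] := (has_order_enum _ _).1 Ik.
  have [rs [urs rsn rssz]] := preimages_enum p_prime a_dist n.
  have [z zn] : exists z, preimages n z.
    by have [z zn] := iter_surj p_prime iota c n (iota a); exists z.
  apply: dvdn_exp2l; rewrite -(leq_exp2l _ _ (prime_gt1 p_prime)) -rssz -sssz.
  rewrite -(size_map (fun s : I => gact (val s) z)); apply: uniq_leq_size.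
    rewrite map_inj_uniq// => s t st; apply: val_inj; apply: gact_ext.
    apply: tower_agree => // y yn.
    by apply: (inertia_inj ca KS (z := z) (n := n)) => //;
      [exact: pre|exact: pre|exact: (valP s)|exact: (valP t)].
  move=> _ /mapP[s _ ->]; suff : preimages n (gact (val s) z) by rewrite -rsn.
  by apply: gact_preim => //; exact: pre.
Qed.

End FiniteLevel.

(** * Infinite inertia *)

Section InfiniteInertia.
Variables (p : nat) (p_prime : prime p).
Variables (Qp : fieldType) (vp : valuation Qp) (QpP : is_Qp p vp).
Variables (K : fieldExtType Qp) (F : closedFieldType) (iota : {rmorphism K -> F}).
Hypothesis F_alg : forall x : F, algebraicOver iota x.
Variables (v : valuation F).
Hypothesis v_ext : forall x : Qp, v (iota x%:A) = vp x.
Variables (c a : K).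
Hypothesis v_c : v (iota c) = (- (p%:R / (p%:R - 1)))%:E.
Hypothesis a_dist : forall m : nat, distinct_preimages iota p c a m.
Local Notation f := (unicritical p (iota c)).
Local Notation tower := (tower iota p c a).
Local Notation tower_infty := (tower_infty iota p c a).
Local Notation preimages := (preimages iota p c a).
Local Notation Goo := (galois_group iota tower_infty).
Local Notation Ioo := (inertia_group iota tower_infty v : groupClosed Goo).

Let K0 := K_pchar QpP K.
Let vp1 := v_p p_prime QpP v_ext.
Let pk := residue_pchar p_prime vp1.
Let KT k : iota k \in tower_infty. Proof. exact: (base_infty p_prime). Qed.
Let sub n : {subset tower n <= tower_infty}. Proof. by move=> x; exact: (tower_sub_infty p_prime). Qed.

(** The defining condition of inertia at [x] passes to the limit, as the limit
    agrees at [x] with automorphisms of the levels. *)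
Lemma inertia_cluster (tau : forall n, galois_group iota (tower n)) N0 :
  (forall n, (N0 <= n)%N -> tau n \in inertia_group iota (tower n) v) ->
  exists2 s : Goo, s \in Ioo & forall (xs : seq F) N, {subset xs <= tower_infty} ->
    exists2 m, (N <= m)%N & {in xs, gact s =1 gact (tau m)}.
Proof.
move=> tauI; have [s sP] := tower_cluster p_prime F_alg tau.
exists s => //; apply/inertiaP => x xT x0.
have [n xn] := (tower_inftyP p_prime iota c a x).1 xT.
have [|m] := sP [:: x] (maxn n N0); first by move=> y; rewrite mem_seq1 => /eqP ->.
rewrite geq_max => /andP[nm Nm] ->; last exact: mem_head.
have /inertiaP := tauI m Nm; apply=> //.
exact: (tower_le p_prime nm).
Qed.

(** For [m] large the orbit of [x] under the inertia group of level [m] lies in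
    the orbit under [Ioo]: otherwise bad conjugations would have a cluster
    point in [Ioo]. The product of the former orbit is fixed by that inertia
    group, its valuation is a multiple of [v x] by the number of conjugates,
    and [inertia_fixed_val] finds it in [K]. *)
Lemma finite_inertia_val (sI : seq Goo) x : (forall s, s \in Ioo -> s \in sI) ->
  x \in tower_infty -> x != 0 -> exists t k,
    [/\ (0 < t)%N, (t <= size sI)%N & forall r : rat, v x = r%:E -> v (iota k) = (r *+ t)%:E].
Proof.
move=> sIP xT x0; have [n xn] := (tower_inftyP p_prime iota c a x).1 xT.
pose O := [seq gact s x | s <- sI & s \in Ioo].
have [m nm mO] : exists2 m, (n <= m)%N &
    forall t, t \in inertia_group iota (tower m) v -> gact t x \in O.
  apply: contrapT => nO.
  have tex m : exists t : galois_group iota (tower m),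
      (n <= m)%N -> t \in inertia_group iota (tower m) v /\ gact t x \notin O.
    have [nm|_] := leqP n m; last by exists 1%g.
    apply: contrapT => nt; apply: nO; exists m => // t tI.
    by apply: contraT => tx; case: nt; exists t.
  have [|s sI' sP] := @inertia_cluster (fun m => sval (cid (tex m))) n.
    by move=> m nm; case: cid => t /= /(_ nm)[].
  have [|m nm ms] := sP [:: x] n; first by move=> y; rewrite mem_seq1 => /eqP ->.
  have := ms x (mem_head _ _); case: cid => t /= /(_ nm)[_ tx] e.
  move/negP: tx; apply; rewrite -e; apply/mapP; exists s => //.
  by rewrite mem_filter sI' sIP.
have KS k : iota k \in tower m by exact: base_tower.
have xm : x \in tower m by exact: (tower_le p_prime nm).
pose I := [set s | s \in inertia_group iota (tower m) v].
have [O' [uO' O'P]] := orbit_enum F_alg KS I xm.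
have szO' : (size O' <= size sI)%N.
  apply: leq_trans (_ : (size O <= _)%N); last by rewrite size_map size_filter count_size.
  by apply: uniq_leq_size => // y /O'P[t tI <-]; exact: mO.
have xO' : x \in O' by apply/O'P; exists 1%g; [exact: gpred1|exact: gact_one].
have O'm z : z \in O' -> z \in tower m by move=> /O'P[t _ <-]; rewrite gact_in.
pose y := \prod_(z <- O') z.
have ym : y \in tower m by rewrite /y big_seq; apply: rpred_prod => z; exact: O'm.
have act (s : galois_group iota (tower m)) z : z \in tower m -> v (gact s z) = v z.
  by move=> zm; exact: (act_val p_prime QpP F_alg v_ext s KS zm).
have [r vr] := val_fin v x0.
have vO' : {in O', forall z, v z = r%:E} by move=> z /O'P[t _ <-]; rewrite act.
have vy : v y = (r *+ size O')%:E by exact: val_prod_const.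
have y0 : y != 0 by exact: val_neq0 vy.
have yfix (s : galois_group iota (tower m)) : s \in inertia_group iota (tower m) v -> gact s y = y.
  move=> sIm; rewrite /y (gact_prod KS)//.
  rewrite -(big_map (gact s) xpredT id) /=; apply: perm_big.
  apply: (orbit_perm uO' O'P) => t tI; first exact: gpredM.
  by apply: gpredM => //; rewrite gpredV.
have [rs rsP] := level_residues p_prime QpP F_alg v_ext a_dist m.
have fixG z : z \in tower m -> (forall s : galois_group iota (tower m), gact s z = z) ->
    exists k, z = iota k.
  by move=> zm zfix; exact: (tower_fixed p_prime K0 F_alg a_dist zm).
have Ip := level_inertia_pgroup p_prime QpP v_ext v_c a_dist m.
have [k vk] := inertia_fixed_val pk KS act rsP fixG Ip ym y0 yfix.
exists (size O'), k; split=> //; first by case: (O') xO'.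
by move=> r'; rewrite vr => -[<-]; rewrite vk.
Qed.

Variable b : F.
Hypothesis b_fix : f b = b.
Hypothesis ab : (v (iota a - b)%R < 0)%E.

(** By [diff_neg] taking a preimage divides a negative distance to the fixed
    point by [p]. *)
Lemma preimages_dist (r : rat) n z : v (iota a - b) = r%:E ->
  preimages n z -> v (z - b) = (r / p%:R ^+ n)%:E.
Proof.
move=> vr; have r0 : r < 0 by rewrite -lte_fin -vr.
have vb := fixed_point_val p_prime v_c b_fix.
elim: n z => [|n IH] z; rewrite /Defs.preimages /=.
  by move=> ->; rewrite expr0 divr1.
rewrite -[f (iter _ _ _)]iterS iterSr => /IH fz.
rewrite exprSr invfM mulrA; apply: (diff_neg p_prime vp1 (c := iota c) vb).
  by rewrite addrCA subrr addr0 b_fix.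
by rewrite pmulr_llt0// invr_gt0 exprn_gt0// ltr0n prime_gt0.
Qed.

Lemma small_differences (r : rat) k : v (iota a - b) = r%:E ->
  exists2 x, x \in tower_infty & v x = (r / p%:R ^+ k)%:E.
Proof.
move=> vr; have r0 : r < 0 by rewrite -lte_fin -vr.
have [y yk] := iter_surj p_prime iota c k (iota a).
have [x xy] := f_surj p_prime iota c y.
have xk : preimages k.+1 x by rewrite /Defs.preimages /= -iterS iterSr xy.
exists (y - x).
  by rewrite rpredB//; [apply: (sub (n := k))|apply: (sub (n := k.+1))];
     exact: sub_adjoin.
have dy := preimages_dist vr (yk : preimages k y).
have dx := preimages_dist vr xk.
have -> : y - x = (y - b) - (x - b) by ring.
rewrite val_ltD dy// valN dx lte_fin exprSr invfM mulrA.
rewrite ltr_nMr; last by rewrite pmulr_llt0// invr_gt0 exprn_gt0// ltr0n prime_gt0.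
by rewrite invf_lt1 ?ltr1n ?ltr0n ?prime_gt1 ?prime_gt0.
Qed.

(** By [small_differences] the denominators of the valuations of the infinite
    field contain all powers of [p], while [finite_inertia_val] would bound
    these denominators. *)
Lemma infinite_inertia : infinite_set [set: subgroup_of Ioo].
Proof.
move=> /finite_enum[ss uss ssT].
pose sI := map val ss.
have sIP s : s \in Ioo -> s \in sI.
  by move=> sI'; apply/mapP; exists (Sub s sI'); rewrite ?ssT// SubK.
have [M [M0 MP]] := K_val_denom QpP v_ext.
have abn0 : iota a - b != 0 by apply: contraTneq ab => ->; rewrite val0.
have [r vr] := val_fin v abn0.
have r0 : r < 0 by rewrite -lte_fin -vr.
(* A is an integer multiple of every power of p, yet it is not zero. *)
pose A := r * ((size sI)`! * M)%:R.
have A0 : A != 0.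
  by rewrite mulf_eq0 negb_or lt_eqF//= pnatr_eq0 muln_eq0 negb_or -!lt0n fact_gt0.
have Aint k : exists z : int, A = z%:~R * p%:R ^+ k.
  have [x xT vx] := small_differences k vr.
  have x0 : x != 0 by exact: val_neq0 vx.
  have [t [q [t0 tle qP]]] := finite_inertia_val sIP xT x0.
  have vq := qP _ vx.
  have q0 : q != 0 by rewrite -(fmorph_eq0 iota); exact: val_neq0 vq.
  have [z vz] := MP q q0; move: vq; rewrite vz => -[e].
  have [d dE] : exists d, (size sI)`! = (d * t)%N.
    by apply/dvdnP; apply: dvdn_fact; rewrite t0.
  exists (z * d%:Z); rewrite /A dE intrM -[d%:Z%:~R]pmulrn.
  have Mn0 : M%:R != 0 :> rat by rewrite pnatr_eq0 -lt0n.
  have pn0 : p%:R ^+ k != 0 :> rat by rewrite expf_neq0// pnatr_eq0 -lt0n prime_gt0.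
  have -> : z%:~R = (r / p%:R ^+ k * t%:R) * M%:R.
    by rewrite (mulr_natr _ t) -e divfK.
  by rewrite !natrM; field.
have [N NP] := rat_bound `|A|.
have [z zE] := Aint N.
have z0 : z != 0 by apply: contraNneq A0 => z0; rewrite zE z0 mul0r.
have : p%:R ^+ N <= `|A|.
  rewrite zE normrM normrX normr_nat ler_peMl ?exprn_ge0 ?ler0n//.
  rewrite -intr_norm -[leLHS]/(1%:~R) ler_int.
  by move: z0; rewrite -normr_gt0.
rewrite leNgt => /negP; apply; apply: lt_trans NP _.
by rewrite -natrX ltr_nat ltn_expl// prime_gt1.
Qed.

(** An open subgroup contains the elements that fix some level [n]. The
    quotient is then finite, and [torsion_tower] bounds its exponent by [p ^
    n]. *)
Lemma inertia_pro_p : is_pro_p p (subgroup_of Ioo).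
Proof.
split; first by apply: (sub_profinite F_alg KT); exact: inertia_closed.
move=> N nN oN.
have [xs xsN] := (sub_openP _).1 oN 1%g (gpred1 (s := N)).
pose ys := [seq x <- xs | x \in tower_infty].
have [|n ysn] := @tower_infty_seq p p_prime K F iota c a ys.
  by move=> y; rewrite mem_filter => /andP[].
have nN' (s : subgroup_of Ioo) : {in tower n, gact (val s) =1 id} -> s \in N.
  move=> sn; apply: xsN => x xxs /=.
  have [xT|xT] := boolP (x \in tower_infty); last by rewrite !gact_out.
  by rewrite gact_one sn// ysn// mem_filter xT.
apply: (finite_torsion_pgroup (N := n) p_prime).
  have [T [g gP]] := tower_ffun p_prime a_dist KT (sub (n := n)).
  apply: (inj_finite_group (f := fun q : quotient_group nN => g (val (repr q)))
    (s := enum T)) => [q q' /gP qq|q]; last by rewrite mem_enum.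
  rewrite -[q]reprK -[q']reprK; apply/quot_eqP; rewrite /coset_rel.
  apply: nN' => x xn; rewrite gact_mul -qq// gactVK//.
move=> q; have [s <-] := quot_surj q; rewrite -quot_piX; apply/quot_pi1.
apply: nN'; rewrite subgroup_valX.
apply: (torsion_tower p_prime KT (sub (n := n))) => z.
by apply: (inertia_mu p_prime QpP v_ext v_c KT); exact: (valP s).
Qed.

End InfiniteInertia.

(** * Elementary abelian profinite groups *)

Section ElementaryAbelian.
Variables (p : nat) (p_prime : prime p) (G : pretopGroupType).
Hypothesis comm : forall x y : G, commute x y.
Hypothesis expp : forall x : G, (x ^+ p = 1)%g.
Hypothesis Gcompact : compact [set: G].

Section Strict.
Variable J : nat -> set G.
Hypothesis J0 : forall x, J 0 x.
Hypothesis J1 : forall n, J n 1%g.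
Hypothesis JM : forall n x y, J n x -> J n y -> J n (x * y)%g.
Hypothesis JV : forall n x, J n x -> J n x^-1%g.
Hypothesis Jdec : forall n x, J n.+1 x -> J n x.
Hypothesis Jsep : forall x, (forall n, J n x) -> x = 1%g.
Hypothesis Jnbhs : forall n x, nbhs x [set x' | J n (x^-1 * x')%g].
Hypothesis Jcomplete : forall s : nat -> G, (forall m, J m ((s m)^-1 * s m.+1)%g) ->
  exists t, forall m, J m ((s m)^-1 * t)%g.
Variable y : nat -> G.
Hypothesis yJ : forall n, J n (y n).
Hypothesis yN : forall n, ~ J n.+1 (y n).
Hypothesis Jidx : forall n x, J n x -> exists e : nat, J n.+1 (x * y n ^- e)%g.

Lemma filtrationX n x e : J n x -> J n (x ^+ e)%g.
Proof. by move=> Jx; elim: e => [|e IH]; rewrite ?expg0// expgS; exact: JM. Qed.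

Lemma filtration_le m n x : (m <= n)%N -> J n x -> J m x.
Proof. by move=> /subnKC <-; elim: (n - m)%N x => [|k IH] x; rewrite ?addn0// addnS => /Jdec/IH. Qed.

Lemma basis_torsion n e : J n.+1 (y n ^+ e)%g -> (p %| e)%N.
Proof.
move=> ye; apply: contraT => pe; case: (yN (n := n)).
have cop : coprime e p by rewrite coprime_sym prime_coprime.
have e0 : (0 < e)%N by rewrite lt0n; apply: contraNneq pe => ->; rewrite dvdn0.
have [u w uw _] := egcdnP p e0.
rewrite (eqP cop) in uw.
have -> : y n = ((y n ^+ e) ^+ u)%g.
  rewrite -expgnA mulnC uw expgnDr mulnC expgnA expp expg1n mul1g expg1//.
exact: filtrationX.
Qed.

Lemma digit_ex n x : exists e : nat, J n x -> J n.+1 (x * y n ^- e)%g.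
Proof.
have [Jx|nJx] := pselect (J n x); last by exists 0%N.
by have [e] := Jidx Jx; exists e.
Qed.

(** The elements [y n] play the role of a basis: [digit n x] is the exponent of
    [y n] in [x], for [x] in the n-th step of the filtration. *)
Definition digit n x : nat := sval (cid (digit_ex n x)).

Lemma digitP n x : J n x -> J n.+1 (x * y n ^- digit n x)%g.
Proof. by rewrite /digit; case: cid. Qed.

Lemma basis_congr n d e : J n.+1 (y n ^+ e * y n ^- d)%g -> e = d %[mod p].
Proof.
wlog le : d e / (d <= e)%N => [W h|].
  have [le|/ltnW le] := leqP d e; first exact: W.
  apply/esym; apply: W => //.
  by have := JV h; rewrite invgM invgK.
rewrite -(expgnFr _ le) => /basis_torsion h; apply/eqP.
by rewrite eqn_mod_dvd.
Qed.

Lemma digit_uniq n x e : J n.+1 (x * y n ^- e)%g -> e = digit n x %[mod p].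
Proof.
move=> xe; have Jx : J n x.
  have -> : x = (x * y n ^- e * y n ^+ e)%g by rewrite mulgVK.
  by apply: JM; [exact: Jdec|exact: filtrationX].
apply: (@basis_congr n); have := JM (JV xe) (digitP Jx).
rewrite invgM invgK; have -> : (y n ^+ e * x^-1 * (x * y n ^- digit n x) =
   y n ^+ e * y n ^- digit n x)%g by rewrite -mulgA mulKg.
by [].
Qed.

Lemma basis_expmod n d e : e = d %[mod p] -> (y n ^+ e = y n ^+ d)%g.
Proof.
move=> ed; have h k : (y n ^+ k = y n ^+ (k %% p))%g.
  by rewrite {1}(divn_eq k p) expgnDr mulnC expgnA expp expg1n mul1g.
by rewrite h ed -h.
Qed.

(** What is left of [x] once its first [n] digits are removed. *)
Fixpoint remainder n x : G := if n is k.+1 then (remainder k x * y k ^- digit k (remainder k x))%g else x.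

Lemma remainder_mem n x : J n (remainder n x).
Proof. by elim: n => [|n IH]; [exact: J0|exact: digitP]. Qed.

Definition coordinate x n : nat := digit n (remainder n x).

Lemma remainder_mul n x x' : remainder n (x * x')%g = (remainder n x * remainder n x')%g /\
  (coordinate (x * x')%g n = coordinate x n + coordinate x' n %[mod p]).
Proof.
have main k : remainder k (x * x')%g = (remainder k x * remainder k x')%g ->
    coordinate (x * x')%g k = coordinate x k + coordinate x' k %[mod p].
  move=> e; apply/esym; rewrite /coordinate e; apply: digit_uniq.
  have := JM (remainder_mem k.+1 x) (remainder_mem k.+1 x'); rewrite /= -/(coordinate x k) -/(coordinate x' k).
  congr (J _ _); rewrite expgnDr invgM -!mulgA; congr (_ * _)%g.
  rewrite [LHS]mulgA [RHS]mulgA.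
  rewrite (comm (y k ^- coordinate x k)%g (remainder k x')) -!mulgA; congr (_ * _)%g.
  exact: comm.
suff e : remainder n (x * x')%g = (remainder n x * remainder n x')%g by split=> //; exact: main.
elim: n => [|n IH] //=.
have := main _ IH => /basis_expmod e; rewrite -/(coordinate _ n) e IH expgnDr invgM.
rewrite -!mulgA; congr (_ * _)%g; rewrite -/(coordinate _ n) -/(coordinate x' n).
rewrite mulgA [RHS]mulgA (comm (y n ^- coordinate x n)%g (remainder n x')) -!mulgA; congr (_ * _)%g.
exact: comm.
Qed.

Definition coordinates (x : G) : Zmodp_infty p := fun n => (coordinate x n)%:R : 'Z_p.

Let p_gt1 : (1 < p)%N. Proof. exact: prime_gt1. Qed.

Lemma Zp_congr d e : d = e %[mod p] -> d%:R = e%:R :> 'Z_p.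
Proof. by move=> de; rewrite -Zp_nat_mod// de Zp_nat_mod. Qed.

Lemma coordinatesM x x' : coordinates (x * x')%g = coordinates x + coordinates x'.
Proof.
apply/funext => n; rewrite /coordinates -[RHS]/((coordinate x n)%:R + (coordinate x' n)%:R : 'Z_p).
by rewrite -natrD; apply: Zp_congr; case: (remainder_mul n x x').
Qed.

Lemma coordinates1 : coordinates 1%g = 0.
Proof.
by have := coordinatesM 1%g 1%g; rewrite mul1g => /(congr1 (fun h => h - coordinates 1%g));
  rewrite addrK subrr => <-.
Qed.

Lemma coordinates_filtration n x i : J n x -> (i < n)%N -> coordinates x i = 0.
Proof.
move=> Jx; suff h k : (k <= n)%N -> remainder k x = x /\ forall i, (i < k)%N -> coordinate x i = 0 %[mod p].
  by have [_ h'] := h n (leqnn n) => /h' e; rewrite /coordinates (Zp_congr e).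
elim: k => [|k IH] kn; first by split.
have [rk ck] := IH (ltnW kn).
have ck0 : coordinate x k = 0 %[mod p].
  apply/esym; rewrite /coordinate rk; apply: digit_uniq.
  by rewrite expg0 invg1 mulg1; exact: filtration_le Jx.
split=> [|i']; last by rewrite ltnS leq_eqVlt => /orP[/eqP ->|/ck].
by rewrite /= -/(coordinate x k) (basis_expmod k ck0) expg0 invg1 mulg1.
Qed.

Lemma remainder_id n x : (forall i, (i < n)%N -> coordinates x i = 0) -> remainder n x = x.
Proof.
elim: n => [|n IH] // h; have e := IH (fun i im => h i (ltnW im)).
have c0 : coordinate x n = 0 %[mod p].
  have /(congr1 (@nat_of_ord _)) := h n (ltnSn n).
  by rewrite [coordinates x n]/(_%:R) val_Zp_nat// mod0n.
by rewrite /= -/(coordinate x n) e (basis_expmod n c0) expg0 invg1 mulg1.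
Qed.

Lemma coordinates_inj : injective coordinates.
Proof.
move=> x x' xx.
suff e : (x^-1 * x')%g = 1%g by rewrite -[x']mul1g -(mulgV x) -mulgA e mulg1.
apply: Jsep => n; rewrite -(@remainder_id n (x^-1 * x')%g); first exact: remainder_mem.
move=> i _; have := coordinatesM x (x^-1 * x')%g.
by rewrite mulVKg -xx -[LHS]addr0 => /addrI <-.
Qed.

Lemma coordinates_basis n i : coordinates (y n) i = (i == n)%:R.
Proof.
have [ltin|ltni|->] := ltngtP i n; first exact: coordinates_filtration (yJ n) ltin.
- have yn : remainder n (y n) = y n.
    by apply: remainder_id => k; exact: coordinates_filtration (yJ n).
  have cn : coordinate (y n) n = 1 %[mod p].
    apply/esym; rewrite /coordinate yn; apply: digit_uniq.
    by rewrite expg1 mulgV.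
  have rn k : (n < k)%N -> remainder k (y n) = 1%g.
    elim: k => // k IH; rewrite ltnS leq_eqVlt => /orP[/eqP <-|/IH e] /=.
      by rewrite -/(coordinate (y n) n) yn (basis_expmod n cn) expg1 mulgV.
    rewrite e mul1g.
    have c0 : digit k 1%g = 0 %[mod p].
      by apply/esym/digit_uniq; rewrite expg0 invg1 mulg1.
    by rewrite (basis_expmod k c0) expg0 invg1.
  rewrite /coordinates /coordinate rn//; have c0 : digit i 1%g = 0 %[mod p].
    by apply/esym/digit_uniq; rewrite expg0 invg1 mulg1.
  exact: (Zp_congr c0).
- have yn : remainder n (y n) = y n.
    by apply: remainder_id => k; exact: coordinates_filtration (yJ n).
  rewrite /coordinates; apply: (@Zp_congr _ 1).
  by apply/esym; rewrite /coordinate yn; apply: digit_uniq; rewrite expg1 mulgV.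
Qed.

Lemma coordinatesX x e : coordinates (x ^+ e)%g = coordinates x *+ e.
Proof. by elim: e => [|e IH]; rewrite ?expg0 ?coordinates1// expgS coordinatesM IH mulrS. Qed.

Lemma coordinates_surj (t : Zmodp_infty p) : exists x, coordinates x = t.
Proof.
pose s := fix s m := if m is k.+1 then (s k * y k ^+ (t k : nat))%g else 1%g.
have [m|x xs] := Jcomplete (s := s).
  by rewrite /= mulKg; exact: filtrationX.
have ss m i : (i < m)%N -> coordinates (s m) i = t i.
  elim: m => // m IH im /=.
  rewrite coordinatesM coordinatesX -[LHS]/(coordinates (s m) i + (coordinates (y m) *+ (t m : nat)) i).
  have -> : (coordinates (y m) *+ (t m : nat)) i = coordinates (y m) i *+ (t m : nat).
    by elim: (nat_of_ord (t m)) => // e IHe; rewrite !mulrS -IHe.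
  rewrite coordinates_basis; move: im; rewrite ltnS leq_eqVlt => /orP[/eqP ->|im].
    have -> : coordinates (s m) m = 0.
      have h k j : (k <= j)%N -> coordinates (s k) j = 0.
        elim: k => [|k IHk] kj; first by rewrite /= coordinates1.
        rewrite /= coordinatesM coordinatesX -[LHS]/(coordinates (s k) j + (coordinates (y k) *+ (t k : nat)) j).
        rewrite IHk ?(ltnW kj)//.
        have -> : (coordinates (y k) *+ (t k : nat)) j = coordinates (y k) j *+ (t k : nat).
          by elim: (nat_of_ord (t k)) => // e IHe; rewrite !mulrS -IHe.
        by rewrite coordinates_basis gtn_eqF// mul0rn addr0.
      exact: h.
    by rewrite eqxx add0r natr_Zp.
  by rewrite IH// ltn_eqF// mul0rn addr0.
exists x; apply/funext => i.
rewrite -(ss i.+1 i (ltnSn i)) -[x](mulVKg (s i.+1)) coordinatesM.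
rewrite -[LHS]/(coordinates (s i.+1) i + coordinates ((s i.+1)^-1 * x)%g i).
by rewrite (coordinates_filtration (xs i.+1))// addr0.
Qed.

(** The first [n] digits only depend on the class modulo the n-th step of the
    filtration, which is open. *)
Lemma coordinates_continuous : continuous coordinates.
Proof.
move=> x.
apply: (proj2 (@pointwise_cvgP nat (discrete_topology 'Z_p)
  (coordinates @ nbhs x) (coordinates x) _)) => n A /= /nbhs_singleton An.
have := Jnbhs n.+1 x; apply: filterS => x' /= xx'.
suff -> : coordinates x' n = coordinates x n by [].
rewrite -[x'](mulVKg x) coordinatesM.
rewrite -[LHS]/(coordinates x n + coordinates (x^-1 * x')%g n).
by rewrite (coordinates_filtration xx')// addr0.
Qed.

(** An element is determined by its digits since the filtration is separated,
    and all sequences of digits occur since it is complete. A continuous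
    bijection from a compact space to a separated one is a homeomorphism. *)
Lemma strict_filtration_isog : topgroup_isog G (Zmodp_infty p).
Proof.
pose g t := sval (cid (coordinates_surj t)).
have gK : cancel g coordinates by move=> t; rewrite /g; case: cid.
have fK : cancel coordinates g by move=> x; apply: coordinates_inj; rewrite gK.
exists coordinates, g; split=> //.
- exact: coordinatesM.
- exact: coordinates_continuous.
- apply: (compact_bij_continuous Gcompact _ coordinates_continuous fK gK).
  have h := @hausdorff_product nat (fun=> discrete_topology 'Z_p : topologicalType)
    (fun=> discrete_hausdorff).
  exact: h.
Qed.
End Strict.

Section Weak.
Variable J : nat -> set G.
Hypothesis J0 : forall x, J 0 x.
Hypothesis J1 : forall n, J n 1%g.
Hypothesis JM : forall n x y, J n x -> J n y -> J n (x * y)%g.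
Hypothesis JV : forall n x, J n x -> J n x^-1%g.
Hypothesis Jdec : forall n x, J n.+1 x -> J n x.
Hypothesis Jsep : forall x, (forall n, J n x) -> x = 1%g.
Hypothesis Jnbhs : forall n x, nbhs x [set x' | J n (x^-1 * x')%g].
Hypothesis Jcomplete : forall s : nat -> G, (forall m, J m ((s m)^-1 * s m.+1)%g) ->
  exists t, forall m, J m ((s m)^-1 * t)%g.
Hypothesis Jidx : forall n x y, J n x -> J n y -> ~ J n.+1 y ->
  exists e : nat, J n.+1 (x * y ^- e)%g.
Hypothesis Jnontriv : forall n, exists2 x, J n x & x <> 1%g.

Let jump m := exists y, J m y /\ ~ J m.+1 y.

Lemma filtration_antimono m n x : (m <= n)%N -> J n x -> J m x.
Proof. exact: filtration_le. Qed.

(** Elements of [J n] stay in the filtration until the first step that is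
    proper, and there is one because [J n] is not trivial. *)
Lemma next_jump n : exists m, [/\ (n <= m)%N, jump m & forall x, J n x -> J m x].
Proof.
pose Q m := `[< (n <= m)%N /\ jump m >].
have exQ : exists m, Q m.
  have [x Jx x1] := Jnontriv n; apply: contrapT => nQ; apply: x1; apply: Jsep => m.
  have [mn|/ltnW nm] := leqP m n; first exact: filtration_antimono Jx.
  rewrite -(subnKC nm); elim: (m - n)%N => [|k IH]; first by rewrite addn0.
  rewrite addnS; apply: contrapT => nJ; apply: nQ; exists (n + k)%N.
  by apply/asboolP; split; [exact: leq_addr|exists x].
have [m /asboolP[nm jm] mmin] := ex_minnP exQ; exists m; split=> // x Jx.
suff h k : (n + k <= m)%N -> J (n + k)%N x by rewrite -(subnKC nm); apply: h; rewrite subnKC.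
elim: k => [|k IH] km; first by rewrite addn0.
rewrite addnS in km *; apply: contrapT => nJ.
have := mmin (n + k)%N; rewrite leqNgt km => /(_ _)/not_notP; apply => //.
by apply/asboolP; split; [exact: leq_addr|exists x; split=> //; exact: IH (ltnW km)].
Qed.

Definition next_jump_of n := sval (cid (next_jump n)).

Lemma next_jump_ofP n : [/\ (n <= next_jump_of n)%N, jump (next_jump_of n) & forall x, J n x -> J (next_jump_of n) x].
Proof. by rewrite /next_jump_of; case: cid. Qed.

Fixpoint jump_seq i := if i is k.+1 then next_jump_of (jump_seq k).+1 else next_jump_of 0.

Lemma jump_seq_jump i : jump (jump_seq i).
Proof. by case: i => [|i] /=; [case: (next_jump_ofP 0)|case: (next_jump_ofP (jump_seq i).+1)]. Qed.

Lemma jump_seq_ge i : (i <= jump_seq i)%N.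
Proof.
elim: i => // i IH /=; case: (next_jump_ofP (jump_seq i).+1) => h _ _.
exact: leq_ltn_trans IH h.
Qed.

Lemma jump_seqS i x : J (jump_seq i.+1) x <-> J (jump_seq i).+1 x.
Proof.
rewrite /=; case: (next_jump_ofP (jump_seq i).+1) => h _ h'; split=> [Jx|]; last exact: h'.
exact: filtration_antimono Jx.
Qed.

Lemma jump_seq_le m k : (jump_seq m <= jump_seq (m + k))%N.
Proof.
elim: k => [|k IH]; first by rewrite addn0.
rewrite addnS /=; case: (next_jump_ofP (jump_seq (m + k)).+1) => h _ _.
exact: leq_trans IH (ltnW h).
Qed.

(** The filtration reindexed by its proper steps is as in
    [strict_filtration_isog]. *)
Lemma elementary_abelian_isog : topgroup_isog G (Zmodp_infty p).
Proof.
pose y i := sval (cid (jump_seq_jump i)).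
have yP i : J (jump_seq i) (y i) /\ ~ J (jump_seq i).+1 (y i) by rewrite /y; case: cid.
apply: (@strict_filtration_isog (fun i => J (jump_seq i)) _ _ _ _ _ _ _ _ y) => //.
- by move=> x /=; case: (next_jump_ofP 0) => _ _; apply.
- by move=> i x x'; exact: JM.
- by move=> i x; exact: JV.
- by move=> i x /jump_seqS; exact: Jdec.
- by move=> x Jx; apply: Jsep => n; apply: (filtration_antimono (jump_seq_ge n)); exact: Jx.
- move=> s sJ; have sJ' m : J m ((s m)^-1 * s m.+1)%g by apply: (filtration_antimono (jump_seq_ge m)); exact: sJ.
  have [t tP] := Jcomplete sJ'; exists t => m.
  have le := jump_seq_ge m.
  have -> : ((s m)^-1 * t = ((s m)^-1 * s (jump_seq m)) * ((s (jump_seq m))^-1 * t))%g.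
    by rewrite -mulgA mulVKg.
  have h k : J (jump_seq m) ((s m)^-1 * s (m + k)%N)%g.
    elim: k => [|k IH]; first by rewrite addn0 mulVg.
    have -> : ((s m)^-1 * s (m + k.+1)%N =
        ((s m)^-1 * s (m + k)%N) * ((s (m + k)%N)^-1 * s (m + k).+1))%g.
      by rewrite addnS -mulgA mulVKg.
    by apply: JM => //; apply: (filtration_antimono (jump_seq_le m k)); exact: sJ.
  by apply: JM => //; have := h (jump_seq m - m)%N; rewrite subnKC.
- by move=> i; case: (yP i).
- by move=> i /jump_seqS; case: (yP i).
- move=> i x Jx; have [y1 y2] := yP i.
  by have [e xe] := Jidx Jx y1 y2; exists e; apply/jump_seqS.
Qed.
End Weak.
End ElementaryAbelian.

(** * The inertia group when a has a large valuation *)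

Section ElementaryInertia.
Variables (p : nat) (p_prime : prime p).
Variables (Qp : fieldType) (vp : valuation Qp) (QpP : is_Qp p vp).
Variables (K : fieldExtType Qp) (F : closedFieldType) (iota : {rmorphism K -> F}).
Hypothesis F_alg : forall x : F, algebraicOver iota x.
Variables (v : valuation F).
Hypothesis v_ext : forall x : Qp, v (iota x%:A) = vp x.
Variables (c a : K).
Hypothesis v_c : v (iota c) = (- (p%:R / (p%:R - 1)))%:E.
Hypothesis a_dist : forall m : nat, distinct_preimages iota p c a m.
Local Notation f := (unicritical p (iota c)).
Local Notation tower := (tower iota p c a).
Local Notation tower_infty := (tower_infty iota p c a).
Local Notation preimages := (preimages iota p c a).
Local Notation Goo := (galois_group iota tower_infty).
Local Notation Ioo := (inertia_group iota tower_infty v : groupClosed Goo).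
Variable b : F.
Hypothesis b_fix : f b = b.
Hypothesis ab : (v (iota a - b)%R < 0)%E.
Hypothesis ca : (v (iota c)%R < v (iota a)%R)%E.

Let KT k : iota k \in tower_infty. Proof. exact: (base_infty p_prime). Qed.
Let sub n : {subset tower n <= tower_infty}. Proof. by move=> x; exact: (tower_sub_infty p_prime). Qed.
Let pre n z : preimages n z -> z \in tower_infty.
Proof. by move=> zn; apply: (sub (n := n)); exact: sub_adjoin. Qed.

Lemma tower_infty_ext (s t : Goo) :
  (forall n z, preimages n z -> gact s z = gact t z) -> s = t.
Proof.
move=> st; apply: gact_ext => x /(tower_inftyP p_prime)[n xn].
by apply: (tower_agree (sub (n := n)) (sub (n := n)) _ xn) => z /st.
Qed.

(** The filtration consists of the subgroups that fix the n-th field. By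
    [inertia_inj] an element that fixes level [n] is determined on level [n +
    1] by the p-th root of unity by which it multiplies one preimage [z], so
    that each step has order at most [p]. *)
Lemma inertia_elementary : topgroup_isog (subgroup_of Ioo) (Zmodp_infty p).
Proof.
have comm (s t : subgroup_of Ioo) : commute s t.
  apply: val_inj; apply: tower_infty_ext => n z zn; rewrite !gact_mul.
  apply: (inertia_comm p_prime QpP v_ext v_c ca KT _ _ _ zn).
  - exact: pre zn.
  - exact: (valP s).
  - exact: (valP t).
have expp (s : subgroup_of Ioo) : (s ^+ p = 1)%g.
  apply: val_inj; rewrite subgroup_valX; apply: tower_infty_ext => n z zn; rewrite gact_one.
  apply: (inertia_exp_p p_prime QpP v_ext v_c ca KT _ _ zn).
  - exact: pre zn.
  - exact: (valP s).
have Gcompact : compact [set: subgroup_of Ioo].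
  by apply: (sub_compact F_alg KT); exact: inertia_closed.
pose J n := [set s : subgroup_of Ioo | {in tower n, gact (val s) =1 id}].
have gen n (s : subgroup_of Ioo) :
    (forall z, preimages n z -> gact (val s) z = z) -> J n s.
  move=> sn x xn; rewrite -[RHS](@gact_one _ _ iota tower_infty x).
  apply: (tower_agree (sub (n := n)) (sub (n := n)) _ xn) => z zn.
  by rewrite gact_one sn.
have JV n s : J n s -> J n s^-1%g.
  by move=> Js x xn /=; rewrite -[in LHS](Js x xn) gactVK.
apply: (elementary_abelian_isog p_prime comm expp Gcompact (J := J)) => //.
- move=> s; apply: gen => z; rewrite /Defs.preimages /= => ->.
  exact: (gactK KT).
- by move=> n x _; rewrite gact_one.
- by move=> n s t Js Jt x xn; rewrite gact_mul Jt// Js.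
- move=> n s Js x xn; apply: Js; exact: (tower_le p_prime (leqnSn n)).
- move=> s Js; apply: val_inj; apply: tower_infty_ext => n z zn; rewrite gact_one.
  by apply: (Js n); exact: sub_adjoin.
- move=> n s; have [rs [_ rsn _]] := preimages_enum p_prime a_dist n.
  apply/sub_nbhsP; exists rs => t st; apply: gen => z zn.
  rewrite gact_mul -st ?gactVK//.
  by have : [set` rs] z by rewrite rsn.
- move=> s sJ; have [t tP] := infty_cluster p_prime F_alg a_dist (fun m => val (s m)).
  have sagree m k : {in tower m, gact (val (s (m + k)%N)) =1 gact (val (s m))}.
    move=> x xm; elim: k => [|k IH]; first by rewrite addn0.
    have xmk : x \in tower (m + k) by exact: (tower_le p_prime (leq_addr k m)).
    have := sJ (m + k)%N x xmk; rewrite gact_mul => e.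
    by rewrite addnS -IH -[in RHS]e gactKV.
  have tI : t \in Ioo.
    apply/inertiaP => x xT x0; have [n xn] := (tower_inftyP p_prime iota c a x).1 xT.
    have [m _ ->] := tP n 0%N; last exact: xn.
    by have /inertiaP := valP (s m); apply.
  exists (Sub t tI) => m x xm; rewrite gact_mul.
  have [m' mm' tm] := tP m m; rewrite [val (Sub t tI)]SubK tm//.
  by rewrite -(subnKC mm') sagree// gactVK.
- move=> n s t Js Jt nJt.
  have [z zn] := iter_surj p_prime iota c n.+1 (iota a).
  have zn' : preimages n.+1 z := zn.
  have zT := pre zn'.
  have fzn : f z \in tower n.
    by apply: sub_adjoin; rewrite /Defs.preimages /= -zn' -iterSr.
  (* u fixes f z, hence z ^+ p. *)
  have uz (u : subgroup_of Ioo) : J n u -> gact (val u) z ^+ p = z ^+ p.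
    move=> Ju; have := Ju (f z) fzn; rewrite (gact_f p c KT)// /unicritical.
    by move=> /addIr.
  have determ (u w : subgroup_of Ioo) : gact (val u) z = gact (val w) z ->
      forall y, preimages n.+1 y -> gact (val u) y = gact (val w) y.
    move=> uw y yn; apply: (inertia_inj p_prime QpP v_ext v_c ca KT _ _ _ _ zn' yn uw).
    + exact: zT.
    + exact: pre yn.
    + exact: (valP u).
    + exact: (valP w).
  have tz : gact (val t) z != z.
    apply/eqP => tz; apply: nJt; apply: gen => y yn.
    rewrite -[RHS](@gact_one _ _ iota tower_infty y); apply: (determ t 1%g) => //.
    by rewrite gact_one.
  have z0 : z != 0 by apply: contra_neq tz => ->; rewrite gact0.
  pose w := gact (val t) z / z.
  have wT : w \in tower_infty by rewrite rpred_div ?gact_in.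
  have wp : w ^+ p = 1 by rewrite expr_div_n uz// divff// expf_neq0.
  have w1 : w != 1.
    by apply: contra_neq tz => w1; rewrite -[LHS](divfK z0) -/w w1 mul1r.
  have wprim := prime_unity_root_primitive p_prime wp w1.
  have sp : (gact (val s) z / z) ^+ p = 1 by rewrite expr_div_n uz// divff// expf_neq0.
  have [e se] := prim_rootP wprim sp.
  have tw : gact (val t) w = w.
    apply: (inertia_mu p_prime QpP v_ext v_c KT _ wT wp); exact: (valP t).
  have tez k : gact (val (t ^+ k)%g) z = w ^+ k * z.
    rewrite subgroup_valX; elim: k => [|k IH]; first by rewrite expg0 gact_one mul1r.
    rewrite expgS gact_mul IH gactM ?rpredX// (gactX KT)// tw.
    by rewrite -[gact _ z](divfK z0) -/w mulrA -exprSr.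
  exists e; apply: gen => y yn.
  have seq : gact (val s) z = gact (val (t ^+ e)%g) z by rewrite tez -se divfK.
  have h := determ s (t ^+ e)%g seq.
  have := h (gact (val (t ^- e)%g) y); rewrite gact_mul => ->.
    by rewrite gactKV.
  by apply: (gact_preim KT) => //; exact: pre yn.
- move=> n; apply: contrapT => nt.
  have triv s : J n s -> s = 1%g.
    by move=> Js; apply: contrapT => s1; apply: nt; exists s.
  apply: (infinite_inertia p_prime QpP F_alg v_ext v_c a_dist b_fix ab).
  have [T [g gP]] := tower_ffun p_prime a_dist KT (sub (n := n)).
  apply: (inj_finite_group (f := fun s : subgroup_of Ioo => g (val s)) (s := enum T))
     => [s t /gP st|s]; last by rewrite mem_enum.
  have e : (s^-1 * t)%g = 1%g.
    by apply: triv => x xn; rewrite gact_mul -st// gactVK.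
  by rewrite -[t](mulVKg s) e mulg1.
Qed.

End ElementaryInertia.

(** * The residue field of the infinite level *)

Section ResidueTower.
Variables (p : nat) (p_prime : prime p).
Variables (Qp : fieldType) (vp : valuation Qp) (QpP : is_Qp p vp).
Variables (K : fieldExtType Qp) (F : closedFieldType) (iota : {rmorphism K -> F}).
Hypothesis F_alg : forall x : F, algebraicOver iota x.
Variables (v : valuation F).
Hypothesis v_ext : forall x : Qp, v (iota x%:A) = vp x.
Variables (c a : K).
Hypothesis v_c : v (iota c) = (- (p%:R / (p%:R - 1)))%:E.
Hypothesis a_dist : forall m : nat, distinct_preimages iota p c a m.
Local Notation f := (unicritical p (iota c)).
Local Notation tower := (tower iota p c a).
Local Notation tower_infty := (tower_infty iota p c a).
Local Notation preimages := (preimages iota p c a).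
Local Notation Goo := (galois_group iota tower_infty).
Local Notation Ioo := (inertia_group iota tower_infty v : groupClosed Goo).
Variable b : F.
Hypothesis b_fix : f b = b.

Let K0 := K_pchar QpP K.
Let vp1 := v_p p_prime QpP v_ext.
Let pk := residue_pchar p_prime vp1.
Let KT k : iota k \in tower_infty. Proof. exact: (base_infty p_prime). Qed.
Let sub n : {subset tower n <= tower_infty}. Proof. by move=> x; exact: (tower_sub_infty p_prime). Qed.
Let stab n (s : Goo) x : x \in tower n -> gact s x \in tower n.
Proof. by move=> xn; exact: (tower_stable KT s (sub (n := n)) xn). Qed.
Let v_act (s : Goo) x : x \in tower_infty -> v (gact s x) = v x.
Proof. exact: (act_val p_prime QpP F_alg v_ext s KT). Qed.

Let v_act' n (s : Goo) x : x \in tower n -> v (gact s x) = v x.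
Proof. by move=> xn; apply: v_act; exact: (sub xn). Qed.

(** The negative valuations of [z - b] tend to zero with the level, hence
    eventually exceed [rho], the valuation of [b]. *)
Lemma eventually_rho : exists n0, forall n z, (n0 <= n)%N -> preimages n z -> v z = (rho p)%:E.
Proof.
have vb := fixed_point_val p_prime v_c b_fix.
have [ab|ab] := leP 0%E (v (iota a - b)).
  exists 0%N => n z _ zn.
  by have [] := preimages_near_base p_prime QpP v_ext v_c b_fix ab zn.
have abn0 : iota a - b != 0 by apply: contraTneq ab => ->; rewrite val0.
have [r vr] := val_fin v abn0.
have rho0 := rho_lt0 p_prime.
have [N NP] := rat_bound (r / rho p); exists N => n z Nn zn.
have vz := preimages_dist p_prime QpP v_ext v_c b_fix ab vr zn.
rewrite -(subrK b z) addrC val_ltD vb//= vz lte_fin.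
rewrite ltr_pdivlMr ?exprn_gt0 ?ltr0n ?prime_gt0//.
rewrite -ltr_ndivrMl// mulrC; apply: lt_trans NP _; rewrite -natrX ltr_nat.
exact: leq_ltn_trans Nn (ltn_expl _ (prime_gt1 p_prime)).
Qed.

(** Above level [n0] all preimages have valuation [rho]. Choose for each
    preimage [y] of level [n0] a point [ch y] that [iter k f] sends to [y]. By
    [iter_int] and [iter_sep], a preimage [z] of level [n0 + k] is determined
    by [y = iter k f z] and the residue of [z - ch y]; comparing the numbers [p
    ^ (n0 + k)] and [p ^ n0] of points [z] and [y] shows that there are at
    least [p ^ k] residues. *)
Lemma residues_infinite (R : seq (residue v)) :
  ~ (forall n x, x \in tower n -> (0 <= v x)%E -> red v x \in R).
Proof.
move=> RP; have [n0 n0P] := eventually_rho.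
pose k := size R.
have [rs [urs rsn rssz]] := preimages_enum p_prime a_dist (n0 + k).
have [rs0 [urs0 rs0n rs0sz]] := preimages_enum p_prime a_dist n0.
have chex y : exists x, iter k f x = y by exact: (iter_surj p_prime iota c k y).
pose ch y := sval (cid (chex y)).
have chP y : iter k f (ch y) = y by rewrite /ch; case: cid.
have rsP z : z \in rs -> preimages (n0 + k) z by rewrite -rsn.
have fk z : preimages (n0 + k) z -> preimages n0 (iter k f z).
  by rewrite /Defs.preimages /= iterD.
have chpre z : preimages (n0 + k) z -> preimages (n0 + k) (ch (iter k f z)).
  by rewrite /Defs.preimages /= !iterD chP.
have vit z i : preimages (n0 + k) z -> (i < k)%N -> v (iter i f z) = (rho p)%:E.
  move=> zn ik; apply: (n0P (n0 + k - i)%N).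
    by rewrite -addnBA ?leq_addr// ltnW.
  by rewrite /Defs.preimages /= -iterD subnK// (leq_trans (ltnW ik)) ?leq_addl.
have dint z : preimages (n0 + k) z -> (0 <= v (z - ch (iter k f z))%R)%E.
  move=> zn; apply: (iter_int p_prime vp1 (c := iota c) (k := k)).
    by move=> i; apply: vit; exact: chpre.
  by rewrite chP subrr val0.
have inT z : preimages (n0 + k) z -> z - ch (iter k f z) \in tower (n0 + k).
  by move=> zn; apply: rpredB; apply: sub_adjoin => //; exact: chpre.
pose h z := (iter k f z, red v (z - ch (iter k f z))).
have hinj : {in rs &, injective h}.
  move=> x y /rsP xn /rsP yn [e rxy].
  apply: (iter_sep p_prime vp1 (c := iota c) (k := k)) => //.
    by move=> i; exact: vit.
  have /red_eq := rxy; rewrite !dint// => /(_ isT isT).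
  by rewrite e opprB addrA subrK.
(* The pairs (image, residue) are distinct: p ^ (n0 + k) <= p ^ n0 * k. *)
have : (size (map h rs) <= size [seq (y, u) | y <- rs0, u <- R])%N.
  apply: uniq_leq_size; first by rewrite map_inj_in_uniq.
  move=> _ /mapP[z /rsP zn ->]; apply/allpairsP; exists (h z); split=> //=.
    by have : [set` rs0] (iter k f z) by rewrite rs0n; exact: fk.
  by apply: (RP (n0 + k)%N); [exact: inT|exact: dint].
rewrite size_map size_allpairs rssz rs0sz expnD leq_pmul2l ?expn_gt0 ?prime_gt0//.
by rewrite leqNgt ltn_expl// prime_gt1.
Qed.

Definition res_trivial n (s : Goo) : Prop :=
  forall x, x \in tower n -> (0 <= v x)%E -> red v (gact s x) = red v x.
Local Notation M := res_trivial.

Lemma res_trivial1 n : M n 1%g. Proof. by move=> x _ _; rewrite gact_one. Qed.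

Lemma res_trivialM n s t : M n s -> M n t -> M n (s * t)%g.
Proof.
move=> Ms Mt x xn x0; rewrite gact_mul Ms ?Mt ?stab//.
by rewrite (v_act' _ xn).
Qed.

Lemma res_trivialV n s : M n s -> M n s^-1%g.
Proof.
move=> Ms x xn x0; have := Ms (gact s^-1%g x).
by rewrite gactKV stab// (v_act' _ xn) => /(_ isT x0).
Qed.

Lemma res_trivialJ n s t : M n s -> M n (s ^ t)%g.
Proof.
move=> Ms x xn x0; have xT := sub xn.
have := Ms (gact t x) (stab t xn); rewrite v_act// => /(_ x0) /red_eq.
rewrite !v_act ?gact_in// => /(_ x0 x0) h; apply/red_eq; rewrite ?v_act//.
rewrite -(v_act t) ?rpredB ?gact_in// gactB ?gact_in//.
by rewrite /conjg !gact_mul gactKV.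
Qed.

Lemma res_trivial_le m n s : (m <= n)%N -> M n s -> M m s.
Proof. by move=> mn Ms x xm; apply: Ms; exact: (tower_le p_prime mn). Qed.

Lemma inertia_res_trivial s : s \in Ioo <-> forall n, M n s.
Proof.
split=> [/(inertia_redP v_act) sI n x xn|sM]; first by apply: sI; exact: (sub xn).
apply/(inertia_redP v_act) => x /(tower_inftyP p_prime)[n xn]; exact: (sM n x xn).
Qed.

Lemma res_trivial_agree n s t : {in tower n, gact s =1 gact t} -> M n s -> M n t.
Proof. by move=> st Ms x xn x0; rewrite -st// Ms. Qed.

(** By [residue_gal_cyclic] there is a generator for each level. A cluster
    point of these agrees on level [n] with a generator for a higher level,
    which also serves for level [n]. *)
Lemma topological_generator : exists g : Goo, forall n s, exists u : nat, M n (g ^- u * s)%g.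
Proof.
have gex n : exists g : Goo, forall s, exists u : nat, M n (g ^- u * s)%g.
  have [rs rsP] := level_residues p_prime QpP F_alg v_ext a_dist n.
  have [g gP] := residue_gal_cyclic pk KT (sub (n := n)) (stab (n := n)) v_act rsP.
  exists g => s; have [u uP] := gP s; exists u => x xn x0; have xT := sub xn.
  rewrite gact_mul; have := uP x xn x0 => /red_eq.
  rewrite !v_act// => /(_ x0 x0) h; apply/red_eq; rewrite ?v_act ?gact_in//.
  by rewrite -(v_act (g ^+ u)%g) ?rpredB ?gact_in// gactB ?gact_in// gactKV.
pose gs n := sval (cid (gex n)).
have gsP n s : exists u : nat, M n (gs n ^- u * s)%g by rewrite /gs; case: cid.
have [g gP] := infty_cluster p_prime F_alg a_dist gs.
exists g => n s; have [m nm mg] := gP n n; have [u uM] := gsP m s; exists u.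
have uM' := res_trivial_le nm uM.
have e : {in tower n, gact (g ^+ u)%g =1 gact (gs m ^+ u)%g}.
  move=> x xn; rewrite !gact_expg; elim: u {uM uM'} => //= u ->.
  rewrite mg//; elim: u => //= u IH; rewrite stab//.
have {}e : {in tower n, gact (g ^- u)%g =1 gact (gs m ^- u)%g}.
  move=> x xn; apply: (@gact_inj _ _ _ _ (g ^+ u)%g).
  by rewrite gactKV e ?gactKV// stab.
by move=> x xn x0; rewrite -(uM' x xn x0) !gact_mul e// stab.
Qed.

Hypothesis mu : contains_mu iota p.

Lemma res_trivial_torsion n (s : Goo) : M n (s ^+ (p ^ n))%g.
Proof.
move=> x xn x0; have e : {in tower n, gact (s ^+ (p ^ n))%g =1 id}.
  apply: (torsion_tower p_prime KT (sub (n := n))) => z.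
  by move=> _ /mu[k <-]; rewrite (gactK KT).
by rewrite e.
Qed.

Lemma level_group n : exists sG : seq (galois_group iota (tower n)),
  [/\ uniq sG, forall s, s \in sG & exists k, size sG = (p ^ k)%N].
Proof.
have : finite_pgroup p (galois_group iota (tower n)).
  apply: (finite_torsion_pgroup (N := n) p_prime).
    exact: (level_finite p_prime a_dist).
  move=> s; apply: gact_ext => x xn; rewrite gact_one.
  have KS k : iota k \in tower n by exact: base_tower.
  have e : {in tower n, gact (s ^+ (p ^ n))%g =1 id}.
    apply: (torsion_tower p_prime KS (c := c) (a := a)) => // z.
    by move=> _ /mu[k <-]; rewrite (gactK KS).
  by rewrite e.
by move=> [k /has_order_enum[sG [uG GT szG]]]; exists sG; split=> //; exists k.
Qed.

(** The group of level [n] has order [p ^ j], so the norm of [z], an element of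
    [K], has residue the [p ^ j] power of that of [z]. A further power of the
    Frobenius map gives the residue of [z] itself, since this map is periodic.
    *)
Lemma residue_fixed n z : z \in tower n -> (0 <= v z)%E ->
  (forall s : Goo, red v (gact s z) = red v z) ->
  exists2 k, (0 <= v (iota k)%R)%E & red v (iota k) = red v z.
Proof.
move=> zn z0 zfix; have [sG [uG sGT [j szG]]] := level_group n.
have KS k : iota k \in tower n by exact: base_tower.
have zfix' (s : galois_group iota (tower n)) : red v (gact s z) = red v z.
  have [s' s'P] := infty_extend p_prime K0 F_alg a_dist s.
  by rewrite -s'P.
have vs (s : galois_group iota (tower n)) : (0 <= v (gact s z)%R)%E.
  by rewrite (act_val p_prime QpP F_alg v_ext s KS zn).
pose N := \prod_(s <- sG) gact s z.
have Nn : N \in tower n by rewrite rpred_prod// => s _; rewrite gact_in.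
have Nfix (s : galois_group iota (tower n)) : gact s N = N.
  rewrite /N (gact_prod KS) => [|t _]; last by rewrite gact_in.
  rewrite -[RHS](perm_big _ (perm_mulg s uG sGT)) big_map.
  by apply: eq_bigr => t _; rewrite gact_mul.
have [k Nk] := tower_fixed p_prime K0 F_alg a_dist Nn Nfix.
have redN : red v (iota k) = red v z ^+ (p ^ j).
  rewrite -Nk red_prod => [|s _]; last exact: vs.
  rewrite (eq_bigr (fun=> red v z)) => [|s _]; last exact: zfix'.
  by rewrite big_const_seq count_predT iter_mulr_1 szG.
have vk : (0 <= v (iota k)%R)%E by rewrite -Nk; apply: val_prod_ge0 => s _; exact: vs.
have [rs rsP] := level_residues p_prime QpP F_alg v_ext a_dist n.
have [N0 N0gt N0P] := frob_period pk rsP.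
(* The exponents j and (N0 - 1) * j add up to a multiple of the period N0. *)
exists (k ^+ (p ^ (N0.-1 * j))); first by rewrite rmorphXn valX_ge0.
rewrite rmorphXn /= redX// redN -exprM -expnD.
have -> : (j + N0.-1 * j = j * N0)%N by rewrite -mulSn prednK// mulnC.
elim: j {szG redN} => [|j IH]; first by rewrite mul0n expr1.
by rewrite mulSn expnD exprM N0P.
Qed.

(** If [g ^ P] acted trivially on all residues, each residue would be a root of
    the polynomial of degree [P] whose roots are its conjugates under [g]. The
    coefficients are fixed by [g], hence are residues of [K]. There are
    finitely many such polynomials, against [residues_infinite]. *)
Lemma generator_infinite (g : Goo) P : (forall n s, exists u : nat, M n (g ^- u * s)%g) ->
  (0 < P)%N -> ~ (forall n, M n (g ^+ P)%g).
Proof.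
move=> gP P0 gPM.
have [rs0 rs0P] := level_residues p_prime QpP F_alg v_ext a_dist 0.
have [R RP] := poly_roots_enum rs0 P.+1.
apply: (@residues_infinite R) => n x xn x0.
have [rs rsP] := level_residues p_prime QpP F_alg v_ext a_dist n.
have [d gd] := frob_actsP pk KT (sub (n := n)) (stab (n := n)) v_act rsP g.
have gid i := acts_as_frobX (sub (n := n)) (stab (n := n)) v_act i gd.
pose A := [seq red v (gact (g ^+ i)%g x) | i <- seq.iota 0 P].
pose Q := \prod_(y <- A) ('X - y%:P).
have inQ i : exists z, [/\ z \in tower n, (0 <= v z)%E & red v z = Q`_i].
  apply: (@coef_prod_XsubC_ind _ (fun y => exists z, [/\ z \in tower n, (0 <= v z)%E & red v z = y])).
  - by exists 0; rewrite rpred0 val0 red0.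
  - by exists 1; rewrite rpred1 val1 red1.
  - move=> _ _ [y [yn y0 <-]] [z [zn z0 <-]]; exists (y - z).
    by rewrite rpredB// redB// val_sub_ge.
  - move=> _ _ [y [yn y0 <-]] [z [zn z0 <-]]; exists (y * z).
    by rewrite rpredM// redM// valM_ge0.
  - move=> _ /mapP[k _ ->]; exists (gact (g ^+ k)%g x).
    by rewrite stab// (v_act' _ xn).
have perA : perm_eq [seq y ^+ (p ^ d) | y <- A] A.
  have AE : A = [seq red v (gact (g ^+ i)%g x) | i <- seq.iota 0 P] by [].
  have -> : [seq y ^+ (p ^ d) | y <- A] = [seq red v (gact (g ^+ i)%g x) | i <- seq.iota 1 P].
    rewrite AE -map_comp -[1%N]addn1 -[seq.iota (0 + 1) P]/(seq.iota (1 + 0) P) iotaDl -map_comp.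
    apply: eq_map => i /=; rewrite expgS gact_mul gd ?stab//.
    by rewrite (v_act' _ xn).
  rewrite AE; move: (P) P0 gPM => [|P'] // _ gPM'.
  have gx : red v (gact (g ^+ P'.+1)%g x) = red v x by exact: gPM' xn x0.
  have -> : seq.iota 1 P'.+1 = seq.iota 1 P' ++ [:: P'.+1].
    by have := iotaD 1 P' 1; rewrite addn1 add1n.
  by rewrite map_cat /= gx perm_catC /= expg0 gact_one.
have Qfrob i : Q`_i ^+ (p ^ d) = Q`_i.
  have frobd : exists h : {rmorphism residue v -> residue v}, forall y, h y = y ^+ (p ^ d).
    elim: (d) => [|d' [h hE]]; first by exists idfun => y; rewrite expr1.
    exists (h \o pFrobenius_aut pk)%FUN => y /=.
    by rewrite hE pFrobenius_autE -exprM expnS.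
  have [h hE] := frobd; rewrite -hE -coef_map; suff -> : map_poly h Q = Q by [].
  rewrite /Q rmorph_prod -[RHS](perm_big _ perA) [RHS]big_map.
  by apply: eq_bigr => y _; rewrite /= map_polyXsubC hE.
apply: (RP Q).
- by rewrite monic_neq0// monic_prod_XsubC.
- by rewrite size_prod_XsubC size_map size_iota.
- move=> i; have [z [zn z0 zQ]] := inQ i.
  have gz : red v (gact g z) = red v z by rewrite gd// zQ Qfrob.
  have guz u : red v (gact (g ^+ u)%g z) = red v z.
    rewrite gid//; elim: u => [|u IH]; first by rewrite mul0n expr1.
    by rewrite mulSn expnD exprM -gd// gz.
  have [|k k0 kz] := residue_fixed zn z0.
    move=> s; have [u uM] := gP n s.
    have -> : s = (g ^+ u * (g ^- u * s))%g by rewrite mulVKg.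
    rewrite gact_mul gid ?stab ?(v_act' _ zn)// uM// -gid//.
  by rewrite -zQ -kz; apply: rs0P => //; exact: base_tower.
- rewrite root_prod_XsubC; apply/mapP; exists 0%N; last by rewrite expg0 gact_one.
  by rewrite mem_iota.
Qed.

End ResidueTower.

(** * Coordinates on a procyclic group *)

(** The multiples of the least positive element [d] of [Z] fill [Z], and [d]
    divides [p ^ n]. *)
Lemma dvd_period (Z : nat -> Prop) p n : prime p ->
  Z 0%N -> (forall i j, Z i -> Z j -> Z (i + j)%N) ->
  (forall i j, Z i -> Z (i + j)%N -> Z j) -> Z (p ^ n)%N ->
  exists e, forall N, Z N <-> (p ^ e %| N)%N.
Proof.
move=> p_prime Z0 ZD ZB Zn.
have ex : exists d, (0 < d)%N && `[< Z d >].
  by exists (p ^ n)%N; rewrite expn_gt0 prime_gt0//; exact/asboolP.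
case: (ex_minnP ex) => d /andP[d0 /asboolP Zd] dmin.
have Zm k : Z (k * d)%N by elim: k => // k IH; rewrite mulSn; exact: ZD.
have ZP N : Z N <-> (d %| N)%N.
  split=> [ZN|/dvdnP[k ->]//]; rewrite /dvdn; apply/eqP/eqP; rewrite -leqn0 leqNgt.
  apply/negP => r0; have : (N %% d < d)%N by rewrite ltn_mod.
  rewrite ltnNge dmin// r0; apply/asboolP; apply: (ZB (N %/ d * d)%N) => //.
  by rewrite -divn_eq.
have /(dvdn_pfactor _ _ p_prime)[e _ de] : (d %| p ^ n)%N by apply/ZP.
by exists e => N; rewrite ZP de.
Qed.

Section NatValues.
Variables (p : nat) (p_prime : prime p).
Variables (Qp : fieldType) (vp : valuation Qp) (QpP : is_Qp p vp).

Lemma Qp_val_subn e m n :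
  (e%:R%:E <= vp (m%:R - n%:R)%R)%E <-> (m = n %[mod p ^ e])%N.
Proof.
wlog mn : m n / (n <= m)%N.
  move=> h; have [mn|/ltnW mn] := leqP n m; first exact: h.
  by rewrite -opprB valN h//; split.
have [->|ne] := eqVneq m n; first by rewrite subrr val0 leey.
have d0 : (0 < m - n)%N by rewrite subn_gt0 ltn_neqAle eq_sym ne.
rewrite -natrB// (Qp_val QpP)// lee_fin ler_nat -pfactor_dvdn// -eqn_mod_dvd//.
by split=> /eqP.
Qed.

(** Extract one p-adic digit after the other with [Qp_residue]. *)
Lemma Qp_nat_approx (z : Qp) k : (0 <= vp z)%E -> exists m : nat, (k%:R%:E <= vp (z - m%:R)%R)%E.
Proof.
elim: k z => [|k IH] z z0; first by exists 0%N; rewrite subr0.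
have [m zm] := Qp_residue p_prime QpP z0.
have p0 : p%:R != 0 :> Qp by rewrite (Qp_natr_neq0 QpP) ?prime_gt0.
have vpp := vp_p p_prime QpP.
have [|w wP] := IH ((z - m%:R) / p%:R).
  rewrite valM (valV_fin vpp).
  have [->|zm0] := eqVneq (z - m%:R) 0; first by rewrite val0.
  have [y yE] := vp_Z QpP zm0; move: zm; rewrite yE lte_fin ltr0z -EFinD lee_fin.
  by rewrite -[1]/(1%:~R) -rmorphB /= ler0z subr_ge0.
exists (m + p * w)%N.
have -> : z - (m + p * w)%N%:R = p%:R * ((z - m%:R) / p%:R - w%:R).
  by rewrite natrD natrM mulrBr mulrCA mulfV// mulr1 opprD addrA.
by rewrite valM vpp -natr1 addrC EFinD leeD.
Qed.
End NatValues.

Section Procyclic.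
Variables (p : nat) (p_prime : prime p).
Variables (Qp : fieldType) (vp : valuation Qp) (QpP : is_Qp p vp).
Variables (G : groupType) (M : nat -> G -> Prop).
Hypothesis M1 : forall n, M n 1%g.
Hypothesis MM : forall n s t, M n s -> M n t -> M n (s * t)%g.
Hypothesis MV : forall n s, M n s -> M n s^-1%g.
Hypothesis MJ : forall n s t, M n s -> M n (s ^ t)%g.
Hypothesis Mle : forall m n s, (m <= n)%N -> M n s -> M m s.
Variable g : G.
Hypothesis gM : forall n s, exists u : nat, M n (g ^- u * s)%g.
Hypothesis g_torsion : forall n, M n (g ^+ (p ^ n))%g.
Hypothesis g_infinite : forall P, (0 < P)%N -> ~ (forall n, M n (g ^+ P)%g).

Lemma procyclic_exponent n : exists e, forall N, M n (g ^+ N)%g <-> (p ^ e %| N)%N.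
Proof.
apply: (@dvd_period (fun N => M n (g ^+ N)%g) p n p_prime) => // [i j|i j].
  by rewrite expgnDr; exact: MM.
move=> Mi Mij; have -> : (g ^+ j = (g ^+ i)^-1 * g ^+ (i + j))%g by rewrite expgnDr mulKg.
by apply: MM => //; exact: MV.
Qed.

Let e n := sval (cid (procyclic_exponent n)).
Let eP n N : M n (g ^+ N)%g <-> (p ^ e n %| N)%N.
Proof. by rewrite /e; case: cid. Qed.

Let e_unbounded E : exists n, (E <= e n)%N.
Proof.
apply: contrapT => nE; apply: (@g_infinite (p ^ E)%N); first by rewrite expn_gt0 prime_gt0.
move=> n; apply/eP; rewrite dvdn_exp2l// leqNgt; apply/negP => /ltnW En.
by apply: nE; exists n.
Qed.

Let M_sub n k u : M n (g ^- k * g ^+ u)%g <-> ((e n)%:R%:E <= vp (u%:R - k%:R)%R)%E.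
Proof.
rewrite (Qp_val_subn p_prime QpP); have [ku|/ltnW uk] := leqP k u.
  have -> : (g ^- k * g ^+ u = g ^+ (u - k))%g by rewrite -[in LHS](subnKC ku) expgnDr mulKg.
  rewrite eP -eqn_mod_dvd//; split=> /eqP//.
have -> : (g ^- k * g ^+ u = (g ^+ (k - u))^-1)%g.
  by rewrite -[in LHS](subnKC uk) expgnDr invgM mulgVK.
split=> [/MV|/esym ku].
  by rewrite invgK eP -eqn_mod_dvd// => /eqP.
by apply/MV/eP; rewrite -eqn_mod_dvd//; apply/eqP.
Qed.

(** For each [n] choose [u n] such that [g ^ (u n)] agrees with [s] at level
    [n]. As [g ^ N] is trivial at level [n] exactly when [p ^ e n] divides [N],
    the [u n] form a Cauchy sequence, and the limit is the coordinate of [s].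
    *)
Lemma procyclic_coord s : exists z, (0 <= vp z)%E /\
  forall n k, ((e n)%:R%:E <= vp (z - k%:R)%R)%E <-> M n (g ^- k * s)%g.
Proof.
pose u n := sval (cid (gM n s)).
have uM n : M n (g ^- u n * s)%g by rewrite /u; case: cid.
have change n k : M n (g ^- k * s)%g <-> M n (g ^- k * g ^+ u n)%g.
  split=> h; first have -> : (g ^- k * g ^+ u n = g ^- k * s * (g ^- u n * s)^-1)%g.
  - by rewrite invgM invgK mulgA mulgK.
  - by apply: MM => //; exact: MV.
  have -> : (g ^- k * s = g ^- k * g ^+ u n * (g ^- u n * s))%g.
    by rewrite -!mulgA mulVKg.
  exact: MM.
have uC n m : (n <= m)%N -> ((e n)%:R%:E <= vp ((u n)%:R - (u m)%:R)%R)%E.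
  by move=> nm; apply/M_sub/change/(Mle nm).
have [r|l lP] := Qp_complete QpP (u := fun n => (u n)%:R).
  have [E rE] := rat_bound r; have [N EN] := e_unbounded E.
  have rN : (r%:E < (e N)%:R%:E)%E by rewrite lte_fin (lt_le_trans rE)// ler_nat.
  exists N => m n Nm Nn.
  rewrite (_ : _ - _ = ((u N)%:R - (u n)%:R) - ((u N)%:R - (u m)%:R)); last by ring.
  by apply: val_sub_gt; apply: lt_le_trans rN _; exact: uC.
have lu n : ((e n)%:R%:E <= vp (l - (u n)%:R)%R)%E.
  have [N NP] := lP (e n)%:R; pose m := maxn n N.
  have -> : l - (u n)%:R = - (((u m)%:R - l) + ((u n)%:R - (u m)%:R)) by ring.
  rewrite valN; apply: valD_ge; last by apply: uC; exact: leq_maxl.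
  by apply/ltW/NP; exact: leq_maxr.
exists l; split.
  rewrite -(subrK (u 0)%:R l); apply: valD_ge; last exact: val_nat_ge0.
  by apply: le_trans (lu 0%N); rewrite lee_fin.
move=> n k; rewrite change M_sub; split=> h.
  have -> : (u n)%:R - k%:R = (l - k%:R) - (l - (u n)%:R) :> Qp by ring.
  by apply: val_sub_ge.
rewrite -(subrK (u n)%:R l) -addrA; exact: valD_ge.
Qed.

Definition pcoord s := sval (cid (procyclic_coord s)).

Lemma pcoord_ge0 s : (0 <= vp (pcoord s))%E.
Proof. by rewrite /pcoord; case: cid => z []. Qed.

Let pcoordP s n k : ((e n)%:R%:E <= vp (pcoord s - k%:R)%R)%E <-> M n (g ^- k * s)%g.
Proof. by rewrite /pcoord; case: cid => z []. Qed.

Lemma pcoord_sub r : exists n, forall s t, M n (s^-1 * t)%g -> (r%:E < vp (pcoord t - pcoord s)%R)%E.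
Proof.
have [E rE] := rat_bound r; have [n En] := e_unbounded E.
exists n => s t st; have [u us] := gM n s.
apply: lt_le_trans (_ : ((e n)%:R%:E <= _)%E).
  by rewrite lte_fin (lt_le_trans rE)// ler_nat.
rewrite (_ : pcoord t - pcoord s = (pcoord t - u%:R) - (pcoord s - u%:R)); last by ring.
apply: val_sub_ge; apply/pcoordP => //.
have -> : (g ^- u * t = g ^- u * s * (s^-1 * t))%g by rewrite -!mulgA mulVKg.
exact: MM.
Qed.

Lemma pcoord_inj s t : pcoord s = pcoord t -> forall n, M n (s^-1 * t)%g.
Proof.
move=> st n; have [u us] := gM n s; have := us; rewrite -pcoordP st pcoordP => ut.
have -> : (s^-1 * t = (g ^- u * s)^-1 * (g ^- u * t))%g.
  by rewrite invgM invgK -!mulgA mulVKg.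
by apply: MM => //; exact: MV.
Qed.

Let big_e0 z : (forall n, ((e n)%:R%:E <= vp z)%E) -> z = 0.
Proof.
move=> ez; apply: (@val_ge_all0 _ vp _ 0) => k; have [n kn] := e_unbounded k.
by apply: le_trans (ez n); rewrite subr0 lee_fin ler_nat.
Qed.

Lemma pcoordM s t : pcoord (s * t)%g = pcoord s + pcoord t.
Proof.
apply/eqP; rewrite -subr_eq0; apply/eqP/big_e0 => n.
have [u us] := gM n s; have [w wt] := gM n t.
have -> : pcoord (s * t)%g - (pcoord s + pcoord t) =
  (pcoord (s * t)%g - (u + w)%N%:R) - ((pcoord s - u%:R) + (pcoord t - w%:R)).
  by rewrite natrD; ring.
apply: val_sub_ge; last by apply: valD_ge; exact/pcoordP.
apply/pcoordP; have -> : (g ^- (u + w) * (s * t) = (g ^- u * s) ^ (g ^+ w) * (g ^- w * t))%g.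
  by rewrite expgnDr invgM /conjg -!mulgA mulVKg.
by apply: MM => //; exact: MJ.
Qed.

Hypothesis M_cluster : forall t : nat -> G,
  exists s, forall n N, exists2 m, (N <= m)%N & M n ((t m)^-1 * s)%g.

Lemma pcoord_surj z : (0 <= vp z)%E -> exists s, pcoord s = z.
Proof.
move=> z0.
have [k kz] := choice (fun m => Qp_nat_approx p_prime QpP m z0).
have [s sP] := M_cluster (fun m => g ^+ (k m))%g.
exists s; apply/eqP; rewrite -subr_eq0; apply/eqP/big_e0 => n.
have [m em /pcoordP ms] := sP n (e n).
have -> : pcoord s - z = (pcoord s - (k m)%:R) - (z - (k m)%:R) by ring.
apply: val_sub_ge => //; apply: le_trans (kz m).
by rewrite lee_fin ler_nat.
Qed.

(** The map [kappa] is the inverse limit of the discrete logarithms with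
    respect to [g] in the cyclic groups of order [p ^ e n], and [e] is
    unbounded. *)
Lemma procyclic_iso : exists kappa : G -> Qp,
  [/\ forall s, (0 <= vp (kappa s))%E,
      forall s t, kappa (s * t)%g = kappa s + kappa t,
      forall s t, kappa s = kappa t <-> (forall n, M n (s^-1 * t)%g),
      forall r : rat, exists n, forall s t, M n (s^-1 * t)%g ->
        (r%:E < vp (kappa t - kappa s)%R)%E &
      forall z, (0 <= vp z)%E -> exists s, kappa s = z].
Proof.
exists pcoord; split; [exact: pcoord_ge0|exact: pcoordM|move=> s t; split|exact: pcoord_sub|exact: pcoord_surj].
  exact: pcoord_inj.
move=> st; apply/eqP; rewrite eq_sym -subr_eq0; apply/eqP/(@val_ge_all0 _ vp _ 0) => k.
by have [n nP] := pcoord_sub k%:R; rewrite subr0; apply/ltW/(nP s t).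
Qed.

End Procyclic.

(** * The Galois group of the residue field *)

Lemma valuation_ring_hausdorff (F : fieldType) (w : valuation F) :
  hausdorff_space (valuation_ring w).
Proof.
have ball (x : valuation_ring w) (r : rat) :
    nbhs x [set y : valuation_ring w | (r%:E < w (val y - val x)%R)%E].
  apply: open_nbhs_nbhs; split; last by rewrite /= subrr val0 ltey.
  have oB : @valued_open _ w [set y | (r%:E < w ((y : F) - val x)%R)%E].
    by move=> y /= yx; exists r => z zy; rewrite -(subrKA (y : F)); exact: valD_gt.
  by exists [set y : valued w | (r%:E < w ((y : F) - val x)%R)%E].
move=> x y xy; apply/val_inj/eqP; rewrite -subr_eq0; apply/eqP.
apply: (@val_ge_all0 _ w _ 0) => k; rewrite subr0.
have [z [/= zx zy]] := xy _ _ (ball x k%:R) (ball y k%:R).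
have -> : val x - val y = (val z - val y) - (val z - val x) by ring.
by apply: val_sub_ge; exact: ltW.
Qed.

Section ResidueGalois.
Variables (p : nat) (p_prime : prime p).
Variables (Qp : fieldType) (vp : valuation Qp) (QpP : is_Qp p vp).
Variables (K : fieldExtType Qp) (F : closedFieldType) (iota : {rmorphism K -> F}).
Hypothesis F_alg : forall x : F, algebraicOver iota x.
Variables (v : valuation F).
Hypothesis v_ext : forall x : Qp, v (iota x%:A) = vp x.
Variables (c a : K).
Hypothesis v_c : v (iota c) = (- (p%:R / (p%:R - 1)))%:E.
Hypothesis a_dist : forall m : nat, distinct_preimages iota p c a m.
Local Notation f := (unicritical p (iota c)).
Local Notation tower := (tower iota p c a).
Local Notation tower_infty := (tower_infty iota p c a).
Local Notation Goo := (galois_group iota tower_infty).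
Local Notation Ioo := (inertia_group iota tower_infty v : groupClosed Goo).
Variable b : F.
Hypothesis b_fix : f b = b.
Hypothesis mu : contains_mu iota p.
Local Notation M := (@res_trivial p Qp K F iota v c a).

(** The coordinate of [procyclic_iso] has kernel the inertia group, and is
    continuous since it only depends, up to a given precision, on the action on
    one level. Compactness of the Galois group makes the inverse continuous. *)
Lemma infinite_quotient (nI : is_normal Ioo) :
  topgroup_isog (quotient_group nI) (valuation_ring vp).
Proof.
have sub n : {subset tower n <= tower_infty} by move=> x; exact: (tower_sub_infty p_prime).
have [g gM] := topological_generator p_prime QpP F_alg v_ext a_dist.
have M_close n (s t : Goo) : {in tower n, gact s =1 gact t} -> M n (s^-1 * t)%g.
  move=> st; apply: (@res_trivial_agree p Qp K F iota v c a n 1%g); last exact: res_trivial1.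
  by move=> x xn; rewrite gact_one gact_mul -st// gactVK.
have [||||||||kappa [k0 kM kE kC kS]] := @procyclic_iso p p_prime Qp vp QpP Goo M _ _ _ _ _ g gM _ _.
- exact: res_trivial1.
- by move=> n s *; apply: (res_trivialM p_prime QpP F_alg v_ext).
- by move=> n s *; apply: (res_trivialV p_prime QpP F_alg v_ext).
- by move=> n s *; apply: (res_trivialJ p_prime QpP F_alg v_ext).
- by move=> m n s; exact: (res_trivial_le p_prime).
- by move=> n; exact: (res_trivial_torsion p_prime mu).
- move=> P; exact: (generator_infinite p_prime QpP F_alg v_ext v_c a_dist b_fix mu gM).
- move=> t; have [s sP] := infty_cluster p_prime F_alg a_dist t; exists s => n N.
  by have [m Nm ms] := sP n N; exists m => //; apply: M_close => x xn; rewrite ms.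
have kI s t : kappa s = kappa t <-> (s^-1 * t)%g \in Ioo.
  by rewrite kE -(inertia_res_trivial p_prime QpP F_alg v_ext).
pose Q := quotient_group nI.
have k0' s : kappa s \in val_ring vp by rewrite inE.
pose fQ (q : Q) : valuation_ring vp := exist _ (kappa (repr q)) (k0' (repr q)).
have fpi s : val (fQ (\pi_Q%qT s)) = kappa s.
  by apply/kI; apply/(@quot_eqP _ _ nI); rewrite reprK.
have [h hP] := choice (fun z : valuation_ring vp => kS (val z) (valP z)).
pose gQ z : Q := \pi_Q%qT (h z).
have fgK : cancel fQ gQ.
  by elim/quotW=> s; apply/(@quot_eqP _ _ nI)/kI; rewrite hP fpi.
have gfK : cancel gQ fQ by move=> z; apply: val_inj; rewrite fpi hP.
have piC : continuous (\pi_Q%qT : Goo -> Q).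
  by apply/continuousP => U; exact.
have fC : continuous fQ.
  apply/continuousP => _ [C oC <-].
  suff : open (\pi_Q%qT @^-1` (fQ @^-1` (val @^-1` C)) : set Goo) by [].
  have -> : \pi_Q%qT @^-1` (fQ @^-1` (val @^-1` C)) = [set s : Goo | C (kappa s)].
    by apply/funext => s; rewrite -[RHS]/(C (kappa s)) -fpi.
  apply/gal_openP => s /= Cs; have [r rC] : exists r : rat,
    forall y : Qp, (r%:E < vp (y - kappa s)%R)%E -> C y by exact: oC.
  have [n nP] := kC r.
  have [rs [_ rsn _]] := preimages_enum p_prime a_dist n.
  exists rs => t /= st; apply/rC/nP/M_close.
  apply: (tower_agree (sub n) (sub n)) => z.
  by rewrite -rsn; exact: st.
have cQ : compact [set: Q].
  have -> : [set: Q] = (\pi_Q%qT : Goo -> Q) @` [set: Goo].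
    by apply/seteqP; split=> // q _; exists (repr q); rewrite ?reprK.
  apply: continuous_compact; first exact: continuous_subspaceT.
  by apply: gal_compact => // k; exact: (base_infty p_prime).
exists fQ, gQ; split=> //.
  elim/quotW=> s; elim/quotW=> t; apply: val_inj.
  by rewrite -quot_piM fpi kM -!fpi.
exact: (compact_bij_continuous cQ (@valuation_ring_hausdorff _ vp) fC fgK gfK).
Qed.

End ResidueGalois.

(** * Galois and inertia groups of the tower *)

Theorem theorem5p1
    (p : nat) (p_prime : prime p)
    (Qp : fieldType) (vp : valuation Qp) (QpP : is_Qp p vp)
    (K : fieldExtType Qp)
    (Kbar : closedFieldType) (iota : {rmorphism K -> Kbar})
    (Kbar_alg : forall x : Kbar, algebraicOver iota x)
    (v : valuation Kbar) (v_ext : forall x : Qp, v (iota x%:A) = vp x)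
    (c : K) (c_neq0 : c != 0)
    (v_c : v (iota c) = (- (p%:R / (p%:R - 1)))%:E)
    (a : K) (a_dist : forall m : nat, distinct_preimages iota p c a m)
    (n : nat)
    (b : Kbar) (b_fix : unicritical p (iota c) b = b) :
  let K_n : divringClosed Kbar := tower iota p c a n in
  let K_oo : divringClosed Kbar := tower_infty iota p c a in
  let I_n : groupClosed (galois_group iota K_n) := inertia_group iota K_n v in
  let I_oo : groupClosed (galois_group iota K_oo) := inertia_group iota K_oo v in
  (contains_mu iota p -> exists nI : is_normal I_n,
     is_cyclic (quotient_group nI) /\ finite_pgroup p (quotient_group nI)) /\
  finite_pgroup p (subgroup_of I_n) /\
  ((v (iota c) < v (iota a))%E ->
     is_pelem p (subgroup_of I_n) /\
     (exists2 m : nat, has_order (subgroup_of I_n) m & (m %| p ^ n)%N)) /\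
  (contains_mu iota p -> exists nI : is_normal I_oo,
     topgroup_isog (quotient_group nI) (valuation_ring vp)) /\
  ((v (iota a - b)%R < 0)%E ->
     (infinite_set [set: subgroup_of I_oo] /\ is_pro_p p (subgroup_of I_oo)) /\
     ((v (iota c) < v (iota a))%E ->
        topgroup_isog (subgroup_of I_oo) (Zmodp_infty p))) /\
  ((0 <= v (iota a - b)%R)%E ->
     [set s | s \in I_oo] = [set 1%g]).
Proof.

Proof.
move=> K_n K_oo I_n I_oo.
have KT k : iota k \in K_oo by exact: (base_infty p_prime).
split; [|split; [|split; [|split; [|split]]]].
- move=> mu; exists (inertia_is_normal p_prime QpP Kbar_alg v_ext (base_tower p iota c a n)).
  exact: (level_quotient p_prime QpP Kbar_alg v_ext a_dist).
- exact: (level_inertia_pgroup p_prime QpP v_ext v_c a_dist).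
- exact: (level_inertia_pelem p_prime QpP v_ext v_c a_dist).
- move=> mu; exists (inertia_is_normal p_prime QpP Kbar_alg v_ext KT).
  exact: (infinite_quotient p_prime QpP Kbar_alg v_ext v_c a_dist b_fix mu).
- move=> ab; split.
    split; first exact: (infinite_inertia p_prime QpP Kbar_alg v_ext v_c a_dist b_fix ab).
    exact: (inertia_pro_p p_prime QpP Kbar_alg v_ext v_c a_dist).
  exact: (inertia_elementary p_prime QpP Kbar_alg v_ext v_c a_dist b_fix ab).
- move=> ab; apply/seteqP; split=> [s sI|_ ->]; last exact: gpred1.
  exact: (inertia_trivial p_prime QpP v_ext v_c b_fix ab sI).
Qed.
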